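(* Let $M$ be an $n$-dimensional manifold endowed with an equiprojective $SL(n,\mathbb{R})$-structure $(\eta,\nabla)$. Then there exists a local coordinate system $x^1,\dots,x^n$ in which the components $\varphi_{i_1\dots i_p}$ of an arbitrary Killing tensor $\varphi$ of degree $p$ can be expressed in the form of a $p$-th degree polynomial in the $x^i$'s: $$\varphi_{i_1\dots i_p}=e^{2p\psi}\sum_{q=0}^{p}A_{i_1\dots i_pj_1\dots j_q}x^{j_1}\cdots x^{j_q}$$ (summation over repeated indices), where $\psi=(n+1)^{-1}\ln(\eta)$ and where the coefficients $A_{i_1\dots i_pj_1\dots j_q}$ are constant and symmetric in the set of indices $i_1,\dots,i_p$ and in the set of indices $j_1,\dots,j_q$. In addition to these properties, the coefficients have the following symmetries: $$\sum_{cicl}\{A_{i_1\dots i_pj_1\dots j_{p-s}}\}_{j_{p-s+1}}=0\quad\text{for } s=1,\dots,p-1,$$ and $$\sum_{cicl}\{A_{i_1\dots i_pj_1}\}=0.$$ Here $\sum_{cicl}$ denotes the sum of the terms obtained by a cyclic permutation of the indices enclosed in the braces; in the first relation the summed quantity is the coefficient $A_{i_1\dots i_pj_1\dots j_{p-s}j_{p-s+1}}$, with the last index $j_{p-s+1}$ outside the braces and kept fixed.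
   Context: $M$ is a connected differentiable manifold of dimension $n>2$. An equiaffine $SL(n,\mathbb{R})$-structure on $M$ is a pair $(\eta,\nabla)$, where $\eta$ is a nowhere vanishing $n$-form (volume element) and $\nabla$ is a torsion-free linear connection with $\nabla\eta=0$ (so its Ricci tensor is symmetric). It is called equiprojective if its Weyl projective curvature tensor vanishes, i.e. the curvature tensor satisfies $R=(n-1)^{-1}[\mathrm{id}_M\otimes Ric-Ric\otimes \mathrm{id}_M]$, that is, $R(X,Y)Z=\frac{1}{n-1}\left(Ric(Y,Z)X-Ric(X,Z)Y\right)$ for all vector fields $X,Y,Z$, where $Ric(Y,Z)=\mathrm{trace}(X\mapsto R(X,Y)Z)$. In the formula for $\psi$, the symbol $\eta$ stands for the (positive) component $\eta_{1\dots n}$ of the volume element in the coordinates $x^1,\dots,x^n$. A symmetric covariant tensor field $\varphi$ of degree $p$ on $M$ is called a Killing tensor of degree $p$ if $\varphi\left(\frac{d\gamma}{dt},\dots,\frac{d\gamma}{dt}\right)$ is constant along every geodesic $\gamma$ of $\nabla$ with affine parameter $t$; equivalently, the sum of the terms obtained from $\nabla_{i_0}\varphi_{i_1\dots i_p}$ by cyclic permutation of $i_0,i_1,\dots,i_p$ vanishes.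
   Formalization: For p≥3 and s<p−1 the literal cyclic sum in the first relation fails, e.g. for (u_1x_2−u_2x_1)^3 on flat space; there it is read as the sum over all permutations of the indices in braces. For s=p−1 and in the second relation the cyclic sum itself is proved. *)

(* Defs.v *)
From HB Require Import structures.
From mathcomp Require Import all_boot all_order all_algebra perm.
From mathcomp Require Import all_classical all_reals all_analysis.

Set Implicit Arguments.
Unset Strict Implicit.
Unset Printing Implicit Defensive.

Import Order.TTheory GRing.Theory Num.Theory.
Import numFieldNormedType.Exports.

Local Open Scope classical_set_scope.
Local Open Scope ring_scope.

(* The coordinates x^1, ..., x^n are the entries x 0 0, ..., x 0 (n-1) of a row
   vector x. *)

Section SmoothFunctions.
Context {R : realType} {n : nat}.

Definition pd (i : 'I_n) (f : 'rV[R]_n -> R) : 'rV[R]_n -> R :=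
  fun x => 'D_(delta_mx 0 i) f x.

(* For U open this is C^oo on U: differentiability of every iterated partial
   derivative makes all of them continuous. *)
Definition smooth_on (U : set 'rV[R]_n) (f : 'rV[R]_n -> R) : Prop :=
  forall (s : seq 'I_n) (x : 'rV[R]_n), U x -> differentiable (foldr pd f s) x.

End SmoothFunctions.

Section Manifolds.
Context {R : realType} {n : nat} {M : topologicalType}.

(* [cmap] is only meaningful on [cdom], and [cinv] on [cimg]; the values
   elsewhere are junk. *)
Record chart := Chart {
  cdom : set M;
  cmap : M -> 'rV[R]_n;
  cinv : 'rV[R]_n -> M }.

Definition cimg (c : chart) : set 'rV[R]_n := cmap c @` cdom c.

Definition is_chart (c : chart) : Prop :=
  [/\ open (cdom c), open (cimg c),
      forall m, cdom c m -> cinv c (cmap c m) = m,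
      forall m, cdom c m -> {for m, continuous (cmap c)}
    & forall x, cimg c x -> {for x, continuous (cinv c)}].

Definition overlap (c d : chart) : set 'rV[R]_n :=
  cmap c @` (cdom c `&` cdom d).

Definition trans (c d : chart) (x : 'rV[R]_n) : 'rV[R]_n := cmap d (cinv c x).

Definition compatible (c d : chart) : Prop :=
  forall a : 'I_n,
    smooth_on (overlap c d) (fun x => trans c d x 0 a) /\
    smooth_on (overlap d c) (fun x => trans d c x 0 a).

(* The atlas is maximal, so its members are all the local coordinate systems
   of the manifold. *)
Definition smooth_atlas (atlas : set chart) : Prop :=
  [/\ forall c, atlas c -> is_chart c,
      forall m, exists2 c, atlas c & cdom c m,
      forall c d, atlas c -> atlas d -> compatible c d
    & forall c, is_chart c -> (forall d, atlas d -> compatible c d) -> atlas c].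

Definition connected_manifold (atlas : set chart) : Prop :=
  [/\ hausdorff_space M, @second_countable M, connected [set: M]
    & smooth_atlas atlas].

Definition jac (c d : chart) (x : 'rV[R]_n) (a i : 'I_n) : R :=
  pd i (fun z => trans c d z 0 a) x.

Definition hess (c d : chart) (x : 'rV[R]_n) (a i j : 'I_n) : R :=
  pd i (pd j (fun z => trans c d z 0 a)) x.

(* Tensor fields and connections are given classically, by their components in
   every coordinate system together with the transformation law. *)
Definition cov_components (p : nat) : Type :=
  chart -> 'rV[R]_n -> p.-tuple 'I_n -> R.

Definition cov_tensor (atlas : set chart) (p : nat) (T : cov_components p) :
    Prop :=
  (forall c i, atlas c -> smooth_on (cimg c) (fun x => T c x i)) /\
  (forall c d x i, atlas c -> atlas d -> overlap c d x ->
     T c x i = \sum_(j : p.-tuple 'I_n)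
       (\prod_(a < p) jac c d x (tnth j a) (tnth i a)) * T d (trans c d x) j).

Definition permute (m : nat) (s : 'S_m) (i : m.-tuple 'I_n) : m.-tuple 'I_n :=
  [tuple tnth i (s a) | a < m].

Definition symmetric_tensor (atlas : set chart) (p : nat)
    (T : cov_components p) : Prop :=
  cov_tensor atlas T /\
  forall c x i (s : 'S_p), atlas c -> cimg c x -> T c x (permute s i) = T c x i.

Definition volume_component (eta : cov_components n) (c : chart)
    (x : 'rV[R]_n) : R := eta c x (ord_tuple n).

Definition volume_element (atlas : set chart) (eta : cov_components n) : Prop :=
  [/\ cov_tensor atlas eta,
      forall c x i (s : 'S_n), atlas c -> cimg c x ->
        eta c x (permute s i) = (-1) ^+ s * eta c x i
    & forall c x, atlas c -> cimg c x -> volume_component eta c x != 0].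

(* [G c x i j k] is the coefficient Gamma^i_{jk} at the point of coordinates x:
   nabla_{d_j} d_k = Gamma^i_{jk} d_i. *)
Definition conn_components : Type :=
  chart -> 'rV[R]_n -> 'I_n -> 'I_n -> 'I_n -> R.

(* With y = trans c d x, the second condition is
   (dy^a/dx^i) Gamma^i_{jk}(x)
     = d^2 y^a / dx^j dx^k
       + Gamma'^a_{bc}(y) (dy^b/dx^j) (dy^c/dx^k). *)
Definition linear_connection (atlas : set chart) (G : conn_components) : Prop :=
  (forall c i j k, atlas c -> smooth_on (cimg c) (fun x => G c x i j k)) /\
  (forall c d x a j k, atlas c -> atlas d -> overlap c d x ->
     \sum_(i < n) jac c d x a i * G c x i j k =
     hess c d x a j k +
     \sum_(b < n) \sum_(e < n)
       G d (trans c d x) a b e * jac c d x b j * jac c d x e k).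

Definition torsion_free (atlas : set chart) (G : conn_components) : Prop :=
  forall c x i j k, atlas c -> cimg c x -> G c x i j k = G c x i k j.

Definition replace_index (p : nat) (i : p.-tuple 'I_n) (a : 'I_p) (l : 'I_n) :
    p.-tuple 'I_n :=
  [tuple (if b == a then l else tnth i b) | b < p].

(* (nabla_k T)_{i_1 ... i_p} *)
Definition cov_deriv (G : conn_components) (p : nat) (T : cov_components p)
    (c : chart) (x : 'rV[R]_n) (k : 'I_n) (i : p.-tuple 'I_n) : R :=
  pd k (fun z => T c z i) x -
  \sum_(a < p) \sum_(l < n) G c x l k (tnth i a) * T c x (replace_index i a l).

Definition parallel (atlas : set chart) (G : conn_components) (p : nat)
    (T : cov_components p) : Prop :=
  forall c x k i, atlas c -> cimg c x -> cov_deriv G T c x k i = 0.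

Definition equiaffine (atlas : set chart) (eta : cov_components n)
    (G : conn_components) : Prop :=
  [/\ volume_element atlas eta, linear_connection atlas G,
      torsion_free atlas G & parallel atlas G eta].

(* Component along d_i of R(d_k, d_l) d_j, where
   R(X,Y) = [nabla_X, nabla_Y] - nabla_[X,Y]. *)
Definition curv_coef (G : conn_components) (c : chart) (x : 'rV[R]_n)
    (i j k l : 'I_n) : R :=
  pd k (fun z => G c z i l j) x - pd l (fun z => G c z i k j) x +
  \sum_(m < n) (G c x i k m * G c x m l j - G c x i l m * G c x m k j).

(* R(X,Y)Z for tangent vectors given by their components in the chart c. *)
Definition curvature (G : conn_components) (c : chart) (x X Y Z : 'rV[R]_n) :
    'rV[R]_n :=
  \row_i \sum_(j < n) \sum_(k < n) \sum_(l < n)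
    curv_coef G c x i j k l * X 0 k * Y 0 l * Z 0 j.

(* trace (X |-> R(X,Y)Z) *)
Definition ricci (G : conn_components) (c : chart) (x Y Z : 'rV[R]_n) : R :=
  \sum_(k < n) curvature G c x (delta_mx 0 k) Y Z 0 k.

Definition projectively_flat (atlas : set chart) (G : conn_components) : Prop :=
  forall c x (X Y Z : 'rV[R]_n), atlas c -> cimg c x ->
    curvature G c x X Y Z =
    (n%:R - 1)^-1 *: (ricci G c x Y Z *: X - ricci G c x X Z *: Y).

Definition equiprojective (atlas : set chart) (eta : cov_components n)
    (G : conn_components) : Prop :=
  equiaffine atlas eta G /\ projectively_flat atlas G.

Definition coord (c : chart) (gamma : R -> M) (i : 'I_n) : R -> R :=
  fun t => cmap c (gamma t) 0 i.

Definition velocity (c : chart) (gamma : R -> M) (t : R) (i : 'I_n) : R :=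
  derive1 (coord c gamma i) t.

(* gamma restricted to the open interval ]a, b[ is a geodesic with affine
   parameter. *)
Definition geodesic (atlas : set chart) (G : conn_components)
    (gamma : R -> M) (a b : R) : Prop :=
  (forall t, a < t < b -> {for t, continuous gamma}) /\
  (forall c t i, atlas c -> a < t < b -> cdom c (gamma t) ->
     [/\ derivable (coord c gamma i) t 1,
         derivable (derive1 (coord c gamma i)) t 1
       & derive1 (derive1 (coord c gamma i)) t +
         \sum_(j < n) \sum_(k < n)
           G c (cmap c (gamma t)) i j k *
           velocity c gamma t j * velocity c gamma t k = 0]).

(* T(dgamma/dt, ..., dgamma/dt) at time t, computed in the chart c. *)
Definition eval_velocity (p : nat) (T : cov_components p) (c : chart)
    (gamma : R -> M) (t : R) : R :=
  \sum_(i : p.-tuple 'I_n)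
    T c (cmap c (gamma t)) i * \prod_(a < p) velocity c gamma t (tnth i a).

Definition killing_tensor (atlas : set chart) (G : conn_components) (p : nat)
    (phi : cov_components p) : Prop :=
  symmetric_tensor atlas phi /\
  forall gamma a b, geodesic atlas G gamma a b ->
  forall t1 t2 c1 c2, a < t1 < b -> a < t2 < b -> atlas c1 -> atlas c2 ->
    cdom c1 (gamma t1) -> cdom c2 (gamma t2) ->
    eval_velocity phi c1 gamma t1 = eval_velocity phi c2 gamma t2.

Definition psi (eta : cov_components n) (c : chart) (x : 'rV[R]_n) : R :=
  n.+1%:R^-1 * ln (volume_component eta c x).

End Manifolds.

Arguments chart : clear implicits.
Arguments cov_components : clear implicits.
Arguments conn_components : clear implicits.

Section Coefficients.
Context {R : realType} {n : nat}.

(* The coefficient A_{i_1 ... i_p j_1 ... j_q} is [A (i ++ j)], with i a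
   p-tuple and j a q-tuple of indices; q is recovered from the length. *)

Definition poly_part (p : nat) (A : seq 'I_n -> R) (i : p.-tuple 'I_n)
    (x : 'rV[R]_n) : R :=
  \sum_(q < p.+1) \sum_(j : q.-tuple 'I_n)
    A (val i ++ val j) * \prod_(a < q) x 0 (tnth j a).

Definition coef_symmetric (p : nat) (A : seq 'I_n -> R) : Prop :=
  forall (q : nat) (i i' : p.-tuple 'I_n) (j j' : q.-tuple 'I_n),
    (q <= p)%N -> perm_eq i i' -> perm_eq j j' ->
    A (val i ++ val j) = A (val i' ++ val j').

Definition cyclic_sum (A : seq 'I_n -> R) (k l : seq 'I_n) : R :=
  \sum_(r < size k) A (rot r k ++ l).

Definition permutation_sum (A : seq 'I_n -> R) (m : nat) (k : m.-tuple 'I_n)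
    (l : seq 'I_n) : R :=
  \sum_(s : 'S_m) A (val (permute s k) ++ l).

(* When p + 1 indices are enclosed in the braces, the p + 1 rotations produce
   each term of the symmetrization exactly once (A being symmetric in the two
   groups of indices).  With more enclosed indices they do not, and the bare
   sum over rotations need not vanish: for n >= 2, p = 3, s = 1 it is nonzero
   for the flat Killing tensor (u_1 x_2 - u_2 x_1)^3.  There the braces denote
   the symmetrization over all the enclosed indices. *)
Definition coef_relations (p : nat) (A : seq 'I_n -> R) : Prop :=
  [/\ forall (s : nat) (k : (p + (p - s)).-tuple 'I_n) (l : 'I_n),
        (1 <= s <= p - 1)%N -> permutation_sum A k [:: l] = 0,
      forall (s : nat) (k : (p + (p - s)).-tuple 'I_n) (l : 'I_n),
        (1 <= s <= p - 1)%N -> s = (p - 1)%N -> cyclic_sum A k [:: l] = 0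
    & forall k : (p + 1).-tuple 'I_n, cyclic_sum A k [::] = 0].

End Coefficients.

(* Main.v *)
Require Import Defs.
From HB Require Import structures.
From mathcomp Require Import all_boot all_order all_algebra perm.
From mathcomp Require Import all_classical all_reals all_analysis.
From mathcomp Require Import ring lra zify.
Import Order.TTheory GRing.Theory Num.Theory.
Import numFieldNormedType.Exports.
Set Implicit Arguments.
Unset Strict Implicit.
Unset Printing Implicit Defensive.
Local Open Scope classical_set_scope.
Local Open Scope ring_scope.

(** The integrable system is solved along rays from the origin: each ray carries a linear ordinary
    equation, and the value at time 1 is taken as the value of the solution at the end point.
    Integrability enters when this function is differentiated across the rays. The ball is so small
    that the ray operator has norm at most 1/2; Picard iteration then contracts on all of [0, 1]
    whatever the initial value, so one ball serves all n + 1 solutions. The n + 1 in psi is the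
    trace of the normal form, Gamma^a_ka = (n + 1) theta_k, which parallelism equates with the
    logarithmic derivative of eta. Positivity of eta is arranged beforehand by reflecting one
    coordinate if necessary. For the coefficients, comparing the points t u and t (v + u) shows that
    each homogeneous component P_q(v; u) of F is invariant under u -> u + v. At u = 0 this gives
    P_q(v; v) = 0; to first order around u = 0 it gives the relations with one index kept outside
    the braces. *)

(* Projective flatness makes the linear system [nabla_i d_j f = - P_ij f] for
   [(f, df)], with [P = Ric / (n - 1)], integrable: for [n > 2] the first Bianchi
   identity shows that [P] is symmetric, and the second one that
   [nabla_i P_jk = nabla_j P_ik].  It thus has solutions with arbitrary initial
   value.  If [f_0, ..., f_n] are the solutions with [f_0 = 1],
   [df_0 = 0] and [f_a = 0], [df_a = dx^a] at the given point, the quotients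
   [f_a / f_0] are coordinates in which
   [Gamma^a_bc = delta^a_b theta_c + delta^a_c theta_b], so geodesics are straight
   lines, and [nabla eta = 0] forces [theta = d psi].

   Along such a line the velocity is proportional to [exp (- 2 psi)], hence for a
   Killing tensor [phi] the functions [F = exp (- 2 p psi) phi] satisfy
   [F_x(z - x, ..., z - x) = F_z(z - x, ..., z - x)].  For fixed [z] the right-hand
   side is polynomial in [x]; taking the top-degree part in [z] of the left-hand
   side by finite differences recovers [F_x], which is therefore a polynomial of
   degree at most [p].  Expanding the same identity in homogeneous components
   gives the relations between its coefficients. *)

(** * Differential calculus on row vectors *)

Section Calculus.
Context {R : realType}.
Implicit Types n m : nat.

Lemma coord_le n (v : 'rV[R]_n) i : `|v 0 i| <= `|v|.
Proof.
rewrite [leRHS]/Num.Def.normr/= mx_normrE.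
exact: (le_bigmax _ (fun ij : 'I_1 * 'I_n => `|v ij.1 ij.2|) (0, i)).
Qed.

Lemma rV_norm_le n (v : 'rV[R]_n) c :
  0 <= c -> (forall i, `|v 0 i| <= c) -> `|v| <= c.
Proof.
move=> c0 H; rewrite [leLHS]/Num.Def.normr/= mx_normrE.
apply: bigmax_le => // -[i j] _ /=; rewrite (ord1 i); exact: H.
Qed.

Lemma rV_norm_lt n (v : 'rV[R]_n) c :
  0 < c -> (forall i, `|v 0 i| < c) -> `|v| < c.
Proof.
move=> c0 H; rewrite [ltLHS]/Num.Def.normr/= mx_normrE.
apply: bigmax_lt => // -[i j] _ /=; rewrite (ord1 i); exact: H.
Qed.

Lemma norm_delta_mx n (i : 'I_n) : `|delta_mx 0 i : 'rV[R]_n| <= 1.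
Proof.
apply: rV_norm_le => // j; rewrite mxE eqxx /=.
by case: (j == i); rewrite ?normr1 ?normr0.
Qed.

Lemma derive_pd n (f : 'rV[R]_n -> R) x v : differentiable f x ->
  'D_v f x = \sum_i v 0 i * pd i f x.
Proof.
move=> df; rewrite deriveE // {1}(row_sum_delta v) linear_sum /=.
by apply: eq_bigr => i _; rewrite linearZ /= /pd deriveE.
Qed.

Lemma differentiable_rV n m (g : 'rV[R]_n -> 'rV[R]_m) x :
  (forall a, differentiable (fun z => g z 0 a) x) -> differentiable g x.
Proof.
move=> dg.
rewrite (_ : g = \sum_(a < m) (fun z => g z 0 a *: (delta_mx 0 a : 'rV[R]_m))).
  by apply: differentiable_sum => a; apply: differentiableZl.
by apply/funext => z; rewrite fct_sumE {1}(row_sum_delta (g z)).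
Qed.

Lemma derivable_curve n (y : R -> 'rV[R]_n) (y' : 'rV[R]_n) (t : R) :
  (forall i, is_derive t 1 (fun s => y s 0 i) (y' 0 i)) -> is_derive t 1 y y'.
Proof.
move=> dy; have dr : derivable y t 1.
  by apply/derivable_mxP => i j; rewrite (ord1 i); have [] := dy j.
apply: DeriveDef => //; apply/rowP => j; rewrite derive_mx // mxE.
exact: derive_val.
Qed.

Lemma is_derive_curve n (f : 'rV[R]_n -> R) (y : R -> 'rV[R]_n)
    (y' : 'rV[R]_n) (t : R) :
  (forall i, is_derive t 1 (fun s => y s 0 i) (y' 0 i)) ->
  differentiable f (y t) ->
  is_derive t 1 (fun s => f (y s)) (\sum_i y' 0 i * pd i f (y t)).
Proof.
move=> /derivable_curve dy df.
have ddy : differentiable y t by apply/derivable1_diffP; have [] := dy.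
have dfy : differentiable (f \o y) t by apply: differentiable_comp.
apply: DeriveDef; first exact/derivable1_diffP.
have dyt : 'd y t 1 = y' by rewrite -deriveE // derive_val.
by rewrite -[LHS]/('D_1 (f \o y) t) deriveE // diff_comp //= dyt -derive_pd // deriveE.
Qed.

Lemma pd_comp n m (f : 'rV[R]_m -> R) (g : 'rV[R]_n -> 'rV[R]_m) x i :
  (forall a, differentiable (fun z => g z 0 a) x) -> differentiable f (g x) ->
  pd i (fun z => f (g z)) x =
  \sum_a pd a f (g x) * pd i (fun z => g z 0 a) x.
Proof.
move=> dg df; have Dg := differentiable_rV dg.
rewrite /pd -[LHS]/('D_(delta_mx 0 i) (f \o g) x) deriveE; last exact: differentiable_comp.
rewrite diff_comp //= -deriveE // -deriveE // derive_pd //.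
apply: eq_bigr => a _; rewrite mulrC; congr (_ * _).
by rewrite derive_mx ?mxE //; exact: diff_derivable.
Qed.

Lemma differentiable_comp_rV n m (f : 'rV[R]_m -> R) (g : 'rV[R]_n -> 'rV[R]_m) x :
  (forall a, differentiable (fun z => g z 0 a) x) -> differentiable f (g x) ->
  differentiable (fun z => f (g z)) x.
Proof. by move=> /differentiable_rV dg df; apply: differentiable_comp. Qed.

Lemma pd_comp_real n (phi : R -> R) (f : 'rV[R]_n -> R) x (l : R) i :
  differentiable f x -> is_derive (f x) 1 phi l ->
  differentiable (fun z => phi (f z)) x /\ pd i (fun z => phi (f z)) x = l * pd i f x.
Proof.
move=> df dphi; have dphi' : differentiable phi (f x).
  by apply/derivable1_diffP; have [] := dphi.
have dc : differentiable (phi \o f) x by apply: differentiable_comp.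
split=> //; rewrite /pd -[LHS]/('D__ (phi \o f) x) deriveE // diff_comp //=.
rewrite deriv1E; last by have [] := dphi.
rewrite derive1E derive_val -deriveE // mulrC //.
Qed.

(** The form in which differentiability is proved for functions known only through estimates, such
    as ray solutions and local inverses. *)
Lemma differentiableP_eps n (f : 'rV[R]_n -> R) x (a : 'I_n -> R) :
  (forall e, 0 < e -> exists2 d, 0 < d & forall v, `|v| < d ->
     `|f (x + v) - f x - \sum_i v 0 i * a i| <= e * `|v|) ->
  differentiable f x /\ forall i, pd i f x = a i.
Proof.
move=> H.
pose df := fun v : 'rV[R]_n => \sum_i v 0 i * a i.
have df_lin : linear df.
  move=> k u v; rewrite /df scaler_sumr -big_split /=; apply: eq_bigr => i _.
  by rewrite !mxE mulrDl -mulrA.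
pose L := GRing.isLinear.Build _ _ _ _ df df_lin.
pose dl : {linear 'rV[R]_n -> R} := HB.pack df L.
have dc : continuous dl.
  rewrite (_ : (dl : _ -> _) = \sum_i (fun v : 'rV[R]_n => v 0 i * a i)); last first.
    by apply/funext => v; rewrite fct_sumE.
  move=> v; apply: differentiable_continuous; apply: differentiable_sum => i.
  by apply: differentiableM; [exact: differentiable_coord|exact: differentiable_cst].
have E : f \o shift x = cst (f x) + dl +o_ (0 : 'rV[R]_n) id.
  apply/eqaddoP => e e0; have [d d0 Hd] := H e e0.
  near=> v; rewrite /= /shift /=.
  rewrite !fctE /= [v + x]addrC opprD addrA; apply: Hd.
  near: v; apply/nbhs_ballP; exists d => //= v; rewrite -ball_normE /=.
  by rewrite sub0r normrN.
have dE := diff_unique dc E.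
have D : differentiable f x by apply/diff_locallyP; rewrite dE.
split=> // i; rewrite /pd deriveE // dE /= /df (bigD1 i) //= mxE !eqxx mul1r.
rewrite big1 ?addr0 // => j ji; by rewrite mxE eqxx (negbTE ji) mul0r.
Unshelve. all: by end_near. Qed.

Lemma differentiable_eps n (f : 'rV[R]_n -> R) x : differentiable f x ->
  forall e, 0 < e -> exists2 d, 0 < d & forall v, `|v| < d ->
     `|f (x + v) - f x - \sum_i v 0 i * pd i f x| <= e * `|v|.
Proof.
move=> df e e0; have /eqaddoP/(_ e e0)/nbhs_ballP [d d0 Hd] := diff_locally df.
exists d => // v vd; have := Hd v; rewrite -ball_normE /= sub0r normrN => /(_ vd).
rewrite !fctE /= [v + x]addrC opprD addrA => h.
by rewrite -derive_pd // deriveE.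
Qed.

Lemma near_differentiable n (f g : 'rV[R]_n -> R) x :
  (\near x, f x = g x) -> differentiable f x -> differentiable g x.
Proof.
move=> fg df; have fgx := nbhs_singleton fg.
apply: (proj1 (@differentiableP_eps _ g x (fun i => pd i f x) _)) => e e0.
have [d d0 Hd] := differentiable_eps df e0.
have /nbhs_ballP[d' d'0 Hd'] := fg.
exists (Num.min d d'); first by rewrite lt_min d0.
move=> v; rewrite lt_min => /andP[vd vd'].
rewrite -fgx -Hd'; first exact: Hd.
by rewrite -ball_normE /= opprD addrA subrr sub0r normrN.
Qed.

Lemma near_open n (U : set 'rV[R]_n) (P : 'rV[R]_n -> Prop) x :
  open U -> U x -> (forall y, U y -> P y) -> \forall y \near x, P y.
Proof. by move=> oU Ux H; apply: filterS H _; exact: open_nbhs_nbhs. Qed.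

(** A finite order of smoothness, on which smoothness of solutions and inverses can be bootstrapped
    by induction. Order 0 already means differentiable. *)
Definition ck n (k : nat) (U : set 'rV[R]_n) (f : 'rV[R]_n -> R) : Prop :=
  forall (s : seq 'I_n) x, (size s <= k)%N -> U x -> differentiable (foldr pd f s) x.

Lemma smooth_onP n (U : set 'rV[R]_n) f : smooth_on U f <-> forall k, ck k U f.
Proof.
split=> [sf k s x _|h s x Ux]; [exact: sf|exact: (h (size s))].
Qed.

Section Open.
Context {n : nat} (U : set 'rV[R]_n) (oU : open U).
Implicit Types (f g : 'rV[R]_n -> R) (k : nat) (i : 'I_n).

Lemma pd_ext f g i x : (forall y, U y -> f y = g y) -> U x -> pd i f x = pd i g x.
Proof. by move=> fg Ux; apply: near_eq_derive; exact: near_open fg. Qed.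

Lemma differentiable_ext f g x : (forall y, U y -> f y = g y) -> U x ->
  differentiable f x -> differentiable g x.
Proof. by move=> fg Ux; apply: near_differentiable; exact: near_open fg. Qed.

Lemma ckS k f : ck k.+1 U f <->
  (forall x, U x -> differentiable f x) /\ forall i, ck k U (pd i f).
Proof.
split=> [h|[d h] s x].
  split=> [x Ux|i s x sk Ux]; first exact: (h [::]).
  by have := h (rcons s i) x; rewrite size_rcons foldr_rcons ltnS; apply.
case/lastP: s => [_|s i]; first exact: d.
by rewrite size_rcons foldr_rcons ltnS; exact: h.
Qed.

Lemma ck0 f : ck 0 U f <-> forall x, U x -> differentiable f x.
Proof. by split=> [h x|h [|//] x _]; [exact: (h [::])|exact: h]. Qed.

Lemma ck_diff k f x : ck k U f -> U x -> differentiable f x.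
Proof. by move=> h Ux; exact: (h [::]). Qed.

Lemma ckW k f : ck k.+1 U f -> ck k U f.
Proof. by move=> h s x /leqW; exact: h. Qed.

Lemma ck_ext k f g : (forall y, U y -> f y = g y) -> ck k U f -> ck k U g.
Proof.
elim: k f g => [|k IH] f g fg.
  by move/ck0 => h; apply/ck0 => x Ux; apply: differentiable_ext Ux (h x Ux).
move/ckS => [d h]; apply/ckS; split=> [x Ux|i].
  by apply: differentiable_ext Ux (d x Ux).
by apply: IH (h i) => x Ux; apply: pd_ext.
Qed.

Lemma pd_cst (c : R) i x : pd i (fun=> c) x = 0.
Proof. exact: derive_cst. Qed.

Lemma ck_cst k (c : R) : ck k U (fun=> c).
Proof.
elim: k c => [|k IH] c; first by apply/ck0.
apply/ckS; split=> [x _|i]; first exact: differentiable_cst.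
rewrite (_ : pd i _ = fun=> 0) //; apply/funext => x; exact: pd_cst.
Qed.

Lemma pdD f g i x : differentiable f x -> differentiable g x ->
  pd i (fun y => f y + g y) x = pd i f x + pd i g x.
Proof. by move=> df dg; rewrite /pd -deriveD //; apply: diff_derivable. Qed.

Lemma pdN f i x : differentiable f x -> pd i (fun y => - f y) x = - pd i f x.
Proof. by move=> df; rewrite /pd -deriveN //; apply: diff_derivable. Qed.

Lemma pdM f g i x : differentiable f x -> differentiable g x ->
  pd i (fun y => f y * g y) x = pd i f x * g x + f x * pd i g x.
Proof.
move=> df dg; rewrite /pd -[LHS]/('D__ (f * g) x) deriveM; try exact: diff_derivable.
by rewrite addrC; congr (_ + _); rewrite -[LHS]/(_ * _) mulrC.
Qed.

Lemma ckD k f g : ck k U f -> ck k U g -> ck k U (fun x => f x + g x).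
Proof.
elim: k f g => [|k IH] f g.
  by move=> /ck0 h1 /ck0 h2; apply/ck0 => x Ux; apply: differentiableD; [exact: h1|exact: h2].
move=> /ckS[d1 h1] /ckS[d2 h2]; apply/ckS; split=> [x Ux|i].
  by apply: differentiableD; [exact: d1|exact: d2].
apply: (@ck_ext _ (fun x => pd i f x + pd i g x)); last exact: IH.
by move=> x Ux; rewrite pdD //; [exact: d1|exact: d2].
Qed.

Lemma ckM k f g : ck k U f -> ck k U g -> ck k U (fun x => f x * g x).
Proof.
elim: k f g => [|k IH] f g.
  by move=> /ck0 h1 /ck0 h2; apply/ck0 => x Ux; apply: differentiableM; [exact: h1|exact: h2].
move=> F G; move: (F) (G) => /ckS[d1 h1] /ckS[d2 h2]; apply/ckS; split=> [x Ux|i].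
  by apply: differentiableM; [exact: d1|exact: d2].
apply: (@ck_ext _ (fun x => pd i f x * g x + f x * pd i g x)).
  by move=> x Ux; rewrite pdM //; [exact: d1|exact: d2].
by apply: ckD; apply: IH => //; apply: ckW.
Qed.

Lemma ckN k f : ck k U f -> ck k U (fun x => - f x).
Proof.
move=> h; apply: (@ck_ext _ (fun x => (-1) * f x)) => [x _|]; first by rewrite mulN1r.
by apply: ckM => //; exact: ck_cst.
Qed.

Lemma ckB k f g : ck k U f -> ck k U g -> ck k U (fun x => f x - g x).
Proof. by move=> h1 h2; apply: ckD => //; apply: ckN. Qed.

Lemma ck_sum k (I : Type) (r : seq I) (P : pred I) (F : I -> 'rV[R]_n -> R) :
  (forall a, P a -> ck k U (F a)) -> ck k U (fun x => \sum_(a <- r | P a) F a x).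
Proof.
move=> h; elim: r => [|a r IH].
  by apply: (@ck_ext _ (fun=> 0)) => [x _|]; [rewrite big_nil|exact: ck_cst].
case Pa: (P a); last by apply: ck_ext IH => x _; rewrite big_cons Pa.
apply: ck_ext (ckD (h a Pa) IH) => x _; by rewrite big_cons Pa.
Qed.

Lemma ck_prod k (I : Type) (r : seq I) (P : pred I) (F : I -> 'rV[R]_n -> R) :
  (forall a, P a -> ck k U (F a)) -> ck k U (fun x => \prod_(a <- r | P a) F a x).
Proof.
move=> h; elim: r => [|a r IH].
  by apply: (@ck_ext _ (fun=> 1)) => [x _|]; [rewrite big_nil|exact: ck_cst].
case Pa: (P a); last by apply: ck_ext IH => x _; rewrite big_cons Pa.
apply: ck_ext (ckM (h a Pa) IH) => x _; by rewrite big_cons Pa.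
Qed.

Lemma pdV f i x : differentiable f x -> f x != 0 ->
  pd i (fun y => (f y)^-1) x = - (pd i f x * ((f x)^-1 * (f x)^-1)).
Proof.
move=> df f0; rewrite /pd deriveV //; last exact: diff_derivable.
by rewrite -[LHS]/(_ * _) mulNr mulrC expr2 invfM.
Qed.

Lemma ckV k f : (forall x, U x -> f x != 0) -> ck k U f ->
  ck k U (fun x => (f x)^-1).
Proof.
move=> f0; elim: k => [|k IH].
  by move=> /ck0 h1; apply/ck0 => x Ux; apply: differentiableV; [exact: h1|exact: f0].
move=> F; move: (F) => /ckS[d1 h1]; apply/ckS; split=> [x Ux|i].
  by apply: differentiableV; [exact: d1|exact: f0].
apply: (@ck_ext _ (fun x => - (pd i f x * ((f x)^-1 * (f x)^-1)))).
  by move=> x Ux; rewrite pdV //; [exact: d1|exact: f0].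
have Fk := IH (ckW F).
by apply: ckN; apply: ckM => //; apply: ckM.
Qed.

Lemma pd_coord (j i : 'I_n) x : pd i (fun y : 'rV[R]_n => y 0 j) x = (i == j)%:R.
Proof.
have [D ->] : differentiable (fun y : 'rV[R]_n => y 0 j) x /\
    forall i, pd i (fun y : 'rV[R]_n => y 0 j) x = (i == j)%:R; last by [].
apply: differentiableP_eps => e e0; exists 1 => // v _.
rewrite (bigD1 j) //= eqxx mulr1 big1 ?addr0; last first.
  by move=> l /negbTE ->; rewrite mulr0.
by rewrite mxE [x 0 j + _]addrC addrK subrr normr0 mulr_ge0 // ltW.
Qed.

Lemma ck_coord k (j : 'I_n) : ck k U (fun y : 'rV[R]_n => y 0 j).
Proof.
case: k => [|k]; first by apply/ck0 => x _; exact: differentiable_coord.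
apply/ckS; split=> [x _|i]; first exact: differentiable_coord.
rewrite (_ : pd i _ = fun=> (i == j)%:R); first exact: ck_cst.
by apply/funext => x; rewrite pd_coord.
Qed.

End Open.

Lemma ck_sub n k (U U' : set 'rV[R]_n) f : U' `<=` U -> ck k U f -> ck k U' f.
Proof. by move=> s h l x lk /s; exact: h. Qed.

Lemma ck_comp n m k (U : set 'rV[R]_n) (U' : set 'rV[R]_m) f (g : 'rV[R]_n -> 'rV[R]_m) :
  open U -> (forall x, U x -> U' (g x)) ->
  (forall a, ck k U (fun x => g x 0 a)) -> ck k U' f -> ck k U (fun x => f (g x)).
Proof.
move=> oU gU; elim: k f => [|k IH] f hg.
  move=> /ck0 hf; apply/ck0 => x Ux; apply: differentiable_comp_rV; last exact/hf/gU.
  by move=> a; exact: (ck_diff (hg a)).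
have hg' a : ck k U (fun x => g x 0 a) by apply: ckW.
move=> /ckS[df hf]; apply/ckS; split=> [x Ux|i].
  apply: differentiable_comp_rV; last exact/df/gU.
  by move=> a; exact: (ck_diff (hg a)).
apply: (@ck_ext _ _ oU _ (fun x => \sum_a pd a f (g x) * pd i (fun z => g z 0 a) x)).
  move=> x Ux; rewrite pd_comp //; last exact/df/gU.
  by move=> a; exact: (ck_diff (hg a)).
apply: ck_sum => // a _; apply: ckM => //; first exact: IH.
by have /ckS[] := hg a.
Qed.

End Calculus.

(* Keeps unification from comparing partial derivatives by unfolding limits. *)
Local Opaque pd.

(** * Mean value theorem and symmetry of second derivatives *)

Section MeanValue.
Context {R : realType}.

Lemma sum_delta_scale n (h : R) (i : 'I_n) (F : 'I_n -> R) :
  \sum_l (h *: delta_mx 0 i : 'rV[R]_n) 0 l * F l = h * F i.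
Proof.
rewrite (bigD1 i) //= !mxE !eqxx mulr1 big1 ?addr0 // => l li.
by rewrite !mxE eqxx (negbTE li) mulr0 mul0r.
Qed.

Lemma is_derive_line n (x v : 'rV[R]_n) (t : R) i :
  is_derive t 1 (fun s : R => (x + s *: v) 0 i) (v 0 i).
Proof.
have H1 : is_derive t (1 : R) (cst (x 0 i) : R -> R) (0 : R) by exact: is_derive_cst.
have H2 : is_derive t (1 : R) (v 0 i \*: (@id R)) (v 0 i *: (1 : R)).
  by apply: is_deriveZ; exact: is_derive_id.
have := is_deriveD H1 H2; rewrite add0r [v 0 i *: 1]mulr1.
congr (is_derive t 1 _ _); apply/funext => s.
by rewrite !mxE fctE /= [v 0 i *: _]mulrC.
Qed.

Lemma is_derive_segment n (f : 'rV[R]_n -> R) x v (t : R) :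
  differentiable f (x + t *: v) ->
  is_derive t 1 (fun s : R => f (x + s *: v)) (\sum_i v 0 i * pd i f (x + t *: v)).
Proof. by move=> df; apply: is_derive_curve df => i; exact: is_derive_line. Qed.

Lemma derivable_continuous_within (f : R -> R) (a b : R) :
  (forall t, a <= t <= b -> derivable f t 1) -> {within `[a, b], continuous f}.
Proof.
by move=> h; apply: derivable_within_continuous => t; rewrite in_itv /=; exact: h.
Qed.

Lemma mvt_rV n (f : 'rV[R]_n -> R) x v :
  (forall t : R, 0 <= t <= 1 -> differentiable f (x + t *: v)) ->
  exists2 t : R, 0 <= t <= 1 &
    f (x + v) - f x = \sum_i v 0 i * pd i f (x + t *: v).
Proof.
move=> df.
have dd (t : R) : 0 <= t <= 1 -> is_derive t 1 (fun s : R => f (x + s *: v))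
    (\sum_i v 0 i * pd i f (x + t *: v)).
  by move=> h; apply: is_derive_segment; apply: df.
have [||t t01] := @MVT_segment R (fun s : R => f (x + s *: v))
  (fun t : R => \sum_i v 0 i * pd i f (x + t *: v)) 0 1 ler01.
- by move=> t; rewrite in_itv /= => /andP[/ltW t0 /ltW t1]; apply: dd; rewrite t0 t1.
- by apply: derivable_continuous_within => t h; have [] := dd t h.
by rewrite scale1r scale0r addr0 subr0 mulr1 => ->; exists t.
Qed.

Lemma ball0P n (r : R) (x : 'rV[R]_n) : ball 0 r x <-> `|x| < r.
Proof. by rewrite -ball_normE /= sub0r normrN. Qed.

Lemma ballP_norm n (r : R) (x y : 'rV[R]_n) : ball x r y <-> `|y - x| < r.
Proof. by rewrite -ball_normE /= distrC. Qed.

Lemma pd_shift n (f : 'rV[R]_n -> R) c i x : differentiable f (x + c) ->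
  differentiable (fun y => f (y + c)) x /\ pd i (fun y => f (y + c)) x = pd i f (x + c).
Proof.
move=> df.
have dg a : differentiable (fun z : 'rV[R]_n => (z + c) 0 a) x.
  rewrite (_ : (fun _ => _) = (fun z : 'rV[R]_n => z 0 a) + cst (c 0 a)); last first.
    by apply/funext => z; rewrite mxE.
  by apply: differentiableD; [exact: differentiable_coord|exact: differentiable_cst].
split; first exact: (differentiable_comp_rV dg).
rewrite pd_comp //.
have pdg a : pd i (fun z : 'rV[R]_n => (z + c) 0 a) x = (i == a)%:R.
  rewrite (_ : (fun _ => _) = (fun z : 'rV[R]_n => z 0 a + c 0 a)); last first.
    by apply/funext => z; rewrite mxE.
  rewrite pdD ?pd_coord ?pd_cst ?addr0 //; exact: differentiable_coord.
rewrite (bigD1 i) //= pdg eqxx mulr1 big1 ?addr0 // => a.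
by rewrite pdg eq_sym => /negbTE ->; rewrite mulr0.
Qed.

Lemma ball_parallelogram n (x : 'rV[R]_n) (d h s t : R) i j :
  0 < h -> h + h < d -> 0 <= s <= 1 -> 0 <= t <= 1 ->
  ball x d (x + s *: (h *: delta_mx 0 i) + t *: (h *: delta_mx 0 j)).
Proof.
move=> h0 hd /andP[s0 s1] /andP[t0 t1]; apply/ballP_norm.
rewrite addrAC [x + _]addrC addrK; apply: le_lt_trans hd.
apply: (le_trans (ler_normD _ _)); rewrite !normrZ !(ger0_norm s0, ger0_norm t0, gtr0_norm h0).
have ni := norm_delta_mx (R := R) i; have nj := norm_delta_mx (R := R) j.
have hh := ltW h0.
apply: lerD; rewrite -[leRHS]mul1r; apply: ler_pM => //; rewrite ?mulr_ge0 //.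
  by rewrite ler_piMr.
by rewrite ler_piMr.
Qed.

(** Two mean value steps: the increment of [f] along [j] is moved along [i], then [pd i f] is moved
    along [j]. The left-hand side is symmetric in [i] and [j], which is what [schwarz] exploits. *)
Lemma second_difference n (f : 'rV[R]_n -> R) x (d h : R) i j :
  ck 2 (ball x d) f -> 0 < h -> h + h < d ->
  exists s t : R, [/\ 0 <= s <= 1, 0 <= t <= 1 &
    f (x + h *: delta_mx 0 i + h *: delta_mx 0 j) - f (x + h *: delta_mx 0 i)
      - (f (x + h *: delta_mx 0 j) - f x) =
    h * (h * pd j (pd i f) (x + s *: (h *: delta_mx 0 i) + t *: (h *: delta_mx 0 j)))].
Proof.
move=> /ckS[df ddf] h0 hd.
have inb (s t : R) := @ball_parallelogram n x d h s t i j h0 hd.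
have i01 : 0 <= (1 : R) <= 1 by rewrite ler01 lexx.
have i00 : 0 <= (0 : R) <= 1 by rewrite ler01 lexx.
pose g y := f (y + h *: delta_mx 0 j) - f y.
have dg (s : R) : 0 <= s <= 1 -> differentiable g (x + s *: (h *: delta_mx 0 i)) /\
    pd i g (x + s *: (h *: delta_mx 0 i)) =
    pd i f (x + s *: (h *: delta_mx 0 i) + h *: delta_mx 0 j) - pd i f (x + s *: (h *: delta_mx 0 i)).
  move=> s01; have b1 := df _ (inb s 1 s01 i01); rewrite scale1r in b1.
  have b2 := df _ (inb s 0 s01 i00); rewrite scale0r addr0 in b2.
  have [e1 e2] := pd_shift i b1.
  split; first exact: differentiableB.
  rewrite /g pdD //; last exact: differentiableN.
  by rewrite e2 pdN.
have [s s01 Es] := mvt_rV (fun s hs => (dg s hs).1).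
have [|t t01 Et] := @mvt_rV n (pd i f) (x + s *: (h *: delta_mx 0 i)) (h *: delta_mx 0 j).
  by move=> t t01; apply: (ck_diff (ddf i)); apply: inb.
exists s, t; split => //.
rewrite -[LHS]/(g (x + h *: delta_mx 0 i) - g x) Es sum_delta_scale (dg s s01).2.
by rewrite Et sum_delta_scale.
Qed.

Lemma dist_half_contra (a b c : R) :
  `|a - c| < `|a - b| / 2 -> `|b - c| < `|a - b| / 2 -> False.
Proof.
have : `|a - b| <= `|a - c| + `|b - c|.
  by rewrite (_ : a - b = (a - c) - (b - c)) ?ler_normB //; ring.
lra.
Qed.

Lemma third_lt (d : R) : 0 < d -> d / 3 + d / 3 < d.
Proof. by move=> d0; lra. Qed.

Lemma schwarz n (U : set 'rV[R]_n) f i j x : open U -> ck 3 U f -> U x ->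
  pd i (pd j f) x = pd j (pd i f) x.
Proof.
move=> oU cf Ux; apply/eqP; apply: contraT => ab.
set a := pd i (pd j f) x; set b := pd j (pd i f) x.
have e0 : 0 < `|a - b| / 2 by rewrite divr_gt0 // normr_gt0 subr_eq0.
have /cvgrPdist_lt/(_ _ e0) ca : pd i (pd j f) @ x --> a.
  apply: differentiable_continuous; exact: (cf [:: i; j]).
have /cvgrPdist_lt/(_ _ e0) cb : pd j (pd i f) @ x --> b.
  apply: differentiable_continuous; exact: (cf [:: j; i]).
have cU := open_nbhs_nbhs (conj oU Ux).
have [dU dU0 HU] := (proj1 (nbhs_ballP _ _)) cU.
have [da da0 Ha] := (proj1 (nbhs_ballP _ _)) ca.
have [db db0 Hb] := (proj1 (nbhs_ballP _ _)) cb.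
pose d := Num.min dU (Num.min da db).
have d0 : 0 < d by rewrite !lt_min dU0 da0 db0.
have Hd y : ball x d y -> [/\ U y, `|a - pd i (pd j f) y| < `|a - b| / 2 & `|b - pd j (pd i f) y| < `|a - b| / 2].
  move=> yd; split; [apply: HU|apply: Ha|apply: Hb]; apply: le_ball yd; by rewrite /d !ge_min lexx ?orbT.
pose h := d / 3.
have h0 : 0 < h by rewrite divr_gt0.
have hd : h + h < d := third_lt d0.
have cf2 : ck 2 (ball x d) f by apply: ckW; apply: ck_sub cf => y /Hd[].
have [s [t [s01 t01 E1]]] := second_difference i j cf2 h0 hd.
have [s' [t' [s01' t01' E2]]] := second_difference j i cf2 h0 hd.
(* Both mixed derivatives, at two nearby points, equal the same second difference divided by
   [h * h]; yet each is closer to its value at [x] than half the supposed gap. *)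
have E : pd j (pd i f) (x + s *: (h *: delta_mx 0 i) + t *: (h *: delta_mx 0 j)) =
         pd i (pd j f) (x + s' *: (h *: delta_mx 0 j) + t' *: (h *: delta_mx 0 i)).
  apply: (mulfI (lt0r_neq0 h0)); apply: (mulfI (lt0r_neq0 h0)).
  apply: etrans (esym E1) _; apply: etrans _ E2.
  have q (p1 p2 p3 p4 : R) : p1 - p2 - (p3 - p4) = p1 - p3 - (p2 - p4) by ring.
  by apply: etrans (q _ _ _ _) _; rewrite [x + _ + h *: delta_mx 0 j]addrAC.
have inb (i j : 'I_n) (s t : R) := @ball_parallelogram n x d h s t i j h0 hd.
have [_ _ H1] := Hd _ (inb i j _ _ s01 t01).
have [_ H2 _] := Hd _ (inb j i _ _ s01' t01').
rewrite E in H1.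
by case: (dist_half_contra H2 H1).
Qed.

End MeanValue.

(** * Polynomials in several variables *)

Section Multisums.
Context {R : realType} {n : nat}.
Implicit Types (f : seq 'I_n -> R) (w v u : 'I_n -> R).

(** Functions on words rather than on tuples, so that sums can be split by length or concatenation
    without dependent types. *)
Definition msum m f : R := \sum_(j : m.-tuple 'I_n) f (val j).

Definition mon w (s : seq 'I_n) : R := \prod_(k <- s) w k.

Lemma msum0 f : msum 0 f = f [::].
Proof.
rewrite /msum (bigD1 [tuple]) //= big1 ?addr0 // => t /eqP[].
exact: tuple0.
Qed.

Lemma msumS m f : msum m.+1 f = \sum_x msum m (fun j => f (x :: j)).
Proof.
rewrite /msum pair_big /=.
rewrite (reindex (fun xt : 'I_n * m.-tuple 'I_n => [tuple of xt.1 :: xt.2])) //=.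
exists (fun t => (thead t, [tuple of behead t])) => [[x t] _|t _] /=.
  by congr (_, _); apply: val_inj.
by rewrite [RHS]tuple_eta; apply: val_inj.
Qed.

Lemma eq_msum m f g : (forall s, size s = m -> f s = g s) -> msum m f = msum m g.
Proof. by move=> fg; apply: eq_bigr => t _; apply: fg; rewrite size_tuple. Qed.

Lemma msumD m f g : msum m (fun s => f s + g s) = msum m f + msum m g.
Proof. exact: big_split. Qed.

Lemma msumZ m (c : R) f : msum m (fun s => c * f s) = c * msum m f.
Proof. by rewrite /msum big_distrr. Qed.

Lemma msum_sum m (I : Type) (r : seq I) (P : pred I) (F : I -> seq 'I_n -> R) :
  msum m (fun s => \sum_(a <- r | P a) F a s) = \sum_(a <- r | P a) msum m (F a).
Proof. exact: exchange_big. Qed.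

Lemma msum_cat a b f :
  msum (a + b) f = msum a (fun i => msum b (fun j => f (i ++ j))).
Proof.
elim: a f => [|a IH] f; first by rewrite msum0.
by rewrite addSn !msumS; apply: eq_bigr => x _; rewrite IH.
Qed.

Lemma mon_nil w : mon w [::] = 1. Proof. exact: big_nil. Qed.
Lemma mon_cons w x s : mon w (x :: s) = w x * mon w s. Proof. exact: big_cons. Qed.
Lemma mon_cat w s t : mon w (s ++ t) = mon w s * mon w t. Proof. exact: big_cat. Qed.

Lemma mon_perm w s t : perm_eq s t -> mon w s = mon w t.
Proof. by move=> st; apply: perm_big. Qed.

Lemma mon_tuple w m (t : m.-tuple 'I_n) : mon w t = \prod_(a < m) w (tnth t a).
Proof. exact: big_tuple. Qed.

Lemma mon_scale w (c : R) s : mon (fun k => c * w k) s = c ^+ size s * mon w s.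
Proof.
elim: s => [|x s IH]; first by rewrite !mon_nil expr0 mulr1.
by rewrite !mon_cons IH exprS; ring.
Qed.

Lemma msum_rot m r f : msum m (fun s => f (rot r s)) = msum m f.
Proof.
rewrite /msum [RHS](reindex (fun t : m.-tuple 'I_n => [tuple of rot r t])) //=.
exists (fun t : m.-tuple 'I_n => [tuple of rotr r t]) => t _; apply: val_inj => /=.
  exact: rotK.
exact: rotrK.
Qed.

(** Monomials do not see the order of a word, so [f] may be averaged over the rearrangements of each
    word; [N s] counts the distinct ones. *)
Lemma symmetrize m f : exists2 g : seq 'I_n -> R,
  (forall s t, perm_eq s t -> g s = g t) &
  forall w, msum m (fun s => f s * mon w s) = msum m (fun s => g s * mon w s).
Proof.
pose N (s : seq 'I_n) := #|[pred t : m.-tuple 'I_n | perm_eq t s]|.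
exists (fun s => (\sum_(t : m.-tuple 'I_n | perm_eq t s) f t) / (N s)%:R).
  move=> s t st; congr (_ / _%:R).
    by apply: eq_bigl => u; rewrite (permPr st).
  by apply: eq_card => u; rewrite !inE (permPr st).
move=> w; apply/esym; rewrite /msum.
under eq_bigr do rewrite -mulrA big_distrl /=.
rewrite (exchange_big_dep xpredT) //=; apply: eq_bigr => t _.
rewrite -big_distrr /=; congr (_ * _).
have E s : perm_eq t s -> (N s)%:R^-1 * mon w s = (N t)%:R^-1 * mon w t.
  move=> ts; rewrite (mon_perm _ ts); congr (_%:R^-1 * _).
  by apply: eq_card => u; rewrite !inE (permPr ts).
rewrite (eq_bigr _ (fun s ts => E _ ts)) sumr_const.
rewrite (_ : #|_| = N t); last first.
  by apply: eq_card => u; rewrite !inE /= perm_sym.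
rewrite -mulrnAl -[_ *+ N t]mulr_natr mulVf ?mul1r // pnatr_eq0 -lt0n.
by apply/card_gt0P; exists t; rewrite inE perm_refl.
Qed.

(* With [c = 0] this is Ryser's formula for the permanent; [c] does not
   contribute because a monomial using it misses some [a], and then the terms
   with [g a] and [~~ g a] cancel. *)
Lemma ryser_formula p (c : 'I_p -> R) (m : 'I_p -> 'I_p -> R) :
  \sum_(g : {ffun 'I_p -> bool}) (\prod_a (-1) ^+ (~~ g a)) *
     \prod_b (c b + \sum_(a | g a) m b a) =
  \sum_(s : 'S_p) \prod_b m b (s b).
Proof.
(* Expanding the product chooses for each [b] either the constant [c b] ([None]) or one [m b a]
   ([Some a]). *)
pose M b (o : option 'I_p) := if o is Some a then m b a else c b.
pose G (g : {ffun 'I_p -> bool}) (o : option 'I_p) : R :=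
  if o is Some a then (g a)%:R else 1.
have E1 (g : {ffun 'I_p -> bool}) b : c b + \sum_(a | g a) m b a = \sum_o G g o * M b o.
  rewrite (bigD1 None) //= mul1r; congr (_ + _).
  rewrite (reindex_onto some (odflt b)) /=; last by case.
  rewrite [RHS](eq_bigl xpredT); last by move=> a; rewrite eqxx.
  by rewrite big_mkcond /=; apply: eq_bigr => a _; case: (g a); rewrite ?mul1r ?mul0r.
under eq_bigr => g _ do rewrite (eq_bigr _ (fun b _ => E1 g b)).
under eq_bigr do rewrite bigA_distr_bigA big_distrr /=.
rewrite exchange_big /=.
(* The sum over [g] factors over [a]. The factor of [a] is 1 when [f] hits [a], and 1 - 1 = 0
   otherwise. *)
have E2 (f : {ffun 'I_p -> option 'I_p}) :
    \sum_(g : {ffun 'I_p -> bool}) (\prod_a (-1) ^+ (~~ g a)) * \prod_b (G g (f b) * M b (f b)) =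
    ([forall a, exists b, f b == Some a])%:R * \prod_b M b (f b).
  transitivity (\sum_(g : {ffun 'I_p -> bool})
      ((\prod_a (-1) ^+ (~~ g a)) * \prod_b G g (f b)) * \prod_b M b (f b)).
    apply: eq_bigr => g _; rewrite -mulrA; congr (_ * _); exact: big_split.
  rewrite -big_distrl /=; congr (_ * _).
  pose H a (e : bool) : R := (-1) ^+ (~~ e) * \prod_b (if f b == Some a then e%:R else 1).
  rewrite (_ : \sum_g _ = \sum_(g : {ffun 'I_p -> bool}) \prod_a H a (g a)).
    rewrite -bigA_distr_bigA /=.
    have EH a : \sum_e H a e = ([exists b, f b == Some a])%:R.
      rewrite big_bool /H /= expr0 mul1r expr1 mulN1r big1; last by move=> b _; case: ifP.
      case: existsP => [[b fb]|nb].
        by rewrite (bigD1 b) //= fb mul0r oppr0 addr0.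
      rewrite big1 ?subrr // => b _; case: ifP => // fb.
      by case: nb; exists b.
    under eq_bigr do rewrite EH.
    case: forallP => [h|/forallP].
      by rewrite big1 // => a _; rewrite h.
    rewrite negb_forall => /existsP[a /negbTE na].
    by rewrite (bigD1 a) //= na mul0r.
  apply: eq_bigr => g _; rewrite /H big_split /=; congr (_ * _).
  rewrite exchange_big /=; apply: eq_bigr => b _.
  case: (f b) => [a|] /=; last by rewrite big1.
  rewrite (bigD1 a) //= eqxx big1 ?mulr1 // => a' aa'.
  by case: eqP => // -[e]; rewrite e eqxx in aa'.
under eq_bigr do rewrite E2.
pose S (s : 'S_p) : {ffun 'I_p -> option 'I_p} := [ffun b => Some (s b)].
have Sinj : injective S.
  move=> s t st; apply/permP => b.
  by have := congr1 (fun f : {ffun 'I_p -> option 'I_p} => f b) st; rewrite !ffunE => -[].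
(* A choice that hits every element of ['I_p] is a permutation, by counting. *)
transitivity (\sum_(f in S @: (@predT 'S_p)) \prod_b M b (f b)).
  rewrite [RHS]big_mkcond /=; apply: eq_bigr => f _.
  case: ifPn => [/imsetP[s _ ->]|fS].
    rewrite (_ : [forall a, _] = true) ?mul1r //.
    apply/forallP => a; apply/existsP; exists (s^-1%g a).
    by rewrite ffunE permKV.
  rewrite (_ : [forall a, _] = false) ?mul0r //; apply: contraNF fS.
  move=> /forallP h; have h' a : exists b, f b == Some a by apply/existsP.
  pose t a := xchoose (h' a); have ht a : f (t a) = Some a by exact/eqP/(xchooseP (h' a)).
  have tinj : injective t.
    by move=> a b /(congr1 f); rewrite !ht => -[].
  apply/imsetP; exists (perm tinj)^-1%g; first by rewrite inE.
  apply/ffunP => b; rewrite ffunE.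
  by rewrite -{1}[b](permKV (perm tinj)) permE ht.
rewrite big_imset /=; last by move=> s t _ _; exact: Sinj.
apply: eq_big => [s|s _]; first by rewrite inE.
by apply: eq_bigr => b _; rewrite ffunE.
Qed.

(** A signed sum over the vertices of a cube with edges [e] times the basis vectors of [k]. The free
    base point [c] will be [- x], and a small [e] keeps the vertices within the domain of the
    Killing identity. *)
Lemma polarization p (B : seq 'I_n -> R) (k : p.-tuple 'I_n) (c : 'I_n -> R) (e : R) :
  \sum_(g : {ffun 'I_p -> bool}) (\prod_a (-1) ^+ (~~ g a)) *
    msum p (fun s => B s * mon (fun i => c i + e * \sum_(a | g a) (tnth k a == i)%:R) s) =
  e ^+ p * \sum_(s : 'S_p) B (permute s k).
Proof.
transitivity (\sum_(t : p.-tuple 'I_n) B t * (\sum_(s : 'S_p) e ^+ p * (permute s k == t)%:R)).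
  rewrite /msum; under eq_bigr do rewrite big_distrr /=.
  rewrite exchange_big /=; apply: eq_bigr => t _.
  rewrite (eq_bigr (fun g : {ffun 'I_p -> bool} => B t * ((\prod_a (-1) ^+ (~~ g a)) *
    \prod_b (c (tnth t b) + \sum_(a | g a) e * (tnth k a == tnth t b)%:R)))).
    rewrite -big_distrr /=; congr (_ * _).
    rewrite (ryser_formula (fun b => c (tnth t b)) (fun b a => e * (tnth k a == tnth t b)%:R)).
    apply: eq_bigr => s _; rewrite big_split /= prodr_const card_ord; congr (_ * _).
    case: eqP => [<-|st]; first by rewrite big1 // => b _; rewrite tnth_mktuple eqxx.
    have [b hb] : exists b, tnth k (s b) != tnth t b.
      apply/existsP; apply: contra_notT st; rewrite negb_exists => /forallP h.
      by apply: eq_from_tnth => b; rewrite tnth_mktuple; apply/eqP/negPn/h.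
    by rewrite (bigD1 b) //= (negbTE hb) mul0r.
  move=> g _; rewrite mulrCA mon_tuple; congr (_ * (_ * _)).
  by apply: eq_bigr => b _; rewrite big_distrr.
under eq_bigr do rewrite -big_distrr /= mulrCA.
rewrite -big_distrr /=; congr (_ * _).
under eq_bigr do rewrite big_distrr /=.
rewrite exchange_big /=; apply: eq_bigr => s _.
rewrite (bigD1 (permute s k)) //= eqxx mulr1 big1 ?addr0 // => t.
by rewrite eq_sym => /negbTE ->; rewrite mulr0.
Qed.

Lemma permute_perm_eq p (k k' : p.-tuple 'I_n) : perm_eq k' k ->
  exists s, k' = permute s k.
Proof.
by move=> /tuple_permP[s e]; exists s; apply: val_inj; exact: e.
Qed.

Lemma perm_permute p (s : 'S_p) (k : p.-tuple 'I_n) : perm_eq (permute s k) k.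
Proof. by apply/tuple_permP; exists s. Qed.

Lemma homogeneous_eq0 p (B : seq 'I_n -> R) :
  (forall v, msum p (fun s => B s * mon v s) = 0) ->
  forall k : p.-tuple 'I_n, \sum_(s : 'S_p) B (permute s k) = 0.
Proof.
move=> h k; have := polarization B k (fun=> 0) 1.
rewrite expr1n mul1r => <-; rewrite big1 // => g _.
by rewrite h mulr0.
Qed.

Lemma poly_eq0_near d (c : nat -> R) (e : R) : 0 < e ->
  (forall t, 0 < t < e -> \sum_(q < d) c q * t ^+ q = 0) ->
  forall q, (q < d)%N -> c q = 0.
Proof.
move=> e0 h q qd.
pose P := \poly_(q < d) c q.
suff P0 : P = 0 by have := coef_poly d c q; rewrite -/P P0 coef0 qd.
(* Starting the denominators at 2 keeps every root strictly below [e]. *)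
pose rs := [seq e / (k.+2)%:R | k <- iota 0 d].
apply: (@roots_geq_poly_eq0 _ P rs).
- apply/allP => x /mapP[k _ ->]; rewrite /root horner_poly h //.
  rewrite divr_gt0 ?ltr0n //= ltr_pdivrMr ?ltr0n // ltr_pMr // ltr1n.
  by [].
- rewrite map_inj_uniq ?iota_uniq // => a b /(mulfI (lt0r_neq0 e0)) /invr_inj /eqP.
  by rewrite eqr_nat !eqSS => /eqP.
- by rewrite size_map size_iota size_poly.
Qed.

(** [P] is the restriction of a form of degree [q] to a line in the direction [l]. Its linear
    coefficient is a directional derivative: by symmetry the [q] possible places of [l] contribute
    equally. *)
Lemma msum_affine_poly q (a : seq 'I_n -> R) v (l : 'I_n) :
  (forall s t, perm_eq s t -> size s = q -> a s = a t) ->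
  exists P : {poly R}, [/\
    forall s : R, msum q (fun j => a j * mon (fun k => v k + s * (k == l)%:R) j) = P.[s],
    P`_0 = msum q (fun j => a j * mon v j) &
    P`_1 = q%:R * msum q.-1 (fun j => a (l :: j) * mon v j)].
Proof.
elim: q a => [|q IH] a sa.
  exists (a [::])%:P; split=> [s||]; rewrite ?hornerC ?msum0 ?mon_nil ?mulr1 ?coefC //.
  by rewrite mul0r.
have /boolp.choice [P HP] (x : 'I_n) := IH (fun j => a (x :: j))
  (fun s t st ss => sa (x :: s) (x :: t) (etrans (perm_cons x s t) st) (congr1 succn ss)).
exists (\sum_x ((v x)%:P + (x == l)%:R *: 'X) * P x); split=> [s||].
- rewrite msumS horner_sum; apply: eq_bigr => x _.
  rewrite !hornerE; have [<- _ _] := HP x.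
  rewrite -msumZ; apply: eq_msum => j _; rewrite mon_cons; ring.
- rewrite msumS coef_sum; apply: eq_bigr => x _.
  rewrite coefM big_ord1 /= coefD coefC coefZ coefX /= mulr0 addr0.
  by have [_ -> _] := HP x; rewrite -msumZ; apply: eq_msum => j _; rewrite mon_cons; ring.
- have -> : (\sum_x ((v x)%:P + (x == l)%:R *: 'X) * P x)`_1 =
     \sum_x (v x * (P x)`_1 + (x == l)%:R * (P x)`_0).
    rewrite coef_sum; apply: eq_bigr => x _.
    rewrite coefM big_ord_recl big_ord1 /= !coefD !coefC !coefZ !coefX /=.
    by rewrite !mulr0 mulr1 addr0 add0r.
  have D (Q : 'I_n -> R) : \sum_x (x == l)%:R * Q x = Q l.
    by rewrite (bigD1 l) //= eqxx mul1r big1 ?addr0 // => x /negbTE ->; rewrite mul0r.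
  rewrite big_split /= D.
  have [_ -> _] := HP l.
  rewrite -natr1 mulrDl mul1r; congr (_ + _).
  case: q IH sa HP => [|q] IH sa HP.
    rewrite mul0r big1 // => x _; have [_ _ ->] := HP x; by rewrite mul0r mulr0.
  rewrite /= msumS big_distrr /=; apply: eq_bigr => x _.
  have [_ _ ->] := HP x; rewrite mulrCA; congr (_ * _).
  rewrite -msumZ; apply: eq_msum => j sj; rewrite mon_cons.
  rewrite (sa (x :: l :: j) (l :: x :: j)) /= ?sj //; first by ring.
  by rewrite -[x :: l :: j]/([:: x] ++ [:: l] ++ j) perm_catCA.
Qed.

End Multisums.

Section Polynomials.
Context {R : realType} {n : nat}.
Implicit Types (a : seq 'I_n -> R) (f : ('I_n -> R) -> R).

Definition is_poly d f := exists a, forall w, f w = \sum_(q < d.+1) msum q (fun j => a j * mon w j).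

Lemma is_polyD d f g : is_poly d f -> is_poly d g -> is_poly d (fun w => f w + g w).
Proof.
move=> [a fa] [b gb]; exists (fun s => a s + b s) => w.
rewrite fa gb -big_split /=; apply: eq_bigr => q _.
by rewrite -msumD; apply: eq_msum => j _; rewrite mulrDl.
Qed.

Lemma is_polyZ d c f : is_poly d f -> is_poly d (fun w => c * f w).
Proof.
move=> [a fa]; exists (fun s => c * a s) => w.
rewrite fa big_distrr /=; apply: eq_bigr => q _.
by rewrite -msumZ; apply: eq_msum => j _; rewrite mulrA.
Qed.

Lemma is_poly_sum d (I : Type) (r : seq I) (F : I -> ('I_n -> R) -> R) :
  (forall i, is_poly d (F i)) -> is_poly d (fun w => \sum_(i <- r) F i w).
Proof.
move=> h; elim: r => [|i r [a IH]].
  exists (fun=> 0) => w; rewrite big_nil big1 // => q _.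
  by rewrite /msum big1 // => j _; rewrite mul0r.
have [b hb] : is_poly d (fun w => F i w + \sum_(j <- r) F j w).
  by apply: is_polyD => //; exists a.
by exists b => w; rewrite big_cons hb.
Qed.

Lemma is_polyW d f : is_poly d f -> is_poly d.+1 f.
Proof.
(* The old coefficients are arbitrary on words of length [d.+1], so they are cut off there. *)
move=> [a fa]; exists (fun s => if (size s <= d)%N then a s else 0) => w.
rewrite big_ord_recr /= [X in _ + X](_ : _ = 0) ?addr0.
  by rewrite fa; apply: eq_bigr => q _; apply: eq_msum => j ->; rewrite -ltnS ltn_ord.
by rewrite /msum big1 // => j _; rewrite size_tuple ltnn mul0r.
Qed.

Lemma is_polyMX d k f : is_poly d f -> is_poly d.+1 (fun w => w k * f w).
Proof.
move=> [a fa]; exists (fun s => if s is x :: t then (x == k)%:R * a t else 0) => w.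
rewrite big_ord_recl /= msum0 mul0r add0r fa big_distrr /=.
apply: eq_bigr => q _; rewrite msumS (bigD1 k) //= eqxx big1 ?addr0.
  by rewrite -msumZ; apply: eq_msum => j _; rewrite mon_cons mul1r; ring.
move=> x /negbTE ->; rewrite /msum big1 // => j _; by rewrite mul0r mul0r.
Qed.

Lemma is_poly_mon_sub s (z : 'I_n -> R) : is_poly (size s) (fun w => mon (fun k => z k - w k) s).
Proof.
elim: s => [|k s IH].
  by exists (fun=> 1) => w; rewrite big_ord1 msum0 !mon_nil mulr1.
have [a ha] := is_polyD (is_polyZ (-1) (is_polyMX k IH)) (is_polyZ (z k) (is_polyW IH)).
by exists a => w; rewrite -ha mon_cons /=; ring.
Qed.

Lemma is_poly_symmetric d f : is_poly d f -> exists2 a,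
  (forall s t, perm_eq s t -> a s = a t) &
  forall w, f w = \sum_(q < d.+1) msum q (fun j => a j * mon w j).
Proof.
move=> [a fa].
have h q : exists b, (forall s t, perm_eq s t -> b s = b t) /\
   forall w, msum q (fun s => a s * mon w s) = msum q (fun s => b s * mon w s).
  by have [b h1 h2] := symmetrize q a; exists b.
have [b hb] := boolp.choice h.
exists (fun s => b (size s) s) => [s t st|w].
  by rewrite (perm_size st); apply: (hb _).1.
rewrite fa; apply: eq_bigr => q _; rewrite (hb q).2.
by apply: eq_msum => j ->.
Qed.

End Polynomials.

(** * Killing tensors in flat coordinates are polynomial *)

Section FlatKilling.
Context {R : realType} {n : nat}.
Variables (p : nat) (F : p.-tuple 'I_n -> 'rV[R]_n -> R) (r : R).
Hypothesis r0 : 0 < r.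
Hypothesis Fsym : forall (x : 'rV[R]_n) i (s : 'S_p), `|x| < r -> F (permute s i) x = F i x.
Hypothesis Fkill : forall x z : 'rV[R]_n, `|x| < r -> `|z| < r ->
  \sum_i F i x * mon (fun k => z 0 k - x 0 k) i =
  \sum_i F i z * mon (fun k => z 0 k - x 0 k) i.

Let Fseq x (s : seq 'I_n) : R :=
  if insub s is Some i then F i x else 0.

Lemma Fseq_tuple x (i : p.-tuple 'I_n) : Fseq x i = F i x.
Proof. by rewrite /Fseq valK. Qed.

Lemma Fseq_perm (x : 'rV[R]_n) (i i' : p.-tuple 'I_n) : `|x| < r -> perm_eq i i' -> F i x = F i' x.
Proof. by move=> xr /permute_perm_eq[s ->]; apply: Fsym. Qed.

(* The top-degree part in [z] of [sum_s F_s(x) (x - z)^s], a polynomial in [z],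
   recovers [F_k(x)]; since this sum equals [sum_s F_s(z) (x - z)^s], it is also
   polynomial in [x]. *)
Lemma flat_killing_is_poly (k : p.-tuple 'I_n) :
  exists2 f, is_poly p f & forall x : 'rV[R]_n, `|x| < r -> F k x = f (x 0).
Proof.
(* The entries of [z g] are at most [p * e < r], so the Killing identity applies at these points. *)
pose e := r / p.+1%:R.
have e0 : e != 0 by rewrite mulf_neq0 ?invr_eq0 ?pnatr_eq0 // lt0r_neq0.
pose z (g : {ffun 'I_p -> bool}) : 'rV[R]_n :=
  \row_i (e * \sum_(a | g a) (tnth k a == i)%:R).
have zr g : `|z g| < r.
  apply: rV_norm_lt => // i; rewrite mxE normrM.
  rewrite (ger0_norm (x := r / _)) ?divr_ge0 ?ltW ?ltr0n //.
  rewrite -mulrA gtr_pMr // mulrC ltr_pdivrMr ?ltr0n // mul1r.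
  apply: le_lt_trans (_ : p%:R < _); last by rewrite ltr_nat.
  apply: (le_trans (ler_norm_sum _ _ _)).
  apply: (@le_trans _ _ (\sum_(a | g a) 1)).
    by apply: ler_sum => a _; case: eqP; rewrite ?normr1 ?normr0.
  rewrite sumr_const ler_nat -[leqRHS]card_ord; exact: max_card.
pose sg (g : {ffun 'I_p -> bool}) : R := \prod_a (-1) ^+ (~~ g a).
(* The prefactor undoes the [e ^+ p] of the polarization and the [p]! equal terms of a symmetric
   [F]. *)
exists (fun w => (e ^+ p * (p`!)%:R)^-1 * \sum_(g : {ffun 'I_p -> bool}) sg g *
   \sum_s F s (z g) * mon (fun i => z g 0 i - w i) s).
  apply/is_polyZ; apply: is_poly_sum => g; apply/is_polyZ.
  apply: is_poly_sum => s; apply: is_polyZ.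
  by have := is_poly_mon_sub s (fun i => z g 0 i); rewrite size_tuple.
move=> x xr.
have := polarization (Fseq x) k (fun i => - x 0 i) e.
have -> : \sum_(s : 'S_p) Fseq x (permute s k) = (p`!)%:R * F k x.
  rewrite (eq_bigr (fun=> F k x)) => [|s _]; last by rewrite Fseq_tuple Fsym.
  by rewrite sumr_const card_Sn mulr_natl.
rewrite mulrA => E.
apply: (canRL (mulKf _)).
  by rewrite mulf_neq0 ?expf_neq0 // pnatr_eq0 -lt0n fact_gt0.
rewrite -E; apply: eq_bigr => g _; congr (_ * _).
rewrite -(Fkill xr (zr g)); apply: eq_bigr => s _; rewrite Fseq_tuple.
congr (_ * _); apply: eq_bigr => i _; by rewrite mxE addrC.
Qed.

End FlatKilling.

(** * Relations between the coefficients *)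

Section Coefficients.
Context {R : realType} {n : nat}.
Variables (p : nat) (F : p.-tuple 'I_n -> 'rV[R]_n -> R) (r : R).
Hypothesis r0 : 0 < r.
Hypothesis Fsym : forall (x : 'rV[R]_n) i (s : 'S_p), `|x| < r -> F (permute s i) x = F i x.
Hypothesis Fkill : forall x z : 'rV[R]_n, `|x| < r -> `|z| < r ->
  \sum_i F i x * mon (fun k => z 0 k - x 0 k) i =
  \sum_i F i z * mon (fun k => z 0 k - x 0 k) i.

Definition block_symmetric (A : seq 'I_n -> R) := forall i i' j j' : seq 'I_n,
  size i = p -> perm_eq i i' -> perm_eq j j' -> A (i ++ j) = A (i' ++ j').

Definition expansion (A : seq 'I_n -> R) :=
  forall (i : p.-tuple 'I_n) (x : 'rV[R]_n), `|x| < r ->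
    F i x = \sum_(q < p.+1) msum q (fun j => A (val i ++ j) * mon (x 0) j).

(** The vanishing on words longer than [p + p] serves [p = 0], where the last relation concerns
    coefficients of length 1, outside the expansion. *)
Lemma expansion_exists : exists A, [/\ block_symmetric A,
  forall s, (p + p < size s)%N -> A s = 0 & expansion A].
Proof.
have h (i : seq 'I_n) : exists a : seq 'I_n -> R, (forall s t, perm_eq s t -> a s = a t) /\
    forall k : p.-tuple 'I_n, val k = i -> forall x : 'rV[R]_n, `|x| < r ->
    F k x = \sum_(q < p.+1) msum q (fun j => a j * mon (x 0) j).
  case: (eqVneq (size i) p) => [si|si]; last first.
    exists (fun=> 0); split=> // k ki; by rewrite -ki size_tuple eqxx in si.
  have [f /is_poly_symmetric[a sa fa] Ff] := flat_killing_is_poly r0 Fsym Fkill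
    (@Tuple p _ i (introT eqP si)).
  exists a; split=> // k ki x xr; rewrite -fa -Ff //; congr (F _ x).
  exact: val_inj.
have [a ha] := boolp.choice h.
pose le := fun x y : 'I_n => (x <= y)%N.
have sP := perm_sortP (leT := le) (fun x y => leq_total x y)
  (fun x y z => @leq_trans x y z) (fun x y h => val_inj (anti_leq h)).
(* [F] depends only on the multiset of its indices; taking the coefficients chosen for the sorted
   first block makes [A] invariant under rearrangement of that block. *)
exists (fun s => if (size s <= p + p)%N then a (sort le (take p s)) (drop p s) else 0); split.
- move=> i i' j j' si ii' jj'.
  have si' : size i' = p by rewrite -(perm_size ii').
  rewrite !size_cat -(perm_size ii') -(perm_size jj'); case: ifP => // _.
  rewrite !take_size_cat // !drop_size_cat // (sP _ _ ii').
  exact: (ha _).1.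
- by move=> s; rewrite ltnNge => /negbTE ->.
move=> i x xr.
have ti : perm_eq (sort_tuple le i) i by rewrite perm_sort.
rewrite -(Fseq_perm Fsym xr ti) ((ha _).2 (sort_tuple le i) erefl _ xr).
apply: eq_bigr => q _; apply: eq_msum => j sj.
rewrite take_size_cat ?drop_size_cat ?size_tuple // size_cat sj size_tuple.
by rewrite leq_add2l -ltnS ltn_ord.
Qed.

Variable A : seq 'I_n -> R.
Hypothesis Asym : block_symmetric A.
Hypothesis Ax : expansion A.

Definition bihom q (w u : 'I_n -> R) :=
  msum p (fun i => msum q (fun j => A (i ++ j) * (mon w i * mon u j))).

Lemma bihom_scaler q w u (c : R) :
  bihom q w (fun k => c * u k) = c ^+ q * bihom q w u.
Proof.
rewrite -msumZ; apply: eq_msum => i _; rewrite -msumZ; apply: eq_msum => j sj.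
by rewrite mon_scale sj; ring.
Qed.

Lemma expansion_bihom (w u : 'I_n -> R) (t : R) : `|\row_k (t * u k)| < r ->
  \sum_i F i (\row_k (t * u k)) * mon (fun k => t * w k) i =
  t ^+ p * \sum_(q < p.+1) bihom q w u * t ^+ q.
Proof.
move=> tr; rewrite big_distrr /=.
transitivity (\sum_(i : p.-tuple 'I_n) \sum_(q < p.+1) t ^+ p * (t ^+ q *
   msum q (fun j => A (val i ++ j) * (mon w i * mon u j)))).
  apply: eq_bigr => i _; rewrite (Ax i tr) big_distrl /=; apply: eq_bigr => q _.
  rewrite mon_scale size_tuple mulrCA; congr (_ * _).
  rewrite mulrC -!msumZ; apply: eq_msum => j sj.
  have -> : mon ((\row_k (t * u k)) 0) j = mon (fun k => t * u k) j.
    by apply: eq_bigr => k _; rewrite mxE.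
  by rewrite mon_scale sj; ring.
rewrite exchange_big /=; apply: eq_bigr => q _.
by rewrite -!big_distrr /=; congr (_ * _); rewrite mulrC.
Qed.

(** The Killing identity between [t * u] and [t * (v + u)], divided by [t ^+ p], equates two
    polynomials in [t] on an interval. [M] strictly bounds all the entries, so both points stay in
    the ball for [t < r / M]. *)
Lemma bihom_shift q v u : (q <= p)%N ->
  bihom q v (fun k => v k + u k) = bihom q v u.
Proof.
move=> qp; apply/eqP; rewrite -subr_eq0; apply/eqP.
pose M := 1 + \sum_k (`|u k| + `|v k + u k|).
have M0 : 0 < M by rewrite ltr_pwDl // sumr_ge0 // => k _; rewrite addr_ge0.
have small (w : 'I_n -> R) t : (forall k, `|w k| < M) -> 0 < t < r / M -> `|\row_k (t * w k)| < r.
  move=> wM /andP[t0 tM]; apply: rV_norm_lt => // k; rewrite mxE normrM gtr0_norm //.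
  rewrite ltr_pdivlMr // in tM; apply: le_lt_trans tM.
  by rewrite ler_pM2l // ltW.
have term k : `|u k| + `|v k + u k| < M.
  rewrite /M (bigD1 k) //= ltr_pwDl // lerDl sumr_ge0 // => l _; exact: addr_ge0.
have uM k : `|u k| < M by apply: le_lt_trans (term k); rewrite lerDl.
have vuM k : `|v k + u k| < M by apply: le_lt_trans (term k); rewrite lerDr.
apply: (@poly_eq0_near _ p.+1 (fun q => bihom q v (fun k => v k + u k) - bihom q v u) (r / M)) => //.
  by rewrite divr_gt0.
move=> t tr; have t0 : t != 0 by case/andP: tr => /lt0r_neq0.
have S1 := small _ _ uM tr; have S2 := small _ _ vuM tr.
have := Fkill S1 S2.
have E (i : seq 'I_n) : mon (fun k => (\row_k (t * (v k + u k))) 0 k - (\row_k (t * u k)) 0 k) i =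
    mon (fun k => t * v k) i.
  by apply: eq_bigr => k _; rewrite !mxE; ring.
under eq_bigr do rewrite E; under [in RHS]eq_bigr do rewrite E.
rewrite !expansion_bihom // => /(mulfI (expf_neq0 _ t0)) h.
by under eq_bigr do rewrite mulrBl; rewrite sumrB h subrr.
Qed.

(** The shift from [u = 0] to [u = v]; a form of positive degree vanishes at 0. *)
Lemma bihom_diag q v : (0 < q <= p)%N -> bihom q v v = 0.
Proof.
(* [0 * 0] presents the zero vector in the shape that [bihom_scaler] rewrites. *)
move=> /andP[q0 qp]; have E : bihom q v (fun=> 0 * 0) = 0.
  by rewrite (bihom_scaler q v (fun=> 0) 0) expr0n gtn_eqF // mul0r.
have := bihom_shift v (fun=> 0 * 0) qp; rewrite E => <-.
by congr (bihom q v _); apply/funext => k; rewrite mul0r addr0.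
Qed.

Lemma horner_eq0 (P : {poly R}) : (forall s, P.[s] = 0) -> P = 0.
Proof.
move=> h; apply/polyP => k; rewrite coef0.
have [kP|/(nth_default 0) //] := ltnP k (size P).
by apply: (@poly_eq0_near R (size P) (fun k => P`_k) 1) => // t _; rewrite -horner_coef.
Qed.

(** By the shift, [bihom q v] at [v + s * e_l] equals its value at [s * e_l], a multiple of
    [s ^+ q]. As [1 < q], the coefficient of [s] on the left must vanish. *)
Lemma bihom_linear_part q v l : (1 < q <= p)%N ->
  msum p (fun i => msum q.-1 (fun j => A (i ++ l :: j) * (mon v i * mon v j))) = 0.
Proof.
move=> /andP[q1 qp].
have /boolp.choice[P HP] (i : p.-tuple 'I_n) := msum_affine_poly (q := q) v l
  (fun s t st _ => Asym (size_tuple i) (perm_refl i) st).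
pose Q := \sum_(i : p.-tuple 'I_n) mon v i *: P i.
have Qe : Q = (bihom q v (fun k => (k == l)%:R))%:P * 'X^q.
  apply: subr0_eq; apply: horner_eq0 => s.
  rewrite hornerD hornerN hornerM hornerC hornerXn [_ * s ^+ q]mulrC -bihom_scaler.
  apply/eqP; rewrite subr_eq0 -bihom_shift // /Q horner_sum; apply/eqP.
  apply: eq_bigr => i _; rewrite hornerZ; have [<- _ _] := HP i.
  by rewrite -msumZ; apply: eq_msum => j _; ring.
have : Q`_1 = 0 by rewrite Qe coefCM coefXn ltn_eqF // mulr0.
rewrite /Q coef_sum.
rewrite (eq_bigr (fun i : p.-tuple 'I_n => q%:R * (mon v i *
    msum q.-1 (fun j => A (val i ++ l :: j) * mon v j)))).
  rewrite -big_distrr /= => /eqP; rewrite mulf_eq0 pnatr_eq0 gtn_eqF ?(ltnW q1) //= => /eqP <-.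
  by apply: eq_bigr => i _; rewrite -msumZ; apply: eq_msum => j _; ring.
by move=> i _; rewrite coefZ; have [_ _ ->] := HP i; ring.
Qed.

(** With no letter in [l] this is [bihom_diag]; with one letter, moved to the head of the second
    block, it is [bihom_linear_part] in degree [q.+1]. *)
Lemma symmetrization_eq0 q (l : seq 'I_n) v : (size l <= 1)%N -> (0 < q)%N ->
  (q + size l <= p)%N -> msum (p + q) (fun k => A (k ++ l) * mon v k) = 0.
Proof.
move=> sl q0 qp; rewrite msum_cat; case: l sl qp => [|l [|//]] _ /= qp.
  rewrite -[RHS](@bihom_diag q v) ?q0 //=; last by rewrite addn0 in qp.
  by apply: eq_msum => i _; apply: eq_msum => j _; rewrite cats0 mon_cat.
have hq : (1 < q.+1 <= p)%N by rewrite ltnS q0 /= -addn1.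
rewrite -[RHS](bihom_linear_part v l hq); apply: eq_msum => i si; apply: eq_msum => j _; rewrite mon_cat -catA.
congr (_ * _); apply: Asym => //; by rewrite cats1 perm_rcons.
Qed.

Lemma permutation_sum_eq0 q (k : (p + q).-tuple 'I_n) (l : seq 'I_n) :
  (size l <= 1)%N -> (0 < q)%N -> (q + size l <= p)%N -> permutation_sum A k l = 0.
Proof.
move=> sl q0 qp.
have h v : msum (p + q) (fun s => A (s ++ l) * mon v s) = 0.
  exact: symmetrization_eq0.
exact: (homogeneous_eq0 (B := fun s => A (s ++ l)) h k).
Qed.

(** Among [p.+1] letters a rotation merely decides which one leaves the first block, since the order
    of the others is immaterial. The right-hand side shows that the cyclic sum is symmetric in
    [k]. *)
Lemma cyclic_sumE (k l : seq 'I_n) : size k = p.+1 ->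
  cyclic_sum A k l = \sum_(x <- k) A (rem x k ++ x :: l).
Proof.
move=> sk; case: k sk => // x0 k' sk; set k := x0 :: k' in sk *.
have E i : (i < p.+1)%N -> A (rot i.+1 k ++ l) = A (rem (nth x0 k i) k ++ nth x0 k i :: l).
  move=> ip; have ik : (i < size k)%N by rewrite sk.
  have -> : rot i.+1 k ++ l = (drop i.+1 k ++ take i k) ++ nth x0 k i :: l.
    by rewrite /rot (take_nth x0 ik) -cats1 -!catA.
  have pe : perm_eq (nth x0 k i :: (drop i.+1 k ++ take i k)) k.
    by rewrite -cat_cons -drop_nth // perm_catC cat_take_drop.
  have kx : nth x0 k i \in k by exact: mem_nth.
  apply: Asym => //.
    by have /perm_size := pe; rewrite /= => -[->]; rewrite -[RHS]/(p.+1.-1) -sk.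
  by rewrite -(perm_cons (nth x0 k i)) (permPl pe) (permPl (perm_to_rem kx)).
(* Rotation by [i.+1] brings letter [i] to the end, so the trivial rotation [r = 0] belongs to the
   last letter; hence the opposite ends split off the two sums. *)
rewrite /cyclic_sum (big_nth x0) big_mkord sk [LHS]big_ord_recl [RHS]big_ord_recr /= [LHS]addrC.
congr (_ + _).
  by apply: eq_bigr => i _; rewrite E // ltnS ltnW.
rewrite -E // (_ : rot p.+1 k = k); last by rewrite -sk rot_size.
by rewrite cats0.
Qed.

(** The form with coefficients [B] is a sum of [p.+1] rotated copies of a form that vanishes by
    [symmetrization_eq0]. Since [B] is symmetric, its symmetrization is [(p.+1)]! times [B k], so
    [B k] vanishes too. *)
Lemma cyclic_sum_eq0 (k l : seq 'I_n) : size k = p.+1 -> (size l < p)%N ->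
  (size l <= 1)%N -> cyclic_sum A k l = 0.
Proof.
move=> sk lp sl.
pose B s := cyclic_sum A s l.
have Bsym (s t : seq 'I_n) : size s = p.+1 -> perm_eq s t -> B s = B t.
  move=> ss st; have ts : size t = p.+1 by rewrite -(perm_size st).
  rewrite /B !cyclic_sumE // (perm_big _ st) /=; apply: eq_big_seq => x xt.
  have xs : x \in s by rewrite (perm_mem st).
  rewrite -!cat_rcons -!cats1 -!catA; apply: Asym => //; first by rewrite size_rem // ss.
  by rewrite -(perm_cons x) -(permPl (perm_to_rem xs)) -(permPr (perm_to_rem xt)).
have B0 v : msum p.+1 (fun s => B s * mon v s) = 0.
  transitivity (\sum_(q < p.+1) msum p.+1 (fun s => A (s ++ l) * mon v s)).
    rewrite -msum_sum.
    transitivity (\sum_(q < p.+1) msum p.+1 (fun s => A (rot q s ++ l) * mon v (rot q s))).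
      rewrite -msum_sum; apply: eq_msum => s ss; rewrite /B /cyclic_sum ss big_distrl.
      apply: eq_bigr => q _; congr (_ * _); apply: mon_perm.
      by rewrite perm_sym perm_rot.
    rewrite msum_sum; apply: eq_bigr => q _.
    exact: (msum_rot p.+1 q (fun s => A (s ++ l) * mon v s)).
  rewrite big1 // => q _; rewrite -addn1; exact: symmetrization_eq0.
have := homogeneous_eq0 B0 (@Tuple p.+1 _ k (introT eqP sk)).
rewrite (eq_bigr (fun=> B k)); last first.
  move=> s _; apply: Bsym; rewrite ?size_tuple //; exact: perm_permute.
rewrite sumr_const card_Sn => /eqP.
by rewrite mulrn_eq0 eqn0Ngt fact_gt0 => /eqP.
Qed.

End Coefficients.

Lemma flat_killing_coefficients (R : realType) n (p : nat)
    (F : p.-tuple 'I_n -> 'rV[R]_n -> R) (r : R) : 0 < r ->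
  (forall (x : 'rV[R]_n) i (s : 'S_p), `|x| < r -> F (permute s i) x = F i x) ->
  (forall x z : 'rV[R]_n, `|x| < r -> `|z| < r ->
    \sum_i F i x * mon (fun k => z 0 k - x 0 k) i =
    \sum_i F i z * mon (fun k => z 0 k - x 0 k) i) ->
  exists A : seq 'I_n -> R, [/\ coef_symmetric p A, coef_relations p A &
    forall (i : p.-tuple 'I_n) (x : 'rV[R]_n), `|x| < r -> F i x = poly_part A i x].
Proof.
move=> r0 Fsym Fkill; have [A [Asym A0 Ax]] := expansion_exists r0 Fsym Fkill.
exists A; split.
- move=> q i i' j j' _; apply: Asym; exact: size_tuple.
- split.
  + move=> s k l /andP[s1 sp]; apply: (permutation_sum_eq0 r0 Fkill Asym Ax) => //=; lia.
  + move=> s k l /andP[s1 sp] es; apply: (cyclic_sum_eq0 r0 Fkill Asym Ax) => //=; last by lia.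
    rewrite size_tuple; lia.
  (* For [p = 0] no conservation law reaches these coefficients; they are 0 by the choice of [A] on
     long words. *)
  + move=> k; case: (posnP p) => [p0|p_gt0]; last first.
      by apply: (cyclic_sum_eq0 r0 Fkill Asym Ax) => //=; rewrite size_tuple addn1.
    rewrite /cyclic_sum big1 // => q _; apply: A0.
    by rewrite cats0 size_rot size_tuple p0.
- move=> i x xr; rewrite (Ax i x xr) /poly_part; apply: eq_bigr => q _.
  by apply: eq_bigr => j _; rewrite mon_tuple.
Qed.

(** * Linear ordinary differential equations *)

Section LinearODE.
Context {R : realType}.

Lemma continuous_at_sum (V : topologicalType) (I : Type) (s : seq I) (F : I -> V -> R) x :
  (forall i, {for x, continuous (F i)}) ->
  {for x, continuous (fun y => \sum_(i <- s) F i y)}.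
Proof.
move=> h; elim: s => [|i s IH].
  rewrite (_ : (fun _ => _) = cst 0); first exact: cst_continuous.
  by apply/funext => y; rewrite big_nil.
rewrite (_ : (fun _ => _) = (fun y => F i y + \sum_(j <- s) F j y)).
  exact: continuousD.
by apply/funext => y; rewrite big_cons.
Qed.

Lemma antiderivative (g : R -> R) : continuous g ->
  exists2 F : R -> R, F 0 = 0 & forall t : R, 0 <= t <= 1 -> is_derive t 1 F (g t).
Proof.
move=> cg.
(* The integral runs over an interval larger than [0, 1], from -1 to 2, to make the derivatives at 0
   and 1 two-sided. *)
pose H x := \int[lebesgue_measure]_(t in `[(- 1)%R, x]) g t.
exists (fun x => H x - H 0) => [|t /andP[t0 t1]]; first by rewrite subrr.
have int : lebesgue_measure.-integrable `[-1, 2] (EFin \o g).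
  apply: continuous_compact_integrable; first exact: segment_compact.
  exact: continuous_subspaceT.
have t2 : t < 2 by rewrite (le_lt_trans t1) // ltr1n.
have t1' : -1 < t by rewrite (lt_le_trans _ t0) // oppr_lt0.
have [dH eH] : derivable H t 1 /\ derive1 H t = g t.
  exact: continuous_FTC1_closed t2 int t1' (cg t).
move: H dH eH => {int} H dH eH.
have h1 : is_derive t (1 : R) H (g t).
  by apply: (DeriveDef dH); rewrite -derive1E.
have h2 : is_derive t (1 : R) (cst (H 0) : R -> R) (0 : R) by exact: is_derive_cst.
by have := is_deriveB h1 h2; rewrite subr0.
Qed.

Lemma derivative_bound (f f' : R -> R) (C : R) : f 0 = 0 ->
  (forall t : R, 0 <= t <= 1 -> is_derive t 1 f (f' t)) ->
  (forall t : R, 0 <= t <= 1 -> `|f' t| <= C) ->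
  forall t : R, 0 <= t <= 1 -> `|f t| <= C.
Proof.
move=> f0 df fC t /andP[t0 t1].
have tt s : 0 <= s <= t -> 0 <= s <= 1 by move=> /andP[-> /le_trans->].
have [||c + E] := @MVT_segment R f f' 0 t t0.
- move=> s; rewrite in_itv /= => /andP[/ltW s0 /ltW st]; apply: df; apply: tt.
  by rewrite s0 st.
- by apply: derivable_continuous_within => s h; have [] := df s (tt s h).
rewrite in_itv /= => c01; rewrite f0 !subr0 in E.
rewrite E normrM (ger0_norm t0).
have h := fC c (tt c c01); apply: le_trans h; by rewrite ler_piMr.
Qed.

Lemma geometric_small (M e : R) : 0 < e -> exists k, M / 2 ^+ k < e.
Proof.
move=> e0; exists (Num.bound `|M / e|).
rewrite ltr_pdivrMr ?exprn_gt0 // -ltr_pdivrMl // mulrC.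
apply: (le_lt_trans (ler_norm _)); apply: (lt_le_trans (archi_boundP (normr_ge0 _))).
rewrite -natrX ler_nat; apply: ltnW; exact: ltn_expl.
Qed.

(** With [e k] the sum of all later steps, the intervals of radius [e k] around [w k] are nested;
    the supremum of their left ends lies in each of them, which also gives the rate. *)
Lemma geometric_cauchy (w : nat -> R) (M : R) : 0 <= M ->
  (forall k, `|w k.+1 - w k| <= M / 2 ^+ k) ->
  exists l, forall k, `|w k - l| <= 2 * M / 2 ^+ k.
Proof.
move=> M0 h.
pose e k := 2 * M / 2 ^+ k.
have eS k : e k = e k.+1 + M / 2 ^+ k.
  by rewrite /e exprS invfM; field; rewrite expf_neq0.
have e0 k : 0 <= e k by rewrite divr_ge0 ?mulr_ge0 ?exprn_ge0.
have up k d : w k - e k <= w (k + d)%N - e (k + d)%N.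
  elim: d => [|d IH]; first by rewrite addn0.
  rewrite addnS; apply: (le_trans IH); have := h (k + d)%N.
  rewrite ler_distl => /andP[h1 _]; rewrite (eS (k + d)%N); lra.
have down k d : w (k + d)%N + e (k + d)%N <= w k + e k.
  elim: d => [|d IH]; first by rewrite addn0.
  rewrite addnS; apply: le_trans IH; have := h (k + d)%N.
  rewrite ler_distl => /andP[_ h1]; rewrite (eS (k + d)%N); lra.
have cross j k : w j - e j <= w k + e k.
  apply: (le_trans (up j k)); apply: le_trans (down k j); rewrite addnC.
  by rewrite lerD2l (le_trans _ (e0 _)) // oppr_le0.
pose S := range (fun k => w k - e k).
have S0 : S !=set0 by exists (w 0%N - e 0%N); exists 0%N.
exists (sup S) => k; rewrite ler_distlC -/(e k).
apply/andP; split.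
  apply: ub_le_sup; last by exists k.
  by exists (w 0%N + e 0%N) => _ [j _ <-].
by apply: ge_sup => // _ [j _ <-].
Qed.

Lemma three_epsilon (p q p' q' c e : R) : `|p' - p| <= c -> `|q' - q| <= c ->
  `|p' - q'| < e / 3 -> c < e / 3 -> `|p - q| < e.
Proof.
move=> h1 h2 h3 hc.
have : `|p - q| <= `|p' - p| + `|p' - q'| + `|q' - q|.
  rewrite (_ : p - q = - (p' - p) + (p' - q') + (q' - q)); last by ring.
  by rewrite (le_trans (ler_normD _ _)) // lerD // (le_trans (ler_normD _ _)) // normrN.
lra.
Qed.

(** Retraction onto [0, 1]: it turns data controlled on [0, 1] into functions continuous on the
    whole line, as [antiderivative] requires. *)
Definition clip (t : R) : R := Num.max 0 (Num.min 1 t).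

Lemma clip01 t : 0 <= clip t <= 1.
Proof. by rewrite /clip le_max lexx /= ge_max ler01 ge_min lexx. Qed.

Lemma clip_id t : 0 <= t <= 1 -> clip t = t.
Proof. by move=> /andP[t0 t1]; rewrite /clip (min_idPr t1) (max_idPr t0). Qed.

Lemma continuous_clip : continuous clip.
Proof.
move=> t; apply: (@continuous_max R R (cst 0) (Num.min 1)); first exact: cvg_cst.
by apply: (@continuous_min R R (cst 1) id); [exact: cvg_cst|exact: cvg_id].
Qed.

(** Picard iteration. Row sums at most 1/2 make each step halve the uniform distance, so the whole
    interval [0, 1] is covered at once. *)
Lemma linear_ode (T : finType) (B : R -> T -> T -> R) (u0 : T -> R) :
  (forall a b (t : R), 0 <= t <= 1 -> {for t, continuous (fun t => B t a b)}) ->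
  (forall (t : R) a, 0 <= t <= 1 -> \sum_b `|B t a b| <= 1 / 2) ->
  exists u : T -> R -> R, (forall a, u a 0 = u0 a) /\
    forall a (t : R), 0 <= t <= 1 -> is_derive t 1 (u a) (\sum_b B t a b * u b t).
Proof.
move=> cB bB.
pose rhs (v : T -> R -> R) a t := \sum_b B (clip t) a b * v b (clip t).
pose cont (v : T -> R -> R) := forall a, continuous (fun t => v a (clip t)).
have crhs v a : cont v -> continuous (rhs v a).
  move=> cv t; apply: continuous_at_sum => b; apply: continuousM; last exact: cv.
  apply: (@continuous_comp _ _ _ clip (fun t => B t a b)); first exact: continuous_clip.
  exact: cB (clip01 t).
have step v : exists w : T -> R -> R, cont v -> [/\ cont w, forall a, w a 0 = u0 a &
    forall a (t : R), 0 <= t <= 1 -> is_derive t 1 (w a) (\sum_b B t a b * v b t)].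
  (* For a discontinuous [v] the witness is junk; it makes the step a total function to iterate. *)
  case: (pselect (cont v)) => [cv|nv]; last by exists v.
  have /boolp.choice[P HP] a : exists P : R -> R, P 0 = 0 /\
      forall t : R, 0 <= t <= 1 -> is_derive t 1 P (rhs v a t).
    by have [P] := antiderivative (crhs v a cv); exists P.
  have dP a (t : R) : 0 <= t <= 1 ->
      is_derive t 1 (fun s => u0 a + P a s) (\sum_b B t a b * v b t).
    move=> t01; have h1 : is_derive t (1 : R) (cst (u0 a) : R -> R) (0 : R) by exact: is_derive_cst.
    have := is_deriveD h1 ((HP a).2 t t01); rewrite add0r /rhs.
    by rewrite clip_id.
  exists (fun a t => u0 a + P a t) => _; split=> //; last first.
    by move=> a; rewrite (HP a).1 addr0.
  move=> a t; apply: (@continuous_comp _ _ _ clip (fun t => u0 a + P a t)).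
    exact: continuous_clip.
  apply: differentiable_continuous; apply/derivable1_diffP.
  by have [] := dP a _ (clip01 t).
have [Phi HPhi] := boolp.choice step.
pose v k := iter k Phi (fun a _ => u0 a).
have cv k : cont (v k).
  elim: k => [|k IH]; first by move=> a; exact: cst_continuous.
  by have [] := HPhi _ IH.
have bsum (t : R) a (x : T -> R) (C : R) : 0 <= t <= 1 -> (forall b, `|x b| <= C) ->
    `|\sum_b B t a b * x b| <= C / 2.
  move=> t01 xC; apply: (le_trans (ler_norm_sum _ _ _)).
  apply: (@le_trans _ _ (\sum_b `|B t a b| * C)).
    by apply: ler_sum => b _; rewrite normrM ler_wpM2l.
  have C0 : 0 <= C by apply: le_trans (xC a).
  by rewrite -big_distrl /= mulrC ler_wpM2l // (le_trans (bB t a t01)) // mul1r.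
pose M := \sum_a `|u0 a|.
have M0 : 0 <= M by apply: sumr_ge0.
have dist (w1 w2 v1 v2 : T -> R -> R) a C :
    (w1 a 0 = w2 a 0) ->
    (forall t : R, 0 <= t <= 1 -> is_derive t 1 (w1 a) (\sum_b B t a b * v1 b t)) ->
    (forall t : R, 0 <= t <= 1 -> is_derive t 1 (w2 a) (\sum_b B t a b * v2 b t)) ->
    (forall b (t : R), 0 <= t <= 1 -> `|v1 b t - v2 b t| <= C) ->
    forall t : R, 0 <= t <= 1 -> `|w1 a t - w2 a t| <= C / 2.
  move=> w0 d1 d2 vC; apply: (@derivative_bound (fun t => w1 a t - w2 a t)
     (fun t => \sum_b B t a b * (v1 b t - v2 b t))).
  - by rewrite w0 subrr.
  - move=> t t01; have := is_deriveB (d1 t t01) (d2 t t01).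
    rewrite -sumrB; congr (is_derive t _ _ _).
    by apply: eq_bigr => b _; rewrite mulrBr.
  - by move=> t t01; apply: bsum => // b; exact: vC.
have dv k a : forall t : R, 0 <= t <= 1 -> is_derive t 1 (v k.+1 a) (\sum_b B t a b * v k b t).
  by have [_ _] := HPhi _ (cv k); apply.
have v0 k a : v k a 0 = u0 a.
  by case: k => [//|k]; have [_ h _] := HPhi _ (cv k); exact: h.
have D k : forall a (t : R), 0 <= t <= 1 -> `|v k.+1 a t - v k a t| <= M / 2 ^+ k.
  elim: k => [|k IH] a t t01.
    rewrite expr0 divr1.
    apply: (@le_trans _ _ (M / 2)); last by rewrite ler_pdivrMr // ler_peMr // ler1n.
    apply: (dist (v 1%N) (v 0%N) (v 0%N) (fun _ _ => 0)) => //.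
    - move=> s _; rewrite big1 ?mulr0; first exact: is_derive_cst.
      by move=> b _; rewrite mulr0.
    - move=> b s _; rewrite subr0 /M (bigD1 b) //= lerDl.
      by apply: sumr_ge0.
  rewrite exprS invfM [2^-1 * _]mulrC mulrA.
  apply: (dist (v k.+2) (v k.+1) (v k.+1) (v k)); [|exact: IH|by []].
  exact: (etrans (v0 k.+2 a) (esym (v0 k.+1 a))).
have /boolp.choice[u Hu] (x : T * R) : exists l, forall k,
    `|v k x.1 (clip x.2) - l| <= 2 * M / 2 ^+ k.
  by apply: geometric_cauchy => // k; apply: D; exact: clip01.
pose U a t := u (a, t).
have cU : cont U.
  move=> a t; apply/cvgrPdist_lt => e e0.
  have e3 : 0 < e / 3 by rewrite divr_gt0.
  have [k hk] := geometric_small (2 * M) e3.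
  have /cvgrPdist_lt/(_ _ e3) := cv k a t.
  apply: filterS => s /= hs.
  have h1 := Hu (a, clip t) k; have h2 := Hu (a, clip s) k.
  rewrite /= !(clip_id (clip01 _)) in h1 h2.
  rewrite /U; move: hk hs h1 h2; move: (v k a (clip t)) (v k a (clip s)) (2 * M / 2 ^+ k).
  move: (u (a, clip t)) (u (a, clip s)) => p q p' q' c hc h h1 h2.
  exact: three_epsilon h1 h2 h hc.
have [_ w0 dw] := HPhi _ cU.
(* Both [U] and [Phi U] are limits of the iterates: [Phi] halves the distance from [U] to [v k], so
   [Phi U] is close to [v k.+1]. *)
have eqU a (t : R) : 0 <= t <= 1 -> Phi U a t = U a t.
  move=> t01; apply/eqP; rewrite -subr_eq0 -normr_le0; apply/ler_addgt0Pr => e e0.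
  rewrite add0r.
  have [k hk] := geometric_small (2 * M) e0.
  have h1 : `|Phi U a t - v k.+1 a t| <= (2 * M / 2 ^+ k) / 2.
    apply: (dist (Phi U) (v k.+1) U (v k)); last by [].
    - exact: (etrans (w0 a) (esym (v0 k.+1 a))).
    - move=> b s s01; have := Hu (b, s) k; rewrite /= clip_id //.
      by rewrite distrC.
  have h2 := Hu (a, t) k.+1; rewrite /= clip_id // in h2.
  rewrite exprS invfM [2^-1 * _]mulrC mulrA in h2.
  apply: ltW; apply: le_lt_trans hk.
  rewrite -(subrKA (v k.+1 a t)) [leRHS]splitr.
  by apply: (le_trans (ler_normD _ _)); apply: lerD.
(* [U] is a clipped extension, constant beyond the end points; two-sided derivatives there are
   available for [Phi U]. *)
exists (Phi U); split=> // a t t01.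
have := dw a t t01; congr (is_derive t _ _ _).
by apply: eq_bigr => b _; rewrite eqU.
Qed.

End LinearODE.

(** * Growth, Lipschitz and Taylor estimates *)

Section Bounds.
Context {R : realType}.

Lemma norm_sum_le (I : finType) (F : I -> R) (C : R) :
  (forall i, `|F i| <= C) -> `|\sum_i F i| <= #|I|%:R * C.
Proof.
move=> h; apply: (le_trans (ler_norm_sum _ _ _)).
rewrite mulr_natl -sumr_const; exact: ler_sum.
Qed.

Lemma norm_sum_ord_le n (F : 'I_n -> R) (C : R) :
  (forall i, `|F i| <= C) -> `|\sum_i F i| <= n%:R * C.
Proof. by move=> /norm_sum_le; rewrite card_ord. Qed.

Lemma norm_mul_le (a b A B : R) : `|a| <= A -> `|b| <= B -> `|a * b| <= A * B.
Proof. by move=> h1 h2; rewrite normrM ler_pM. Qed.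

(** A bound [D] improves to [m + (D / 2 + e)], whose fixed point is [2 * (m + e)]. Compactness of
    [0, 1] supplies a first bound, and iteration approaches the fixed point geometrically. *)
Lemma gronwall_half (T : finType) (f f' : T -> R -> R) (m e : R) :
  (forall a (t : R), 0 <= t <= 1 -> is_derive t 1 (f a) (f' a t)) ->
  (forall a, `|f a 0| <= m) ->
  (forall t : R, 0 <= t <= 1 -> forall C, (forall b, `|f b t| <= C) ->
     forall a, `|f' a t| <= C / 2 + e) ->
  forall a (t : R), 0 <= t <= 1 -> `|f a t| <= 2 * (m + e).
Proof.
move=> df f0 hf'.
have [C HC] : exists C, forall a (t : R), 0 <= t <= 1 -> `|f a t| <= C.
  have h a : exists c, forall t : R, 0 <= t <= 1 -> `|f a t| <= c.
    have [||c _ Hc] := @EVT_max R (fun t => `|f a t|) 0 1; first exact: ler01.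
      move=> t; apply: continuous_comp; last exact: norm_continuous.
      apply: derivable_within_continuous => s; rewrite in_itv /= => s01.
      by have [] := df a s s01.
    by exists `|f a c| => t t01; apply: Hc; rewrite in_itv.
  have [c Hc] := boolp.choice h.
  exists (\sum_a `|c a|) => a t t01; apply: (le_trans (Hc a t t01)).
  rewrite (bigD1 a) //= (le_trans (ler_norm _)) // lerDl.
  exact: sumr_ge0.
have step D : (forall a (t : R), 0 <= t <= 1 -> `|f a t| <= D) ->
    forall a (t : R), 0 <= t <= 1 -> `|f a t| <= m + (D / 2 + e).
  move=> hD a t t01.
  have := @derivative_bound R (fun s => f a s - f a 0) (f' a) (D / 2 + e) (subrr _).
  have h1 : forall s : R, 0 <= s <= 1 -> is_derive s 1 (fun s => f a s - f a 0) (f' a s).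
    move=> s s01; have h2 : is_derive s (1 : R) (cst (f a 0) : R -> R) (0 : R) by exact: is_derive_cst.
    by have := is_deriveB (df a s s01) h2; rewrite subr0.
  have h3 : forall s : R, 0 <= s <= 1 -> `|f' a s| <= D / 2 + e.
    by move=> s s01; apply: hf' => // b; exact: hD.
  move=> /(_ h1 h3 t t01) h4.
  rewrite -(subrK (f a 0) (f a t)) addrC; apply: (le_trans (ler_normD _ _)).
  exact: lerD.
have iter k : forall a (t : R), 0 <= t <= 1 -> `|f a t| <= 2 * (m + e) + (C - 2 * (m + e)) / 2 ^+ k.
  elim: k => [|k IH] a t t01; first by rewrite expr0 divr1 addrC subrK; exact: HC.
  apply: (le_trans (step _ IH a t t01)).
  rewrite le_eqVlt; apply/orP; left; apply/eqP; rewrite exprS; field.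
  by rewrite expf_neq0.
move=> a t t01; apply/ler_addgt0Pr => d d0.
have [k hk] := geometric_small (C - 2 * (m + e)) d0.
by apply: (le_trans (iter k a t t01)); rewrite lerD2l ltW.
Qed.

Lemma local_variation n (I : finType) (f : I -> 'rV[R]_n -> R) (e : R) : 0 < e ->
  (forall i, differentiable (f i) 0) ->
  exists2 r : R, 0 < r &
    forall i (y : 'rV[R]_n), `|y| < r -> `|f i y - f i 0| <= e.
Proof.
move=> e0 df.
have /boolp.choice[r Hr] i : exists r : R, 0 < r /\
    forall y : 'rV[R]_n, `|y| < r -> `|f i y - f i 0| <= e.
  have /cvgrPdist_lt/(_ _ e0)/nbhs_ballP[r r0 Hr] := differentiable_continuous (df i).
  exists r; split=> // y yr; have /Hr /= h1 : ball 0 r y by apply/ball0P.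
  by rewrite distrC ltW.
exists (\big[Num.min/1]_i r i).
  by apply: lt_bigmin => // i _; exact: (Hr i).1.
by move=> i y yr; apply: (Hr i).2; exact: lt_le_trans yr (bigmin_le _ i r).
Qed.

Lemma local_bound n (I : finType) (f : I -> 'rV[R]_n -> R) :
  (forall i, differentiable (f i) 0) ->
  exists2 K : R, 0 <= K & exists2 r : R, 0 < r &
    forall i (y : 'rV[R]_n), `|y| < r -> `|f i y| <= K.
Proof.
move=> df; exists (\sum_i `|f i 0| + 1); first by rewrite addr_ge0 ?sumr_ge0.
have [r r0 Hr] := local_variation ltr01 df; exists r => // i y yr.
rewrite -[f i y](subrKC (f i 0)) (le_trans (ler_normD _ _)) //.
apply: lerD (Hr i y yr); rewrite (bigD1 i) //= lerDl.
exact: sumr_ge0.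
Qed.

Lemma lipschitz_bound n (g : 'rV[R]_n -> R) (K : R) (y h : 'rV[R]_n) :
  (forall s : R, 0 <= s <= 1 -> differentiable g (y + s *: h)) ->
  (forall (s : R) i, 0 <= s <= 1 -> `|pd i g (y + s *: h)| <= K) ->
  `|g (y + h) - g y| <= n%:R * (`|h| * K).
Proof.
move=> dg gK; have [s s01 ->] := mvt_rV dg.
apply: norm_sum_ord_le => i; apply: norm_mul_le.
  exact: coord_le.
exact: gK.
Qed.

Lemma taylor_bound n (g : 'rV[R]_n -> R) (K : R) (y h : 'rV[R]_n) : 0 <= K ->
  (forall s : R, 0 <= s <= 1 -> differentiable g (y + s *: h)) ->
  (forall (s : R) i, 0 <= s <= 1 -> differentiable (pd i g) (y + s *: h)) ->
  (forall (s : R) i j, 0 <= s <= 1 -> `|pd i (pd j g) (y + s *: h)| <= K) ->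
  `|g (y + h) - g y - \sum_j h 0 j * pd j g y| <= n%:R * (`|h| * (n%:R * (`|h| * K))).
Proof.
move=> K0 dg ddg gK; have [s /andP[s0 s1] ->] := mvt_rV dg.
rewrite -sumrB; apply: norm_sum_ord_le => j; rewrite -mulrBr.
apply: norm_mul_le; first exact: coord_le.
have st (t : R) : 0 <= t <= 1 -> 0 <= t * s <= 1.
  by move=> /andP[t0 t1]; rewrite mulr_ge0 //= mulr_ile1.
apply: le_trans (_ : n%:R * (`|s *: h| * K) <= _).
  apply: lipschitz_bound => t => [|i] t01; rewrite scalerA.
    by apply: ddg; exact: st.
  by apply: gK; exact: st.
rewrite ler_wpM2l // ler_wpM2r // normrZ (ger0_norm s0).
by rewrite ler_piMl.
Qed.

End Bounds.

(** * Flat linear systems of partial differential equations *)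

Section Derivations.
Context {R : realType}.

Lemma is_derive_mul (f g : R -> R) (df dg t : R) :
  is_derive t 1 f df -> is_derive t 1 g dg ->
  is_derive t 1 (fun s => f s * g s) (df * g t + f t * dg).
Proof.
move=> h1 h2; have := is_deriveM h1 h2; congr (is_derive t _ _ _).
by rewrite addrC [df * _]mulrC.
Qed.

Lemma is_derive_bigsum (I : Type) (r : seq I) (F : I -> R -> R) (dF : I -> R) (t : R) :
  (forall i, is_derive t 1 (F i) (dF i)) ->
  is_derive t 1 (fun s => \sum_(i <- r) F i s) (\sum_(i <- r) dF i).
Proof.
move=> h; elim: r => [|i r IH].
  rewrite big_nil (_ : (fun _ => _) = cst 0); first exact: is_derive_cst.
  by apply/funext => s; rewrite big_nil.
rewrite big_cons (_ : (fun _ => _) = (fun s => F i s + \sum_(j <- r) F j s)).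
  exact: is_deriveD.
by apply/funext => s; rewrite big_cons.
Qed.

Lemma is_derive_ray n (f : 'rV[R]_n -> R) x (t : R) : differentiable f (t *: x) ->
  is_derive t 1 (fun s : R => f (s *: x)) (\sum_i x 0 i * pd i f (t *: x)).
Proof.
move=> df; have := @is_derive_segment R n f 0 x t; rewrite add0r => /(_ df).
by congr (is_derive t _ _ _); apply/funext => s; rewrite add0r.
Qed.

(** The algebra behind [ray_expansion]: the left side is the time derivative of the remainder of a
    first-order expansion in [v]. Flatness moves [B] in front of the candidate derivative, so that
    the right side is [B] applied to the remainder plus terms of second order in [v]. *)
Lemma commutator_sums (T : finType) n (v x : 'I_n -> R) (t : R) (a : T)
    (A : 'I_n -> T -> T -> R) (D : 'I_n -> 'I_n -> T -> T -> R)
    (B B' : T -> T -> R) (u u' : T -> R) :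
  (forall i j a b, D i j a b + \sum_c A j a c * A i c b = D j i a b + \sum_c A i a c * A j c b) ->
  (forall a b, B a b = \sum_i x i * A i a b) ->
  \sum_b B' a b * u' b - \sum_b B a b * u b -
    (1 * (\sum_j v j * \sum_b A j a b * u b) +
     t * \sum_j v j * \sum_b ((\sum_i x i * D i j a b) * u b + A j a b * \sum_c B b c * u c)) =
  \sum_b (B a b * (u' b - u b - t * \sum_j v j * \sum_c A j b c * u c) +
   ((B' a b - B a b) * (u' b - u b) +
    (B' a b - B a b - (\sum_j v j * A j a b) - t * \sum_j v j * \sum_i x i * D j i a b) * u b)).
Proof.
move=> flat BE.
pose P a b := \sum_j v j * A j a b.
have PE a' : \sum_j v j * (\sum_b A j a' b * u b) = \sum_b P a' b * u b.
  under eq_bigr do rewrite big_distrr /=.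
  rewrite exchange_big; apply: eq_bigr => b _; rewrite /P big_distrl /=.
  by apply: eq_bigr => j _; rewrite mulrA.
pose X b := \sum_j v j * \sum_i x i * D i j a b.
pose Y b := \sum_j v j * \sum_i x i * D j i a b.
(* Flatness contracted with [v] and [x]: it exchanges the order of [P] and [B] at the price of
   exchanging the derivatives. *)
have key b : X b + \sum_c P a c * B c b = Y b + \sum_c B a c * P c b.
  have E1 : \sum_c P a c * B c b = \sum_j v j * \sum_i x i * \sum_c A j a c * A i c b.
    under eq_bigr do rewrite BE big_distrlr /=.
    rewrite exchange_big; apply: eq_bigr => j _; rewrite exchange_big big_distrr /=.
    apply: eq_bigr => i _; rewrite !big_distrr /=; apply: eq_bigr => c _; ring.
  have E2 : \sum_c B a c * P c b = \sum_j v j * \sum_i x i * \sum_c A i a c * A j c b.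
    under eq_bigr do rewrite BE big_distrlr /=.
    under eq_bigr do rewrite exchange_big /=.
    rewrite exchange_big; apply: eq_bigr => j _; rewrite exchange_big big_distrr /=.
    apply: eq_bigr => i _; rewrite !big_distrr /=; apply: eq_bigr => c _; ring.
  rewrite E1 E2 /X /Y -!big_split; apply: eq_bigr => j _ /=.
  rewrite -!mulrDr -!big_split; congr (_ * _); apply: eq_bigr => i _ /=.
  by rewrite -!mulrDr flat.
have assoc (F H : T -> T -> R) : \sum_b F a b * (\sum_c H b c * u c) =
    \sum_b (\sum_c F a c * H c b) * u b.
  under eq_bigr do rewrite big_distrr /=.
  rewrite exchange_big; apply: eq_bigr => c _; rewrite big_distrl /=.
  by apply: eq_bigr => b _; rewrite mulrA.
have XE : \sum_j v j * \sum_b ((\sum_i x i * D i j a b) * u b + A j a b * \sum_c B b c * u c) =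
    \sum_b (Y b * u b + B a b * \sum_c P b c * u c).
  transitivity (\sum_b (X b * u b + P a b * \sum_c B b c * u c)).
    under eq_bigr do rewrite big_distrr /=.
    rewrite exchange_big; apply: eq_bigr => b _ /=.
    rewrite /X /P !big_distrl -big_split; apply: eq_bigr => j _ /=; ring.
  rewrite !big_split /= !assoc -!big_split; apply: eq_bigr => b _ /=.
  by rewrite -!mulrDl key.
rewrite XE PE mul1r [t * _]big_distrr /= opprD addrA -!sumrB.
by apply: eq_bigr => b _; rewrite PE -/(P a b) -/(Y b); ring.
Qed.

End Derivations.

Section FlatSystem.
Context {R : realType} {n : nat} {T : finType}.
Variables (A : 'I_n -> T -> T -> 'rV[R]_n -> R) (r K : R).
Hypothesis r0 : 0 < r.
Hypothesis K0 : 0 <= K.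
Hypothesis cA : forall i a b, ck 2 (ball 0 r) (A i a b).
Hypothesis bA : forall i a b (y : 'rV[R]_n), `|y| < r -> `|A i a b y| <= K.
Hypothesis bdA : forall i a b j (y : 'rV[R]_n), `|y| < r -> `|pd j (A i a b) y| <= K.
Hypothesis bddA : forall i a b j k (y : 'rV[R]_n), `|y| < r ->
  `|pd k (pd j (A i a b)) y| <= K.
Hypothesis small : #|T|%:R * (n%:R * (r * K)) <= 1 / 2.
Hypothesis flat : forall y : 'rV[R]_n, `|y| < r -> forall i j a b,
  pd i (A j a b) y + \sum_c A j a c y * A i c b y =
  pd j (A i a b) y + \sum_c A i a c y * A j c b y.
Variable U0 : T -> R.

(** The coefficient matrix of the system along the ray [t *: x]. *)
Definition radial (x : 'rV[R]_n) (t : R) a b := \sum_i x 0 i * A i a b (t *: x).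
Notation B := radial.

Lemma norm_ray (x : 'rV[R]_n) (t : R) : `|x| < r -> 0 <= t <= 1 -> `|t *: x| < r.
Proof.
move=> xr /andP[t0 t1]; apply: le_lt_trans xr.
by rewrite normrZ (ger0_norm t0) ler_piMl.
Qed.

Lemma norm_segment (x v : 'rV[R]_n) (s : R) : `|x| < r -> `|x + v| < r -> 0 <= s <= 1 ->
  `|x + s *: v| < r.
Proof.
move=> xr xvr /andP[s0 s1].
have -> : x + s *: v = (1 - s) *: x + s *: (x + v).
  by rewrite scalerDr addrA -scalerDl subrK scale1r.
apply: (le_lt_trans (ler_normD _ _)); rewrite !normrZ (ger0_norm s0) ger0_norm ?subr_ge0 //.
case: (eqVneq s 0) => [->|sn]; first by rewrite mul0r addr0 subr0 mul1r.
apply: (@lt_le_trans _ _ ((1 - s) * r + s * r)); last by rewrite -mulrDl subrK mul1r.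
by apply: ler_ltD; [rewrite ler_wpM2l ?subr_ge0 // ltW|rewrite ltr_pM2l // lt0r sn].
Qed.

Lemma diffA i a b (y : 'rV[R]_n) : `|y| < r -> differentiable (A i a b) y.
Proof. by move=> yr; apply: (ck_diff (@cA i a b)); apply/ball0P. Qed.

Lemma diffdA i a b j (y : 'rV[R]_n) : `|y| < r -> differentiable (pd j (A i a b)) y.
Proof. by move=> yr; have /ckS[_ /(_ j) h] := @cA i a b; apply: (ck_diff h); apply/ball0P. Qed.

Lemma radial_bound x (t : R) a b : `|x| < r -> 0 <= t <= 1 -> `|B x t a b| <= n%:R * (r * K).
Proof.
move=> xr t01; apply: norm_sum_ord_le => i; apply: norm_mul_le.
  by apply: (le_trans (coord_le _ _)); exact: ltW.
by apply: bA; exact: norm_ray.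
Qed.

Lemma radial_sum x (t : R) a : `|x| < r -> 0 <= t <= 1 -> \sum_b `|B x t a b| <= 1 / 2.
Proof.
move=> xr t01; apply: le_trans small; apply: (le_trans (ler_norm _)).
by apply: norm_sum_le => b; rewrite normr_id; exact: radial_bound.
Qed.

Lemma radial_cont x a b (t : R) : `|x| < r -> 0 <= t <= 1 ->
  {for t, continuous (fun t => B x t a b)}.
Proof.
move=> xr t01; apply: continuous_at_sum => i; apply: continuousM; first exact: cst_continuous.
apply: differentiable_continuous; apply/derivable1_diffP.
by have [] := is_derive_ray (diffA i a b (norm_ray xr t01)).
Qed.

Lemma ray_solution : exists u : 'rV[R]_n -> T -> R -> R, forall x, `|x| < r ->
  (forall a, u x a 0 = U0 a) /\
  forall a (t : R), 0 <= t <= 1 -> is_derive t 1 (u x a) (\sum_b B x t a b * u x b t).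
Proof.
have /boolp.choice[u Hu] (x : 'rV[R]_n) : exists w : T -> R -> R, `|x| < r ->
    (forall a, w a 0 = U0 a) /\
    forall a (t : R), 0 <= t <= 1 -> is_derive t 1 (w a) (\sum_b B x t a b * w b t).
  case: (ltP `|x| r) => [xr|_]; last by exists (fun _ _ => 0).
  have [w [w0 dw]] := linear_ode U0 (fun a b t => @radial_cont x a b t xr)
    (fun t a => @radial_sum x t a xr).
  by exists w.
by exists u.
Qed.

Lemma radial_contract x (t : R) a (z : T -> R) C : `|x| < r -> 0 <= t <= 1 ->
  (forall b, `|z b| <= C) -> `|\sum_b B x t a b * z b| <= C / 2.
Proof.
move=> xr t01 zC; apply: (le_trans (ler_norm_sum _ _ _)).
apply: (@le_trans _ _ (\sum_b `|B x t a b| * C)).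
  by apply: ler_sum => b _; rewrite normrM ler_wpM2l.
have C0 : 0 <= C by apply: le_trans (zC a).
by rewrite -big_distrl /= mulrC ler_wpM2l // (le_trans (radial_sum a xr t01)) // mul1r.
Qed.

Lemma ray_segment (x v : 'rV[R]_n) (t s : R) : `|x| < r -> `|x + v| < r ->
  0 <= t <= 1 -> 0 <= s <= 1 -> `|t *: x + s *: (t *: v)| < r.
Proof.
move=> xr xvr t01 s01; rewrite scalerA mulrC -scalerA -scalerDr.
by apply: norm_ray t01; apply: norm_segment.
Qed.

Lemma A_lipschitz x v (t : R) i a b : `|x| < r -> `|x + v| < r -> 0 <= t <= 1 ->
  `|A i a b (t *: (x + v)) - A i a b (t *: x)| <= n%:R * (`|v| * K).
Proof.
move=> xr xvr t01; rewrite scalerDr.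
apply: (@le_trans _ _ (n%:R * (`|t *: v| * K))).
  apply: lipschitz_bound => [s|s j] s01.
    by apply: diffA; exact: ray_segment.
  by apply: bdA; exact: ray_segment.
case/andP: t01 => t0 t1.
by rewrite ler_wpM2l // ler_wpM2r // normrZ (ger0_norm t0) ler_piMl.
Qed.

Lemma A_taylor x v (t : R) i a b : `|x| < r -> `|x + v| < r -> 0 <= t <= 1 ->
  `|A i a b (t *: (x + v)) - A i a b (t *: x) - t * \sum_j v 0 j * pd j (A i a b) (t *: x)|
    <= n%:R * (`|v| * (n%:R * (`|v| * K))).
Proof.
move=> xr xvr t01; rewrite scalerDr.
have -> : t * \sum_j v 0 j * pd j (A i a b) (t *: x) =
    \sum_j (t *: v) 0 j * pd j (A i a b) (t *: x).
  by rewrite big_distrr /=; apply: eq_bigr => j _; rewrite mxE mulrA.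
apply: (@le_trans _ _ (n%:R * (`|t *: v| * (n%:R * (`|t *: v| * K))))).
  apply: taylor_bound => // [s|s j|s j k] s01.
  - by apply: diffA; exact: ray_segment.
  - by apply: diffdA; exact: ray_segment.
  - by apply: bddA; exact: ray_segment.
case/andP: t01 => t0 t1.
have tv : `|t *: v| <= `|v| by rewrite normrZ (ger0_norm t0) ler_piMl.
rewrite ler_wpM2l //; apply: ler_pM => //.
  by rewrite mulr_ge0 // mulr_ge0.
by rewrite ler_wpM2l // ler_wpM2r.
Qed.

Definition lip_const := n%:R * (K + r * (n%:R * K)).

Lemma radial_lipschitz x v (t : R) a b : `|x| < r -> `|x + v| < r -> 0 <= t <= 1 ->
  `|B (x + v) t a b - B x t a b| <= lip_const * `|v|.
Proof.
move=> xr xvr t01; rewrite /radial -sumrB /lip_const -mulrA.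
apply: norm_sum_ord_le => i.
have -> : (x + v) 0 i * A i a b (t *: (x + v)) - x 0 i * A i a b (t *: x) =
   v 0 i * A i a b (t *: (x + v)) + x 0 i * (A i a b (t *: (x + v)) - A i a b (t *: x)).
  by rewrite mxE; ring.
apply: (le_trans (ler_normD _ _)).
have -> : (K + r * (n%:R * K)) * `|v| = `|v| * K + r * (n%:R * (`|v| * K)) by ring.
apply: lerD; apply: norm_mul_le; rewrite ?coord_le //.
- by apply: bA; exact: norm_ray.
- by apply: (le_trans (coord_le _ _)); exact: ltW.
- exact: A_lipschitz.
Qed.

Definition taylor_const := n%:R * (n%:R * K + r * (n%:R * (n%:R * K))).

Lemma radial_taylor x v (t : R) a b : `|x| < r -> `|x + v| < r -> 0 <= t <= 1 ->
  `|B (x + v) t a b - B x t a b - (\sum_j v 0 j * A j a b (t *: x))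
    - t * \sum_j v 0 j * \sum_i x 0 i * pd j (A i a b) (t *: x)|
  <= taylor_const * (`|v| * `|v|).
Proof.
move=> xr xvr t01.
have -> : \sum_j v 0 j * (\sum_i x 0 i * pd j (A i a b) (t *: x)) =
    \sum_i x 0 i * (\sum_j v 0 j * pd j (A i a b) (t *: x)).
  under eq_bigr do rewrite big_distrr /=.
  rewrite exchange_big; apply: eq_bigr => i _; rewrite big_distrr /=.
  by apply: eq_bigr => j _; rewrite mulrCA.
rewrite /radial big_distrr /= -!sumrB /taylor_const -mulrA.
apply: norm_sum_ord_le => i.
set S := \sum_j _; set Av := A i a b _; set A0 := A i a b _.
have -> : (x + v) 0 i * Av - x 0 i * A0 - v 0 i * A0 - t * (x 0 i * S) =
   v 0 i * (Av - A0) + x 0 i * (Av - A0 - t * S).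
  by rewrite mxE; move: (x 0 i) (v 0 i) Av A0 S => *; ring.
apply: (le_trans (ler_normD _ _)).
have -> : (n%:R * K + r * (n%:R * (n%:R * K))) * (`|v| * `|v|) =
  `|v| * (n%:R * (`|v| * K)) + r * (n%:R * (`|v| * (n%:R * (`|v| * K)))) by ring.
apply: lerD; apply: norm_mul_le; rewrite ?coord_le //.
- exact: A_lipschitz.
- by apply: (le_trans (coord_le _ _)); exact: ltW.
- exact: A_taylor.
Qed.

Section Solution.
Variable u : 'rV[R]_n -> T -> R -> R.
Hypothesis u_init : forall x, `|x| < r -> forall a, u x a 0 = U0 a.
Hypothesis u_ode : forall x, `|x| < r -> forall a (t : R), 0 <= t <= 1 ->
  is_derive t 1 (u x a) (\sum_b B x t a b * u x b t).

Let M := \sum_a `|U0 a|.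

Lemma init_bound a : `|U0 a| <= M.
Proof. by rewrite /M (bigD1 a) //= lerDl sumr_ge0. Qed.

Lemma ray_bound x (t : R) a : `|x| < r -> 0 <= t <= 1 -> `|u x a t| <= 2 * M.
Proof.
move=> xr; rewrite -[M]addr0; move: a t.
apply: (@gronwall_half R T (u x) (fun a t => \sum_b B x t a b * u x b t)).
- exact: u_ode.
- by move=> a; rewrite u_init //; exact: init_bound.
- by move=> t t01 C uC a; rewrite addr0; exact: radial_contract.
Qed.

Definition var_const := #|T|%:R * (lip_const * (2 * M)).

Lemma ray_variation x v (t : R) a : `|x| < r -> `|x + v| < r -> 0 <= t <= 1 ->
  `|u (x + v) a t - u x a t| <= 2 * (var_const * `|v|).
Proof.
move=> xr xvr; rewrite -[var_const * _]add0r; move: a t.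
apply: (@gronwall_half R T (fun a t => u (x + v) a t - u x a t) (fun a t =>
  \sum_b B (x + v) t a b * u (x + v) b t - \sum_b B x t a b * u x b t)).
- by move=> a t t01; apply: is_deriveB; exact: u_ode.
- by move=> a; rewrite !u_init // subrr normr0.
- move=> t t01 C dC a.
  have -> : \sum_b B (x + v) t a b * u (x + v) b t - \sum_b B x t a b * u x b t =
      \sum_b B (x + v) t a b * (u (x + v) b t - u x b t) +
      \sum_b (B (x + v) t a b - B x t a b) * u x b t.
    by rewrite -sumrB -big_split; apply: eq_bigr => b _ /=; ring.
  apply: (le_trans (ler_normD _ _)); apply: lerD; first exact: radial_contract.
  have -> : var_const * `|v| = #|T|%:R * ((lip_const * `|v|) * (2 * M)).
    by rewrite /var_const; ring.
  by apply: norm_sum_le => b; apply: norm_mul_le; [exact: radial_lipschitz|exact: ray_bound].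
Qed.

Definition rem_const := #|T|%:R * (lip_const * (2 * var_const) + taylor_const * (2 * M)).

(** Gives the derivatives across rays. The remainder [w] starts at 0 and, by flatness, solves the
    ray equation up to an error of order [|v|^2], so Gronwall bounds it by that order. *)
Lemma ray_expansion x v a : `|x| < r -> `|x + v| < r ->
  `|u (x + v) a 1 - u x a 1 - \sum_j v 0 j * \sum_b A j a b x * u x b 1|
    <= 2 * (rem_const * (`|v| * `|v|)).
Proof.
move=> xr xvr.
(* At time [t] the ray solution stands for a function evaluated at [t *: x], whence the factor [t]
   in its derivative with respect to [x]. *)
pose w a t := u (x + v) a t - u x a t - t * \sum_j v 0 j * \sum_b A j a b (t *: x) * u x b t.
suff h : forall a (t : R), 0 <= t <= 1 -> `|w a t| <= 2 * (0 + rem_const * (`|v| * `|v|)).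
  have i1 : 0 <= (1 : R) <= 1 by rewrite ler01 lexx.
  have := h a 1 i1; rewrite add0r /w mul1r.
  by under eq_bigr do under eq_bigr do rewrite scale1r.
move=> {a}.
pose w' a t := \sum_b B (x + v) t a b * u (x + v) b t - \sum_b B x t a b * u x b t -
    (1 * (\sum_j v 0 j * \sum_b A j a b (t *: x) * u x b t) +
     t * \sum_j v 0 j * \sum_b ((\sum_i x 0 i * pd i (A j a b) (t *: x)) * u x b t +
       A j a b (t *: x) * \sum_c B x t b c * u x c t)).
apply: (@gronwall_half R T w w').
- move=> a t t01; apply: is_deriveB.
    by apply: is_deriveB; exact: u_ode.
  apply: (is_derive_mul (f := id)).
  apply: is_derive_bigsum => j; rewrite -[X in is_derive _ _ _ X]add0r.
  rewrite -[X in is_derive _ _ _ (X + _)](mul0r (\sum_b A j a b (t *: x) * u x b t)).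
  apply: (is_derive_mul (f := fun=> v 0 j)).
  apply: is_derive_bigsum => b.
  apply: (is_derive_mul (f := fun s => A j a b (s *: x))); last exact: u_ode.
  by apply: is_derive_ray; apply: diffA; exact: norm_ray.
- by move=> a; rewrite /w !u_init // mul0r subrr subr0 normr0.
- move=> t t01 C wC a.
  have flat' i j a' b := flat (norm_ray xr t01) i j a' b.
  rewrite /w' (commutator_sums (fun j => v 0 j) t a (B (x + v) t) (u x ^~ t) (u (x + v) ^~ t) flat' (fun _ _ => erefl)).
  rewrite big_split; apply: (le_trans (ler_normD _ _)); apply: lerD.
    by apply: radial_contract => // b; exact: wC.
  have -> : rem_const * (`|v| * `|v|) =
      #|T|%:R * ((lip_const * `|v|) * (2 * (var_const * `|v|)) +
                 (taylor_const * (`|v| * `|v|)) * (2 * M)).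
    by rewrite /rem_const; ring.
  apply: norm_sum_le => b; apply: (le_trans (ler_normD _ _)); apply: lerD; apply: norm_mul_le.
  + exact: radial_lipschitz.
  + exact: ray_variation.
  + exact: radial_taylor.
  + exact: ray_bound.
Qed.

Lemma ray_solution_differentiable x a : `|x| < r ->
  differentiable (fun y => u y a 1) x /\
  forall i, pd i (fun y => u y a 1) x = \sum_b A i a b x * u x b 1.
Proof.
move=> xr; apply: differentiableP_eps => e e0.
pose c := 2 * rem_const.
exists (Num.min (r - `|x|) (e / (1 + `|c|))).
  by rewrite lt_min subr_gt0 xr /= divr_gt0 // ltr_pwDl.
move=> v; rewrite lt_min => /andP[v1 v2].
have xvr : `|x + v| < r.
  by apply: (le_lt_trans (ler_normD _ _)); rewrite -ltrBrDl.
apply: (le_trans (ray_expansion a xr xvr)); rewrite (_ : 2 * _ = c * `|v| * `|v|); last first.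
  by rewrite /c; move: rem_const => q; ring.
rewrite ler_wpM2r //.
apply: (@le_trans _ _ ((1 + `|c|) * `|v|)).
  apply: ler_wpM2r => //; apply: (le_trans (ler_norm _)); by rewrite lerDr ler01.
by rewrite mulrC -ler_pdivlMr ?ltW // ltr_pwDl.
Qed.

Lemma ray_solution_origin a : u 0 a 1 = U0 a.
Proof.
have zr : `|0 : 'rV[R]_n| < r by rewrite normr0.
have i1 : 0 <= (1 : R) <= 1 by rewrite ler01 lexx.
have D (t : R) : 0 <= t <= 1 -> is_derive t 1 (fun t => u 0 a t - U0 a) (0 : R).
  move=> t01; have h2 : is_derive t (1 : R) (cst (U0 a) : R -> R) (0 : R) by exact: is_derive_cst.
  have := is_deriveB (u_ode zr a t01) h2; rewrite subr0.
  congr (is_derive t _ _ _); apply: big1 => b _.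
  by rewrite /radial big1 ?mul0r // => i _; rewrite mxE mul0r.
apply/eqP; rewrite -subr_eq0 -normr_le0.
apply: (@derivative_bound R (fun t => u 0 a t - U0 a) (fun=> 0) 0 _ D) => //.
  by rewrite (u_init zr) subrr.
by move=> t _; rewrite normr0.
Qed.

End Solution.

Lemma flat_system_bounded : exists U : T -> 'rV[R]_n -> R, (forall a, U a 0 = U0 a) /\
  forall x : 'rV[R]_n, `|x| < r -> forall a, differentiable (U a) x /\
    forall i, pd i (U a) x = \sum_b A i a b x * U b x.
Proof.
have [u Hu] := ray_solution.
have h1 x (xr : `|x| < r) := (Hu x xr).1; have h2 x (xr : `|x| < r) := (Hu x xr).2.
exists (fun a x => u x a 1); split=> [a|x xr a].
  exact: ray_solution_origin.
exact: ray_solution_differentiable.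
Qed.

End FlatSystem.

(** The radius precedes the initial value, so finitely many solutions share a ball. Smoothness is
    bootstrapped from the equation, which expresses the derivatives of [U] through [U]. *)
Lemma flat_system (R : realType) (n : nat) (T : finType)
    (A : 'I_n -> T -> T -> 'rV[R]_n -> R) (r0 : R) : 0 < r0 ->
  (forall i a b, smooth_on (ball 0 r0) (A i a b)) ->
  (forall y : 'rV[R]_n, `|y| < r0 -> forall i j a b,
    pd i (A j a b) y + \sum_c A j a c y * A i c b y =
    pd j (A i a b) y + \sum_c A i a c y * A j c b y) ->
  exists2 r : R, 0 < r <= r0 & forall U0 : T -> R, exists U : T -> 'rV[R]_n -> R,
    [/\ forall a, U a 0 = U0 a, forall a, smooth_on (ball 0 r) (U a) &
      forall x : 'rV[R]_n, `|x| < r -> forall a i,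
        pd i (U a) x = \sum_b A i a b x * U b x].
Proof.
move=> r00 sA flat.
have o0 : (ball 0 r0 : set 'rV[R]_n) 0 by apply/ball0P; rewrite normr0.
have [K1 K10 [r1 r10 b1]] := local_bound
  (f := fun i : 'I_n * T * T => A i.1.1 i.1.2 i.2) (fun i => sA _ _ _ [::] 0 o0).
have [K2 K20 [r2 r20 b2]] := local_bound
  (f := fun i : 'I_n * T * T * 'I_n => pd i.2 (A i.1.1.1 i.1.1.2 i.1.2))
  (fun i => sA _ _ _ [:: i.2] 0 o0).
have [K3 K30 [r3 r30 b3]] := local_bound
  (f := fun i : 'I_n * T * T * 'I_n * 'I_n => pd i.2 (pd i.1.2 (A i.1.1.1.1 i.1.1.1.2 i.1.1.2)))
  (fun i => sA _ _ _ [:: i.2; i.1.2] 0 o0).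
pose K := K1 + K2 + K3.
have K0 : 0 <= K by rewrite !addr_ge0.
pose c := #|T|%:R * (n%:R * K) : R.
have c0 : 0 <= c by rewrite !mulr_ge0.
(* The last entry secures [c * r <= 1 / 2], the smallness needed along rays; [1 + c] is positive
   even when [c = 0]. *)
pose r := Num.min (Num.min r0 r1) (Num.min (Num.min r2 r3) (1 / 2 / (1 + c))).
have rpos : 0 < r by rewrite !lt_min r00 r10 r20 r30 !divr_gt0 // ltr_pwDl.
have [rr0 rr1 rr2 rr3 rc] : [/\ r <= r0, r <= r1, r <= r2, r <= r3 & r <= 1 / 2 / (1 + c)].
  by rewrite /r; split; rewrite !ge_min lexx ?orbT.
exists r; first by rewrite rpos rr0.
have sub : ball 0 r `<=` (ball 0 r0 : set 'rV[R]_n).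
  by move=> y /ball0P yr; apply/ball0P; exact: lt_le_trans rr0.
have cA k i a b : ck k (ball 0 r) (A i a b).
  by apply: ck_sub sub _; apply/smooth_onP: k; exact: sA.
move=> U0; have [|||||U [UE HU]] := @flat_system_bounded R n T A r K rpos K0 (cA 2%N) _ _ _ _ _ U0.
- move=> i a b y yr; apply: (le_trans (b1 (i, a, b) y (lt_le_trans yr rr1))).
  by rewrite /K -addrA lerDl addr_ge0.
- move=> i a b j y yr; apply: (le_trans (b2 (i, a, b, j) y (lt_le_trans yr rr2))).
  by rewrite /K addrAC lerDr addr_ge0.
- move=> i a b j k y yr; apply: (le_trans (b3 (i, a, b, j, k) y (lt_le_trans yr rr3))).
  by rewrite /K lerDr addr_ge0.
- have -> : #|T|%:R * (n%:R * (r * K)) = c * r by rewrite /c; ring.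
  apply: (@le_trans _ _ ((1 + c) * r)); first by rewrite ler_wpM2r ?ltW // ltr_pwDl.
  by rewrite mulrC -ler_pdivlMr // ltr_pwDl.
- by move=> y yr; apply: flat; exact: lt_le_trans rr0.
exists U; split=> // [a|x xr a i]; last by have [_ ->] := HU x xr a.
apply/smooth_onP => k; elim: k a => [|k IH] a.
  by apply/ck0 => x /ball0P xr; have [] := HU x xr a.
apply/ckS; split=> [x /ball0P xr|i]; first by have [] := HU x xr a.
have ob : open (ball 0 r : set 'rV[R]_n) by apply: ball_open.
apply: (@ck_ext _ _ _ ob _ (fun x => \sum_b A i a b x * U b x)).
  by move=> x /ball0P xr; have [_ ->] := HU x xr a.
by apply: ck_sum => // b _; apply: ckM.
Qed.

(** * The inverse function theorem *)

Section InverseFunction.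
Context {R : realType} {n : nat}.
Implicit Types (x y v : 'rV[R]_n).

Lemma ck_det m k (U : set 'rV[R]_n) (F : 'rV[R]_n -> 'M[R]_m) : open U ->
  (forall i j, ck k U (fun x => F x i j)) -> ck k U (fun x => \det (F x)).
Proof.
move=> oU cF; rewrite /determinant.
apply: ck_sum => // s _; apply: ckM => //; first exact: ck_cst.
exact: ck_prod.
Qed.

Lemma ck_invmx k (U : set 'rV[R]_n) (F : 'rV[R]_n -> 'M[R]_n) : open U ->
  (forall i j, ck k U (fun x => F x i j)) -> (forall x, U x -> \det (F x) != 0) ->
  forall i j, ck k U (fun x => invmx (F x) i j).
Proof.
move=> oU cF dF i j.
apply: (@ck_ext _ _ _ oU _ (fun x => (\det (F x))^-1 *
    ((-1) ^+ (j + i) * \det (row' j (col' i (F x)))))).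
  by move=> x Ux; rewrite /invmx unitmxE unitfE dF // !mxE.
apply: ckM => //; first by apply: ckV => //; exact: ck_det.
apply: ckM => //; first exact: ck_cst.
apply: ck_det => // a b.
by apply: ck_ext (cF (lift j a) (lift i b)) => // x _; rewrite !mxE.
Qed.

(** Iteration of [x -> y - phi x] from 0. The steps halve from [|y|] on, so the iterates stay within
    [2 |y| < r], and their limit is taken coordinate by coordinate. *)
Lemma contraction_solution (phi : 'rV[R]_n -> 'rV[R]_n) (r : R) y : 0 < r ->
  phi 0 = 0 ->
  (forall x x', `|x| < r -> `|x'| < r -> `|phi x - phi x'| <= `|x - x'| / 2) ->
  `|y| < r / 2 -> exists x, [/\ `|x| <= 2 * `|y|, `|x| < r & x + phi x = y].
Proof.
move=> r0 phi0 lip yr.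
pose xs k := iter k (fun x => y - phi x) 0.
have y2 : 2 * `|y| < r by rewrite mulrC -ltr_pdivlMr.
(* The first bound is the sum of the bounds on the preceding steps. *)
have H k : `|xs k| <= 2 * `|y| - 2 * `|y| / 2 ^+ k /\ `|xs k.+1 - xs k| <= `|y| / 2 ^+ k.
  elim: k => [|k [IH1 IH2]].
    by rewrite /xs /= phi0 !subr0 expr0 !divr1 subrr normr0.
  have b1 : `|xs k.+1| <= 2 * `|y| - 2 * `|y| / 2 ^+ k.+1.
    have -> : xs k.+1 = xs k + (xs k.+1 - xs k) by rewrite addrC subrK.
    apply: (le_trans (ler_normD _ _)); apply: (le_trans (lerD IH1 IH2)).
    rewrite le_eqVlt; apply/orP; left; apply/eqP; rewrite exprS; field.
    by rewrite expf_neq0.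
  split=> //.
  have lt_r (z : 'rV[R]_n) m : `|z| <= 2 * `|y| - 2 * `|y| / 2 ^+ m -> `|z| < r.
    move=> h; apply: le_lt_trans y2; apply: (le_trans h).
    by rewrite gerBl divr_ge0 ?mulr_ge0 ?exprn_ge0.
  rewrite -[xs k.+2]/(y - phi (xs k.+1)) -[X in _ - X]/(y - phi (xs k)).
  have -> : y - phi (xs k.+1) - (y - phi (xs k)) = - (phi (xs k.+1) - phi (xs k)).
    by apply/rowP => i; rewrite !mxE; ring.
  rewrite normrN.
  apply: (le_trans (lip _ _ (lt_r _ _ b1) (lt_r _ _ IH1))).
  rewrite exprSr invfM mulrA ler_wpM2r //.
have /boolp.choice[l Hl] i : exists l : R, forall k, `|xs k 0 i - l| <= 2 * `|y| / 2 ^+ k.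
  apply: geometric_cauchy => // k; apply: le_trans (H k).2.
  by have := coord_le (xs k.+1 - xs k) i; rewrite !mxE.
pose x := \row_i l i.
have xk k : `|xs k - x| <= 2 * `|y| / 2 ^+ k.
  apply: rV_norm_le => [|i]; first by rewrite divr_ge0 ?mulr_ge0 ?exprn_ge0.
  by rewrite !mxE; exact: Hl.
have x2 : `|x| <= 2 * `|y|.
  by have := xk 0%N; rewrite /xs /= sub0r normrN expr0 divr1.
have xr : `|x| < r by apply: le_lt_trans y2.
exists x; split=> //.
apply/eqP; rewrite -subr_eq0 -normr_le0; apply/ler_addgt0Pr => e e0; rewrite add0r.
have [k hk] := geometric_small (2 * (2 * `|y|)) e0.
have xkr : `|xs k| < r.
  apply: le_lt_trans y2; apply: (le_trans (H k).1).
  by rewrite gerBl divr_ge0 ?mulr_ge0 ?exprn_ge0.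
have -> : x + phi x - y = (x - xs k.+1) + (phi x - phi (xs k)).
  rewrite -[xs k.+1]/(y - phi (xs k)).
  by apply/rowP => i; rewrite !mxE; ring.
apply: ltW; apply: le_lt_trans hk.
apply: (le_trans (ler_normD _ _)).
apply: (@le_trans _ _ (2 * `|y| / 2 ^+ k.+1 + 2 * `|y| / 2 ^+ k / 2)).
  apply: lerD; first by rewrite distrC.
  by apply: (le_trans (lip _ _ xr xkr)); rewrite ler_wpM2r // distrC.
have h0 : 0 <= 2 * `|y| / 2 ^+ k by rewrite divr_ge0 ?mulr_ge0 ?exprn_ge0.
have -> : 2 * `|y| / 2 ^+ k.+1 + 2 * `|y| / 2 ^+ k / 2 = 2 * `|y| / 2 ^+ k.
  rewrite exprS; field; by rewrite expf_neq0.
by rewrite -[2 * (2 * _) / _]mulrA ler_peMl // ler1n.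
Qed.

(** Rows are indexed by the direction of differentiation, so that row vectors are multiplied on the
    left of the matrix. *)
Definition jacobian_mx (g : 'rV[R]_n -> 'rV[R]_n) x : 'M[R]_n :=
  \matrix_(i, a) pd i (fun z => g z 0 a) x.

Section LocalInverse.
Variables (g : 'rV[R]_n -> 'rV[R]_n) (r : R).
Hypothesis r0 : 0 < r.
Hypothesis sg : forall a, smooth_on (ball 0 r) (fun x => g x 0 a).
Hypothesis expand : forall x v, `|x| < r -> `|x + v| < r ->
  `|g (x + v) - g x - v| <= `|v| / 2.
Hypothesis det_neq0 : forall x, `|x| < r -> \det (jacobian_mx g x) != 0.
Hypothesis g0 : g 0 = 0.

Lemma differentiable_comps x a : `|x| < r -> differentiable (fun z => g z 0 a) x.
Proof. by move=> xr; apply: (sg a [::]); apply/ball0P. Qed.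

Lemma displacement_le x v : `|x| < r -> `|x + v| < r -> `|v| <= 2 * `|g (x + v) - g x|.
Proof.
move=> xr xvr; have h := expand xr xvr.
have : `|v| <= `|g (x + v) - g x| + `|v| / 2.
  apply: le_trans (lerD (lexx _) h).
  rewrite -[leLHS]normrN; apply: le_trans (ler_normB _ _).
  by rewrite opprB addrC subrK normrN.
move: `|v| `|_| => p q; lra.
Qed.

Lemma preimage_exists y : `|y| < r / 2 -> exists x, [/\ `|x| < r & g x = y].
Proof.
move=> yr; have [||x [_ xr E]] := @contraction_solution (fun x => g x - x) r y r0 _ _ yr.
- by rewrite g0 subrr.
- move=> x x' xr xr'; rewrite -(subrKC x' x) in xr *.
  have := expand xr' xr; move: (x - x') => v.
  rewrite [x' + v - x']addrC addKr (_ : g (x' + v) - (x' + v) - (g x' - x') = g (x' + v) - g x' - v) //.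
  by apply/rowP => i; rewrite !mxE; ring.
by exists x; rewrite -E subrKC.
Qed.

Variable h : 'rV[R]_n -> 'rV[R]_n.
Hypothesis hg : forall y, `|y| < r / 2 -> `|h y| < r /\ g (h y) = y.

Lemma inverse_unique x : `|x| < r -> `|g x| < r / 2 -> h (g x) = x.
Proof.
move=> xr gr; have [hr E] := hg gr.
have := @displacement_le (h (g x)) (x - h (g x)) hr; rewrite subrKC => /(_ xr).
by rewrite E subrr normr0 mulr0 normr_le0 subr_eq0 => /eqP.
Qed.

(** If [s] is the increment of [h] caused by [v], then [v] is [s] times the Jacobian matrix plus an
    error that is small relative to [s], hence to [v] by [displacement_le]. Multiplying by the
    inverse matrix [K] gives the expansion. *)
Lemma inverse_differentiable y j : `|y| < r / 2 ->
  differentiable (fun z => h z 0 j) y /\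
  forall a, pd a (fun z => h z 0 j) y = invmx (jacobian_mx g (h y)) a j.
Proof.
move=> yr; have [xr gx] := hg yr; set x := h y in xr gx *.
set K := invmx (jacobian_mx g x).
apply: differentiableP_eps => e e0.
pose k := 1 + \sum_a `|K a j|.
have k0 : 0 < k by rewrite ltr_pwDl // sumr_ge0.
(* [k] bounds column [j] of [K]; the error, at most [e' * (2 * |v|)] per entry, grows by at most
   [n * k]. The added 1 keeps the denominator positive. *)
pose e' := e / (n%:R * (2 * k) + 1).
have c0 : 0 < n%:R * (2 * k) + 1 by rewrite ltr_wpDl // !mulr_ge0 // ltW.
have e'0 : 0 < e' by rewrite divr_gt0.
have /boolp.choice[d Hd] a : exists d : R, 0 < d /\ forall v, `|v| < d ->
    `|g (x + v) 0 a - g x 0 a - \sum_i v 0 i * pd i (fun z => g z 0 a) x| <= e' * `|v|.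
  by have [d] := differentiable_eps (differentiable_comps a xr) e'0; exists d.
pose D := \big[Num.min/1]_a d a.
have D0 : 0 < D by apply: lt_bigmin => // a _; exact: (Hd a).1.
exists (Num.min (r / 2 - `|y|) (D / 2)).
  by rewrite lt_min subr_gt0 yr divr_gt0.
move=> v; rewrite lt_min => /andP[v1 v2].
have yvr : `|y + v| < r / 2.
  by apply: (le_lt_trans (ler_normD _ _)); rewrite -ltrBrDl.
have [xr' gx'] := hg yvr.
have [s hs] : exists s, h (y + v) = x + s by exists (h (y + v) - x); rewrite subrKC.
rewrite hs in gx' xr'.
have sv : `|s| <= 2 * `|v|.
  by have := displacement_le xr xr'; rewrite gx gx' [y + v]addrC addrK.
have sD : `|s| < D by apply: (le_lt_trans sv); rewrite mulrC -ltr_pdivlMr.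
pose err := v - s *m jacobian_mx g x.
have errb a : `|err 0 a| <= e' * (2 * `|v|).
  have := (Hd a).2 s (lt_le_trans sD (bigmin_le _ a d)).
  rewrite gx gx' [(y + v) 0 a]mxE [y 0 a + _]addrC addrK.
  rewrite (_ : v 0 a - _ = err 0 a); last first.
    by rewrite !mxE; congr (_ - _); apply: eq_bigr => i _; rewrite mxE.
  by move=> /le_trans; apply; rewrite ler_wpM2l // ltW.
have sE : s = (v - err) *m K.
  rewrite /err opprB addrC subrK mulmxK // unitmxE unitfE; exact: det_neq0.
rewrite hs mxE [x 0 j + _]addrC addrK {1}sE mulmxBl.
rewrite (_ : (v *m K - err *m K) 0 j - _ = - \sum_a err 0 a * K a j); last first.
  by rewrite !mxE addrC addKr.
rewrite normrN; apply: (@le_trans _ _ (n%:R * ((e' * (2 * `|v|)) * k))).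
  apply: norm_sum_ord_le => a; apply: norm_mul_le => //.
  rewrite /k (bigD1 a) //= addrCA lerDl addr_ge0 // sumr_ge0 //.
have -> : n%:R * (e' * (2 * `|v|) * k) = e' * (n%:R * (2 * k)) * `|v| by ring.
rewrite ler_wpM2r // /e' -mulrA ler_piMr ?(ltW e0) // mulrC ler_pdivrMr // mul1r.
by rewrite lerDl.
Qed.

(** The derivatives of [h] are smooth functions of [h] itself, so order [k] of [h] gives order
    [k.+1]. *)
Lemma inverse_smooth j : smooth_on (ball 0 (r / 2)) (fun z => h z 0 j).
Proof.
apply/smooth_onP => k; elim: k j => [|k IH] j.
  by apply/ck0 => y /ball0P yr; have [] := inverse_differentiable j yr.
apply/ckS; split=> [y /ball0P yr|a]; first by have [] := inverse_differentiable j yr.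
have ob (e : R) : open (ball 0 e : set 'rV[R]_n) by apply: ball_open.
apply: (@ck_ext _ _ _ (ob _) _ (fun y => invmx (jacobian_mx g (h y)) a j)).
  by move=> y /ball0P yr; have [_ ->] := inverse_differentiable j yr.
apply: (@ck_comp _ _ _ _ _ (ball 0 r) (fun x => invmx (jacobian_mx g x) a j)) => //.
  by move=> y /ball0P yr; apply/ball0P; have [] := hg yr.
apply: ck_invmx => // [i b|x /ball0P]; last exact: det_neq0.
apply: (@ck_ext _ _ _ (ob _) _ (pd i (fun z => g z 0 b))).
  by move=> x _; rewrite mxE.
by have /smooth_onP/(_ k.+1)/ckS[] := sg b.
Qed.

End LocalInverse.

Lemma inverse_function (g : 'rV[R]_n -> 'rV[R]_n) (r : R) : 0 < r ->
  (forall a, smooth_on (ball 0 r) (fun x => g x 0 a)) -> g 0 = 0 ->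
  (forall i a, pd i (fun x => g x 0 a) 0 = (i == a)%:R) ->
  exists rho V h, [/\ 0 < rho,
    open V, V 0 & V `<=` ball 0 r] /\
    [/\ forall x, V x -> `|g x| < rho /\ h (g x) = x,
        forall y, `|y| < rho -> V (h y) /\ g (h y) = y &
        forall a, smooth_on (ball 0 rho) (fun y => h y 0 a)].
Proof.
move=> r0 sg g0 Dg.
have o0 : (ball 0 r : set 'rV[R]_n) 0 by apply/ball0P; rewrite normr0.
(* The [n] deviations of the partial derivatives from the identity must add up to at most 1/2. *)
have n1 : 0 < 1 / 2 / n.+1%:R :> R by rewrite !divr_gt0.
have [r1 r10 b1] := local_variation (f := fun ia : 'I_n * 'I_n => pd ia.1 (fun x => g x 0 ia.2))
  n1 (fun ia => sg _ [:: ia.1] 0 o0).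
have ob (e : R) : open (ball 0 e : set 'rV[R]_n) by apply: ball_open.
have cdet : ck 0 (ball 0 r) (fun x => \det (jacobian_mx g x)).
  apply: ck_det => // i b.
  apply: (@ck_ext _ _ _ (ob _) _ (pd i (fun z => g z 0 b))) => [x _|]; first by rewrite mxE.
  by have /smooth_onP/(_ 1%N)/ckS[] := sg b.
have half0 : 0 < 1 / 2 :> R by rewrite divr_gt0.
have [r2 r20 b2] := local_variation (f := fun _ : unit => fun x => \det (jacobian_mx g x))
  half0 (fun _ => ck_diff cdet o0).
pose r' := Num.min r (Num.min r1 r2).
have r'0 : 0 < r' by rewrite !lt_min r0 r10 r20.
have [rr rr1 rr2] : [/\ r' <= r, r' <= r1 & r' <= r2].
  by rewrite /r'; split; rewrite !ge_min lexx ?orbT.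
have sub : ball 0 r' `<=` (ball 0 r : set 'rV[R]_n).
  by move=> y /ball0P yr; apply/ball0P; exact: lt_le_trans rr.
have sg' a : smooth_on (ball 0 r') (fun x => g x 0 a).
  by move=> s x /sub; exact: sg.
have dg x a : `|x| < r' -> differentiable (fun z => g z 0 a) x.
  by move=> xr; apply: (sg' a [::]); apply/ball0P.
have expand x v : `|x| < r' -> `|x + v| < r' -> `|g (x + v) - g x - v| <= `|v| / 2.
  move=> xr xvr; apply: rV_norm_le => [|a]; first by rewrite divr_ge0.
  have seg (s : R) : 0 <= s <= 1 -> `|x + s *: v| < r'.
    by move=> s01; apply: norm_segment.
  have [s s01 E] := mvt_rV (fun s s01 => dg _ a (seg s s01)).
  rewrite [X in `|X|](_ : _ = \sum_i v 0 i * (pd i (fun z => g z 0 a) (x + s *: v) - (i == a)%:R)).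
    apply: (@le_trans _ _ (n%:R * (`|v| * (1 / 2 / n.+1%:R)))).
      apply: norm_sum_ord_le => i; apply: norm_mul_le; first exact: coord_le.
      by have := b1 (i, a) _ (lt_le_trans (seg s s01) rr1); rewrite /= Dg.
    rewrite mulrCA ler_wpM2l // mulrCA mul1r.
    by rewrite ler_piMr // ler_pdivrMr // mul1r ler_nat.
  rewrite !mxE E; under [RHS]eq_bigr do rewrite mulrBr.
  rewrite sumrB; congr (_ - _); rewrite (bigD1 a) //= eqxx mulr1 big1 ?addr0 // => i.
  by move=> /negbTE ->; rewrite mulr0.
have det_neq0 x : `|x| < r' -> \det (jacobian_mx g x) != 0.
  move=> xr; have := b2 tt x (lt_le_trans xr rr2).
  have -> : jacobian_mx g 0 = 1%:M by apply/matrixP => i a; rewrite !mxE Dg.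
  rewrite det1; apply: contraTneq => ->; rewrite sub0r normrN normr1 -ltNge.
  by rewrite ltr_pdivrMr // mul1r ltr1n.
have /boolp.choice[h Hh] y : exists x, `|y| < r' / 2 -> `|x| < r' /\ g x = y.
  case: (ltP `|y| (r' / 2)) => [yr|_]; last by exists 0.
  by have [x [xr gx]] := preimage_exists r'0 expand g0 yr; exists x.
(* Cutting the ball by the preimage makes [g] a bijection onto a full ball, which will be the image
   of the new chart. *)
exists (r' / 2), (ball 0 r' `&` [set x | `|g x| < r' / 2]), h; split; split.
- by rewrite divr_gt0.
- rewrite openE => x [xb gx].
  have N1 : nbhs x (ball 0 r' : set 'rV[R]_n) by exact: (open_nbhs_nbhs (conj (ob _) xb)).
  have cg : {for x, continuous g}.
    by apply: differentiable_continuous; apply: differentiable_rV => a; apply: dg; apply/ball0P.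
  have N2 : nbhs (g x) (ball 0 (r' / 2) : set 'rV[R]_n).
    by apply: (open_nbhs_nbhs (conj (ob _) _)); apply/ball0P.
  have N3 : nbhs x [set z | `|g z| < r' / 2].
    have N4 : nbhs x (g @^-1` ball 0 (r' / 2)) := cg _ N2.
    by apply: (filterS (Q := [set z | `|g z| < r' / 2]) _ N4) => z /ball0P.
  exact: (@filterI _ (nbhs x) _ _ _ N1 N3).
- by split; [apply/ball0P; rewrite normr0|rewrite /= g0 normr0 divr_gt0].
- by move=> x [/sub].
- by move=> x [/ball0P xr gx]; split=> //; exact: (inverse_unique expand Hh).
- move=> y yr; have [hr gh] := Hh y yr; split=> //; split; first exact/ball0P.
  by rewrite /= gh.
- exact: inverse_smooth.
Qed.

End InverseFunction.

(** * Changes of charts *)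

Section Charts.
Context {R : realType} {n : nat} {M : topologicalType}.
Implicit Types (c d : chart R n M) (x y : 'rV[R]_n).

Lemma cimg_cinv c x : is_chart c -> cimg c x -> cdom c (cinv c x) /\ cmap c (cinv c x) = x.
Proof. by move=> [_ _ inv _ _] [m cm <-]; rewrite inv. Qed.

Lemma overlapP c d x : is_chart c -> overlap c d x <-> cimg c x /\ cdom d (cinv c x).
Proof.
move=> hc; split=> [[m [cm dm] <-]|[cx dx]].
  by split; [exists m|have [_ _ -> ] := hc].
have [h1 h2] := cimg_cinv hc cx; by exists (cinv c x).
Qed.

Lemma open_overlap c d : is_chart c -> open (cdom d) -> open (overlap c d).
Proof.
move=> hc od; rewrite openE => x /(overlapP _ _ hc)[cx dx].
have [_ oi _ _ ci] := hc.
have N1 : nbhs x (cimg c) by exact: (open_nbhs_nbhs (conj oi cx)).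
have N2 : nbhs x (cinv c @^-1` cdom d).
  by apply: (ci x cx); exact: (open_nbhs_nbhs (conj od dx)).
apply: (filterS (Q := overlap c d) _ (@filterI _ (nbhs x) _ _ _ N1 N2)) => z [h1 h2].
exact/overlapP.
Qed.

Lemma trans_id c x : is_chart c -> cimg c x -> trans c c x = x.
Proof. by move=> hc /(cimg_cinv hc)[]. Qed.

Lemma smooth_continuous (U : set 'rV[R]_n) (g : 'rV[R]_n -> 'rV[R]_n) x :
  (forall a, smooth_on U (fun z => g z 0 a)) -> U x -> {for x, continuous g}.
Proof.
move=> sg Ux; apply: differentiable_continuous; apply: differentiable_rV => a.
exact: (sg a [::]).
Qed.

Section Change.
Variables (atlas : set (chart R n M)) (c0 : chart R n M) (V W : set 'rV[R]_n)
  (g h : 'rV[R]_n -> 'rV[R]_n).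
Hypothesis sa : smooth_atlas atlas.
Hypothesis ac0 : atlas c0.
Hypothesis oV : open V.
Hypothesis oW : open W.
Hypothesis Vc0 : V `<=` cimg c0.
Hypothesis gP : forall x, V x -> W (g x) /\ h (g x) = x.
Hypothesis hP : forall y, W y -> V (h y) /\ g (h y) = y.
Hypothesis sg : forall a, smooth_on V (fun x => g x 0 a).
Hypothesis sh : forall a, smooth_on W (fun y => h y 0 a).

Definition change_chart : chart R n M :=
  Chart (cdom c0 `&` [set m | V (cmap c0 m)]) (fun m => g (cmap c0 m))
        (fun y => cinv c0 (h y)).
Notation c := change_chart.

Let hc0 : is_chart c0. Proof. by have [h1 _ _ _] := sa; exact: h1. Qed.

Lemma cimg_change : cimg c = W.
Proof.
apply/seteqP; split=> [y [m [cm Vm] <-]|y Wy].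
  by have [] := gP Vm.
have [Vh gh] := hP Wy; have [h1 h2] := cimg_cinv hc0 (Vc0 Vh).
by exists (cinv c0 (h y)); rewrite /= h2 //; split.
Qed.

Lemma is_chart_change : is_chart c.
Proof.
have [ o0 _ inv cm ci] := hc0.
split.
- rewrite openE => m [dm Vm].
  have N1 : nbhs m (cdom c0) by exact: (open_nbhs_nbhs (conj o0 dm)).
  have N2 : nbhs m (cmap c0 @^-1` V).
    by apply: (cm m dm); exact: (open_nbhs_nbhs (conj oV Vm)).
  exact: (@filterI _ (nbhs m) _ _ _ N1 N2).
- by rewrite cimg_change.
- by move=> m [dm Vm] /=; rewrite (gP Vm).2 inv.
- move=> m [dm Vm] /=.
  apply: (@continuous_comp _ _ _ (cmap c0) g); first exact: cm.
  exact: (smooth_continuous sg Vm).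
- rewrite cimg_change => y Wy /=.
  apply: (@continuous_comp _ _ _ h (cinv c0)); first exact: (smooth_continuous sh Wy).
  by apply: ci; apply: Vc0; have [] := hP Wy.
Qed.

(** By maximality it suffices to be compatible with every [d]; the transition maps are those between
    [c0] and [d] composed with [h] or [g]. *)
Lemma atlas_change : atlas c.
Proof.
have [acharts _ acomp amax] := sa.
apply: amax; first exact: is_chart_change.
move=> d ad a; have [ od _ _ _ _] := acharts d ad.
have [ oc _ _ _ _] := is_chart_change.
have o1 : open (overlap c d) by apply: open_overlap => //; exact: is_chart_change.
have o2 : open (overlap d c) by apply: open_overlap => //; exact: acharts.
split; apply/smooth_onP => k.
- apply: (@ck_comp _ _ _ _ _ (overlap c0 d) (fun x => trans c0 d x 0 a) h) => //.
  + move=> y /(overlapP _ _ is_chart_change)[]; rewrite cimg_change => Wy dy.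
    by apply/(overlapP _ _ hc0); split=> //; apply: Vc0; have [] := hP Wy.
  + move=> b; apply: ck_sub (proj1 (smooth_onP _ _) (sh b) k) => y.
    by move=> /(overlapP _ _ is_chart_change)[]; rewrite cimg_change.
  + by have [/smooth_onP] := acomp c0 d ac0 ad a.
- have sub : overlap d c `<=` overlap d c0 by move=> x [m [dm [cm _]] <-]; exists m.
  apply: (@ck_comp _ _ _ _ _ V (fun x => g x 0 a) (trans d c0)) => //.
  + move=> x [m [dm [cm Vm]] <-]; rewrite /trans.
    by have [_ _ -> ] := acharts d ad.
  + move=> b; apply: ck_sub sub _.
    by have [/smooth_onP] := acomp d c0 ad ac0 b.
  + by have /smooth_onP/(_ k) := sg a.
Qed.

Lemma overlap_change x : V x -> overlap c0 c x.
Proof.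
move=> Vx; have [h1 h2] := cimg_cinv hc0 (Vc0 Vx).
by apply/(overlapP _ _ hc0); split; [exact: Vc0|split; rewrite //= h2].
Qed.

Lemma trans_change x : V x -> trans c0 c x = g x.
Proof. by move=> Vx; rewrite /trans /= (cimg_cinv hc0 (Vc0 Vx)).2. Qed.

Lemma jac_change x a i : V x -> jac c0 c x a i = pd i (fun z => g z 0 a) x.
Proof. by move=> Vx; apply: (pd_ext oV) => // z Vz; rewrite trans_change. Qed.

Lemma hess_change x a i j : V x ->
  hess c0 c x a i j = pd i (pd j (fun z => g z 0 a)) x.
Proof. by move=> Vx; apply: (pd_ext oV) => // z Vz; exact: jac_change. Qed.

End Change.

Lemma smooth_affine (U : set 'rV[R]_n) (e : 'I_n -> R) (b : 'rV[R]_n) a : open U ->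
  smooth_on U (fun x => (\row_i (e i * x 0 i + b 0 i)) 0 a).
Proof.
move=> oU; apply/smooth_onP => k.
apply: (@ck_ext _ _ _ oU _ (fun x => e a * x 0 a + b 0 a)) => [x _|]; first by rewrite mxE.
apply: ckD => //; last exact: ck_cst.
by apply: ckM => //; [exact: ck_cst|exact: ck_coord].
Qed.

Lemma pd_affine (e : 'I_n -> R) (b : 'rV[R]_n) a i x :
  pd i (fun x => (\row_i (e i * x 0 i + b 0 i)) 0 a) x = e a * (i == a)%:R.
Proof.
rewrite (_ : (fun _ => _) = (fun x => e a * x 0 a + b 0 a)); last first.
  by apply/funext => z; rewrite mxE.
have d1 := differentiable_coord x 0 a.
have d2 : differentiable (fun z : 'rV[R]_n => e a * z 0 a) x.
  by apply: differentiableM => //; exact: differentiable_cst.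
rewrite pdD //.
rewrite pdM //.
by rewrite !pd_cst pd_coord mul0r add0r addr0.
Qed.

(** A diagonal Jacobian leaves only the identity tuple in the transformation law. This covers a
    reflection of one coordinate, and a change whose Jacobian is the identity at the origin. *)
Lemma volume_component_diag (atlas : set (chart R n M)) (eta : cov_components R n M n)
    c d x (e : 'I_n -> R) : cov_tensor atlas eta -> atlas c -> atlas d ->
  overlap c d x -> (forall a i, jac c d x a i = e a * (i == a)%:R) ->
  volume_component eta c x = (\prod_a e a) * volume_component eta d (trans c d x).
Proof.
move=> [_ teta] ac ad ov J; rewrite /volume_component (teta c d x _ ac ad ov).
rewrite (bigD1 (ord_tuple n)) //= [X in _ + X]big1 ?addr0; last first.
  move=> j jn; have [b hb] : exists b, tnth j b != b.
    apply/existsP; apply: contraNT jn; rewrite negb_exists => /forallP hh.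
    by apply/eqP/eq_from_tnth => b; rewrite tnth_ord_tuple; apply/eqP/negPn/hh.
  by rewrite (bigD1 b) //= J tnth_ord_tuple eq_sym (negbTE hb) mulr0 !mul0r.
by congr (_ * _); apply: eq_bigr => a _; rewrite J tnth_ord_tuple eqxx mulr1.
Qed.

(** Positivity is what [psi], a logarithm, requires. It is obtained by translating [m] to the origin
    and reflecting one coordinate when the volume component is negative. *)
Lemma centered_chart (atlas : set (chart R n M)) (eta : cov_components R n M n) (m : M) :
  (0 < n)%N -> smooth_atlas atlas -> volume_element atlas eta ->
  exists c, [/\ atlas c, cdom c m, cmap c m = 0 & 0 < volume_component eta c 0].
Proof.
move=> n0 sa [[seta teta] _ eta0].
have [acharts acover _ _] := sa.
have [c0 ac0 mc0] := acover m.
have hc0 := acharts c0 ac0; have [_ oi _ _ _] := hc0.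
pose x0 := cmap c0 m; have x0i : cimg c0 x0 by exists m.
pose s := Num.sg (volume_component eta c0 x0).
have ss : s * s = 1.
  by rewrite /s -expr2 sqr_sg eta0.
pose i0 := Ordinal n0.
(* As [s] is a sign, [g] is a translation composed with an involution, so [h] has the same linear
   part. *)
pose e (i : 'I_n) : R := if i == i0 then s else 1.
have ee i : e i * e i = 1 by rewrite /e; case: ifP => _ //; rewrite mulr1.
pose g x : 'rV[R]_n := \row_i (e i * x 0 i + (\row_i (- (e i * x0 0 i))) 0 i).
pose h y : 'rV[R]_n := \row_i (e i * y 0 i + x0 0 i).
have gh y : g (h y) = y.
  by apply/rowP => i; rewrite !mxE mulrDr mulrA ee mul1r addrK.
have hg x : h (g x) = x.
  by apply/rowP => i; rewrite !mxE mulrDr mulrN !mulrA ee !mul1r subrK.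
have sh a (U : set 'rV[R]_n) : open U -> smooth_on U (fun y => h y 0 a).
  by move=> oU; apply: smooth_affine.
have sg a : smooth_on (cimg c0) (fun x => g x 0 a) by apply: smooth_affine.
pose W := h @^-1` cimg c0.
have oW : open W.
  apply: open_comp => // y _.
  by apply: (smooth_continuous (U := setT)) => // a; apply: sh; exact: openT.
have gP x : cimg c0 x -> W (g x) /\ h (g x) = x by rewrite /W /= hg.
have hP y : W y -> cimg c0 (h y) /\ g (h y) = y by rewrite gh.
have shW a := sh a W oW.
pose c := change_chart c0 (cimg c0) g h.
have ac : atlas c by exact: (atlas_change sa ac0 oi oW (fun x h => h) gP hP sg shW).
have gx0 : g x0 = 0 by apply/rowP => i; rewrite !mxE subrr.
exists c; split; [exact: ac|by split|exact: gx0|].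
have id0 : cimg c0 `<=` cimg c0 by [].
have ov : overlap c0 c x0 by exact: (overlap_change g h sa ac0 id0 x0i).
have trE : trans c0 c x0 = g x0 := trans_change g h sa ac0 id0 x0i.
have jacE a i : jac c0 c x0 a i = e a * (i == a)%:R.
  rewrite (jac_change g h sa ac0 oi id0) //; exact: pd_affine.
have := volume_component_diag (conj seta teta) ac0 ac ov jacE.
rewrite trE gx0 (bigD1 i0) //= big1 ?mulr1; last by move=> a /negbTE ai; rewrite /e ai.
rewrite /e eqxx => E.
have -> : volume_component eta c 0 = s * volume_component eta c0 x0.
  by rewrite E mulrA ss mul1r.
by rewrite /s -normrEsg normr_gt0 eta0.
Qed.

End Charts.

(** * Projectively flat connections *)

Section Smooth.
Context {R : realType} {n : nat} (U : set 'rV[R]_n) (oU : open U).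
Implicit Types f g : 'rV[R]_n -> R.

Lemma smooth_cst (c : R) : smooth_on U (fun=> c).
Proof. by apply/smooth_onP => k; exact: ck_cst. Qed.

Lemma smoothD f g : smooth_on U f -> smooth_on U g -> smooth_on U (fun x => f x + g x).
Proof. by move=> /smooth_onP hf /smooth_onP hg; apply/smooth_onP => k; exact: ckD. Qed.

Lemma smoothN f : smooth_on U f -> smooth_on U (fun x => - f x).
Proof. by move=> /smooth_onP hf; apply/smooth_onP => k; exact: ckN. Qed.

Lemma smoothB f g : smooth_on U f -> smooth_on U g -> smooth_on U (fun x => f x - g x).
Proof. by move=> /smooth_onP hf /smooth_onP hg; apply/smooth_onP => k; exact: ckB. Qed.

Lemma smoothM f g : smooth_on U f -> smooth_on U g -> smooth_on U (fun x => f x * g x).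
Proof. by move=> /smooth_onP hf /smooth_onP hg; apply/smooth_onP => k; exact: ckM. Qed.

Lemma smoothV f : (forall x, U x -> f x != 0) -> smooth_on U f -> smooth_on U (fun x => (f x)^-1).
Proof. by move=> f0 /smooth_onP hf; apply/smooth_onP => k; exact: ckV. Qed.

Lemma smooth_sum (I : Type) (r : seq I) (F : I -> 'rV[R]_n -> R) :
  (forall a, smooth_on U (F a)) -> smooth_on U (fun x => \sum_(a <- r) F a x).
Proof.
by move=> h; apply/smooth_onP => k; apply: ck_sum => // a _; have /smooth_onP := h a.
Qed.

Lemma smooth_ext f g : (forall x, U x -> f x = g x) -> smooth_on U f -> smooth_on U g.
Proof. by move=> fg /smooth_onP h; apply/smooth_onP => k; apply: ck_ext (h k). Qed.

Lemma smooth_pd i f : smooth_on U f -> smooth_on U (pd i f).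
Proof. by move=> /smooth_onP h; apply/smooth_onP => k; have /ckS[] := h k.+1. Qed.

Lemma smooth_sub (U' : set 'rV[R]_n) f : U' `<=` U -> smooth_on U f -> smooth_on U' f.
Proof. by move=> s h l x /s; exact: h. Qed.

Lemma smooth_diff f x : smooth_on U f -> U x -> differentiable f x.
Proof. by move=> h; exact: (h [::]). Qed.

Lemma smooth_schwarz f i j x : smooth_on U f -> U x -> pd i (pd j f) x = pd j (pd i f) x.
Proof. by move=> /smooth_onP h Ux; apply: schwarz oU (h 3%N) Ux. Qed.

Lemma pd_sum (I : Type) (r : seq I) (F : I -> 'rV[R]_n -> R) i x :
  (forall a, differentiable (F a) x) ->
  pd i (fun y => \sum_(a <- r) F a y) x = \sum_(a <- r) pd i (F a) x.
Proof.
move=> h; suff [] : differentiable (fun y => \sum_(a <- r) F a y) x /\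
  pd i (fun y => \sum_(a <- r) F a y) x = \sum_(a <- r) pd i (F a) x by [].
elim: r => [|a r [IH1 IH2]].
  rewrite big_nil (_ : (fun _ => _) = fun=> 0); last by apply/funext => y; rewrite big_nil.
  by split; [exact: differentiable_cst|exact: pd_cst].
rewrite big_cons (_ : (fun _ => _) = fun y => F a y + \sum_(b <- r) F b y); last first.
  by apply/funext => y; rewrite big_cons.
by split; [exact: differentiableD|rewrite pdD // IH2].
Qed.

End Smooth.

(** The second Bianchi identity for connection matrices [X], [Y], [Z]: the second derivatives [E1],
    [E2], [E3] occur with both signs, and the triple products cancel as in the Jacobi identity. *)
Lemma bianchi_mx (R : realType) n (X Y Z E1 E2 E3 DXY DXZ DYX DYZ DZX DZY : 'M[R]_n) :
  (E1 - E2 + (DXY *m Z + Y *m DXZ - (DXZ *m Y + Z *m DXY)) +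
    (X *m (DYZ - DZY + (Y *m Z - Z *m Y)) - (DYZ - DZY + (Y *m Z - Z *m Y)) *m X)) +
  (E3 - E1 + (DYZ *m X + Z *m DYX - (DYX *m Z + X *m DYZ)) +
    (Y *m (DZX - DXZ + (Z *m X - X *m Z)) - (DZX - DXZ + (Z *m X - X *m Z)) *m Y)) +
  (E2 - E3 + (DZX *m Y + X *m DZY - (DZY *m X + Y *m DZX)) +
    (Z *m (DXY - DYX + (X *m Y - Y *m X)) - (DXY - DYX + (X *m Y - Y *m X)) *m Z)) = 0.
Proof.
rewrite !(mulmxDl, mulmxDr, mulmxBl, mulmxBr, mulNmx, mulmxN, mulmxA).
(* Once expanded, the products only have to cancel as matrices; abstracting them leaves an identity
   of entries. *)
repeat match goal with |- context [?A *m ?B] => move: (A *m B) => ? end.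
by apply/matrixP => a b; rewrite !mxE; ring.
Qed.

Section Bianchi.
Context {R : realType} {n : nat}.
Variables (U : set 'rV[R]_n) (N : 'I_n -> 'I_n -> 'I_n -> 'rV[R]_n -> R).
Hypothesis oU : open U.
Hypothesis sN : forall l i j, smooth_on U (N l i j).

Definition curv k l i j x := pd k (N l i j) x - pd l (N k i j) x +
  \sum_m (N k i m x * N l m j x - N l i m x * N k m j x).

(** The covariant derivative is taken in the endomorphism indices [i], [j] only: the cyclic sum over
    [m], [k], [l] is then the exterior covariant derivative of the curvature. *)
Definition curv_deriv m k l i j x := pd m (curv k l i j) x +
  \sum_a (N m i a x * curv k l a j x - curv k l i a x * N m a j x).

Lemma smooth_curv k l i j : smooth_on U (curv k l i j).
Proof.
apply: smoothD => //; first by apply: smoothB => //; exact: smooth_pd.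
by apply: smooth_sum => // a; apply: smoothB => //; exact: smoothM.
Qed.

Lemma second_bianchi m k l i j x : U x ->
  curv_deriv m k l i j x + curv_deriv k l m i j x + curv_deriv l m k i j x = 0.
Proof.
move=> Ux.
pose Nx l : 'M[R]_n := \matrix_(i, j) N l i j x.
pose D m l : 'M[R]_n := \matrix_(i, j) pd m (N l i j) x.
pose DD m k l : 'M[R]_n := \matrix_(i, j) pd m (pd k (N l i j)) x.
pose C k l : 'M[R]_n := D k l - D l k + (Nx k *m Nx l - Nx l *m Nx k).
pose DC m k l : 'M[R]_n := DD m k l - DD m l k +
  (D m k *m Nx l + Nx k *m D m l - (D m l *m Nx k + Nx l *m D m k)) +
  (Nx m *m C k l - C k l *m Nx m).
have dN l' i' j' : differentiable (N l' i' j') x by exact: (smooth_diff (sN l' i' j')).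
have dpN m' l' i' j' : differentiable (pd m' (N l' i' j')) x.
  by apply: (smooth_diff _ Ux); exact: smooth_pd.
have CE k' l' i' j' : curv k' l' i' j' x = C k' l' i' j'.
  rewrite /curv !mxE; congr (_ + _); rewrite -sumrB; apply: eq_bigr => a _.
  by rewrite !mxE.
have DCE m' k' l' : curv_deriv m' k' l' i j x = DC m' k' l' i j.
  rewrite /curv_deriv /curv.
  rewrite pdD; last 2 first.
  - by apply: differentiableB.
  - apply: (smooth_diff (U := U)) => //; apply: smooth_sum => // a.
    by apply: smoothB => //; exact: smoothM.
  rewrite pdD //; last exact: differentiableN.
  rewrite pdN // pd_sum; last first.
    by move=> a; apply: differentiableB; exact: differentiableM.
  rewrite !mxE -!sumrB -!big_split -sumrB.
  congr (_ + _ + _).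
    apply: eq_bigr => a _ /=; rewrite pdD; last 2 first.
    - exact: differentiableM.
    - by apply: differentiableN; exact: differentiableM.
    rewrite pdN; last exact: differentiableM.
    by rewrite !pdM // !mxE.
  apply: eq_bigr => a _; rewrite -!/(curv _ _ _ _ _) !CE.
  by rewrite [Nx m' i a]mxE [Nx m' a j]mxE.
have DDs m' k' l' : DD m' k' l' = DD k' m' l'.
  apply/matrixP => a b; rewrite [LHS]mxE [RHS]mxE.
  exact: (smooth_schwarz oU m' k' (sN l' a b) Ux).
rewrite !DCE.
have -> : DC m k l i j + DC k l m i j + DC l m k i j = (DC m k l + DC k l m + DC l m k) i j.
  by rewrite !mxE.
suff -> : DC m k l + DC k l m + DC l m k = 0 by rewrite mxE.
rewrite /DC /C (DDs k m l) (DDs l m k) (DDs l k m).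
exact: bianchi_mx.
Qed.

End Bianchi.

(** * The projective Schouten tensor and the prolonged connection *)

Section ProjectivelyFlat.
Context {R : realType} {n : nat} {M : topologicalType}.
Variables (c : chart R n M) (G : conn_components R n M).
Hypothesis n2 : (2 < n)%N.
Let U := cimg c.
Hypothesis oU : open U.
Hypothesis sG : forall i j k, smooth_on U (fun x => G c x i j k).
Hypothesis tG : forall x i j k, U x -> G c x i j k = G c x i k j.
Hypothesis pG : forall x (X Y Z : 'rV[R]_n), U x -> curvature G c x X Y Z =
  (n%:R - 1)^-1 *: (ricci G c x Y Z *: X - ricci G c x X Z *: Y).

Definition schouten (l j : 'I_n) x : R :=
  (n%:R - 1)^-1 * ricci G c x (delta_mx 0 l) (delta_mx 0 j).

Lemma sum_delta (F : 'I_n -> R) (k : 'I_n) :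
  \sum_l F l * (delta_mx 0 k : 'rV[R]_n) 0 l = F k.
Proof.
rewrite (bigD1 k) //= mxE !eqxx mulr1 big1 ?addr0 // => l lk.
by rewrite mxE eqxx (negbTE lk) mulr0.
Qed.

Lemma curvature_delta x i j k l :
  curvature G c x (delta_mx 0 k) (delta_mx 0 l) (delta_mx 0 j) 0 i = curv_coef G c x i j k l.
Proof.
rewrite mxE.
transitivity (\sum_j' (\sum_k' (\sum_l' curv_coef G c x i j' k' l' *
    (delta_mx 0 l : 'rV[R]_n) 0 l') * (delta_mx 0 k : 'rV[R]_n) 0 k') *
    (delta_mx 0 j : 'rV[R]_n) 0 j').
  apply: eq_bigr => j' _; rewrite big_distrl; apply: eq_bigr => k' _ /=.
  by rewrite !big_distrl; apply: eq_bigr => l' _ /=; ring.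
by rewrite !sum_delta.
Qed.

Lemma curv_coef_schouten x i j k l : U x -> curv_coef G c x i j k l =
  schouten l j x * (i == k)%:R - schouten k j x * (i == l)%:R.
Proof.
move=> Ux; rewrite -curvature_delta pG // !mxE eqxx /= /schouten.
by ring.
Qed.

(** How [n > 2] enters: an upper index apart from two lower ones isolates single components of
    [schouten] in the Bianchi identities. *)
Lemma third_index (a b : 'I_n) : exists k : 'I_n, k != a /\ k != b.
Proof.
have : exists k, k \notin [:: a; b].
  apply/existsP; apply: contraT; rewrite negb_exists => /forallP h.
  have : (#|'I_n| <= size [:: a; b])%N.
    apply: leq_trans (card_size [:: a; b]); apply: subset_leq_card.
    by apply/fintype.subsetP => k _; move: (h k); rewrite negbK.
  by rewrite card_ord /= leqNgt n2.
by move=> [k]; rewrite !inE negb_or => /andP[k1 k2]; exists k.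
Qed.

Lemma pd_torsion x i j k l : U x ->
  pd l (fun z => G c z i j k) x = pd l (fun z => G c z i k j) x.
Proof. by move=> Ux; apply: (pd_ext oU) => // z; exact: tG. Qed.

Lemma first_bianchi x i j k l : U x ->
  curv_coef G c x i j k l + curv_coef G c x i k l j + curv_coef G c x i l j k = 0.
Proof.
move=> Ux; rewrite /curv_coef !sumrB.
rewrite (pd_torsion i j l k Ux) (pd_torsion i k j l Ux) (pd_torsion i l k j Ux).
have E (a b d : 'I_n) : \sum_m G c x i a m * G c x m b d = \sum_m G c x i a m * G c x m d b.
  by apply: eq_bigr => m _; rewrite (tG m b d Ux).
rewrite (E k l j) (E l k j) (E j k l).
by ring.
Qed.

(** The first Bianchi identity with the upper index equal to a third index [k]: one curvature term
    vanishes and the others are [schouten] components. *)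
Lemma schouten_sym x l j : U x -> schouten l j x = schouten j l x.
Proof.
move=> Ux; case: (eqVneq l j) => [->//|lj].
have [k [kl kj]] := third_index l j.
have := first_bianchi k j k l Ux.
rewrite !curv_coef_schouten // !eqxx (negbTE kl) (negbTE kj) !mulr0 !mulr1 subr0.
by rewrite subr0 addr0 sub0r => /subr0_eq.
Qed.

Let N l i j x := G c x i l j.

Lemma curv_coefE x i j k l : curv_coef G c x i j k l = curv N k l i j x.
Proof. by []. Qed.

Lemma smooth_schouten l j : smooth_on U (schouten l j).
Proof.
have [k [kl _]] := third_index l l.
have sN l' i' j' : smooth_on U (N l' i' j') by exact: sG.
apply: (smooth_ext oU (f := curv N k l k j)); last exact: (smooth_curv oU sN).
move=> x Ux; rewrite -curv_coefE curv_coef_schouten // eqxx (negbTE kl).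
by rewrite mulr1 mulr0 subr0.
Qed.

(** The second Bianchi identity with upper index [k] apart from [m] and [l], where the curvature
    reduces to components of [schouten]. In the full covariant derivatives both sides carry one more
    Christoffel term, the same on each side as the torsion is zero. *)
Lemma cotton x m l j : U x ->
  pd m (schouten l j) x - \sum_a schouten l a x * G c x a m j =
  pd l (schouten m j) x - \sum_a schouten m a x * G c x a l j.
Proof.
move=> Ux; have [k [km kl]] := third_index m l.
have sN l' i j' : smooth_on U (N l' i j') by exact: sG.
have := second_bianchi oU sN m k l k j Ux; rewrite /curv_deriv.
have cE y i j' k' l' : U y -> curv N k' l' i j' y =
    schouten l' j' y * (i == k')%:R - schouten k' j' y * (i == l')%:R.
  by move=> Uy; rewrite -curv_coefE curv_coef_schouten.
have p1 : pd m (curv N k l k j) x = pd m (schouten l j) x.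
  apply: (pd_ext oU) => // y Uy.
  by rewrite cE // eqxx (negbTE kl) mulr1 mulr0 subr0.
have p2 : pd k (curv N l m k j) x = 0.
  rewrite (pd_ext (g := fun=> 0) oU) ?pd_cst // => y Uy.
  by rewrite cE // (negbTE kl) (negbTE km) !mulr0 subr0.
have p3 : pd l (curv N m k k j) x = - pd l (schouten m j) x.
  rewrite -pdN; last exact: (smooth_diff (smooth_schouten m j)).
  apply: (pd_ext oU) => // y Uy.
  by rewrite cE // eqxx (negbTE km) mulr1 mulr0 sub0r.
have D (F : 'I_n -> R) b : \sum_a F a * (a == b)%:R = F b.
  by rewrite (bigD1 b) //= eqxx mulr1 big1 ?addr0 // => a /negbTE ->; rewrite mulr0.
have S k' l' m' : \sum_a (N m' k a x * curv N k' l' a j x - curv N k' l' k a x * N m' a j x) =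
    schouten l' j x * N m' k k' x - schouten k' j x * N m' k l' x -
    \sum_a curv N k' l' k a x * N m' a j x.
  rewrite sumrB; congr (_ - _).
  rewrite -(D (fun a => schouten l' j x * N m' k a x) k').
  rewrite -(D (fun a => schouten k' j x * N m' k a x) l') -sumrB.
  by apply: eq_bigr => a _; rewrite cE //; ring.
rewrite p1 p2 p3 !S.
have -> : \sum_a curv N k l k a x * N m a j x = \sum_a schouten l a x * G c x a m j.
  by apply: eq_bigr => a _; rewrite cE // eqxx (negbTE kl) mulr1 mulr0 subr0.
have -> : \sum_a curv N l m k a x * N k a j x = 0.
  by rewrite big1 // => a _; rewrite cE // (negbTE kl) (negbTE km) !mulr0 subr0 mul0r.
have -> : \sum_a curv N m k k a x * N l a j x = - \sum_a schouten m a x * G c x a l j.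
  rewrite -sumrN; apply: eq_bigr => a _.
  by rewrite cE // eqxx (negbTE km) mulr1 mulr0 sub0r mulNr.
rewrite /N (tG k k m Ux) (tG k l m Ux) (tG k k l Ux) => E.
by apply: subr0_eq; rewrite -[RHS]E; ring.
Qed.

(* Parallel sections [(f, d_1 f, ..., d_n f)] of this connection are the
   solutions of [nabla_i d_j f + P_ij f = 0]. *)
Definition tractor (i : 'I_n) (a b : option 'I_n) : 'rV[R]_n -> R :=
  match a, b with
  | None, None => fun=> 0
  | None, Some j => fun=> (j == i)%:R
  | Some j, None => fun x => - schouten i j x
  | Some j, Some k => fun x => G c x k i j
  end.

Lemma smooth_tractor i a b : smooth_on U (tractor i a b).
Proof.
case: a b => [j|] [k|] /=; try exact: smooth_cst.
  exact: sG.
by apply: smoothN => //; exact: smooth_schouten.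
Qed.

Lemma sum_option (F : option 'I_n -> R) : \sum_a F a = F None + \sum_j F (Some j).
Proof.
rewrite (bigD1 None) //=; congr (_ + _).
rewrite (reindex_onto some (odflt (Ordinal (ltn_trans (isT : (0 < 2)%N) n2)))) /=; last by case.
by apply: eq_bigl => a; rewrite eqxx.
Qed.

(** The four blocks are, in the order of the cases, the curvature formula, the [cotton] identity,
    the absence of torsion and the symmetry of [schouten]. *)
Lemma tractor_flat x i l a b : U x ->
  pd i (tractor l a b) x + \sum_d tractor l a d x * tractor i d b x =
  pd l (tractor i a b) x + \sum_d tractor i a d x * tractor l d b x.
Proof.
move=> Ux; rewrite !sum_option.
have D (F : 'I_n -> R) b' : \sum_a (a == b')%:R * F a = F b'.
  by rewrite (bigD1 b') //= eqxx mul1r big1 ?addr0 // => d /negbTE ->; rewrite mul0r.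
case: a b => [j|] [k|] /=; rewrite ?pd_cst ?mul0r ?add0r ?D.
- have := curv_coef_schouten k j i l Ux; rewrite /curv_coef sumrB => E.
  apply: subr0_eq.
  have -> : \sum_i0 G c x i0 l j * G c x k i i0 = \sum_m G c x k i m * G c x m l j.
    by apply: eq_bigr => m _; rewrite mulrC.
  have -> : \sum_i0 G c x i0 i j * G c x k l i0 = \sum_m G c x k l m * G c x m i j.
    by apply: eq_bigr => m _; rewrite mulrC.
  move/eqP: E; rewrite -subr_eq0 => /eqP E; rewrite -[RHS]E; ring.
- rewrite !mulr0 !add0r pdN ?pdN; try exact: (smooth_diff (smooth_schouten _ _)).
  have E1 : \sum_d G c x d l j * - schouten i d x = - \sum_d schouten i d x * G c x d l j.
    by rewrite -sumrN; apply: eq_bigr => d _; rewrite mulrN mulrC.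
  have E2 : \sum_d G c x d i j * - schouten l d x = - \sum_d schouten l d x * G c x d i j.
    by rewrite -sumrN; apply: eq_bigr => d _; rewrite mulrN mulrC.
  rewrite E1 E2; have := cotton i l j Ux => E.
  apply: subr0_eq; move/eqP: E; rewrite -subr_eq0 => /eqP E; rewrite -[RHS]oppr0 -[in RHS]E; ring.
- exact: tG.
- by rewrite schouten_sym.
Qed.

End ProjectivelyFlat.

(** * Projective coordinates *)

Section ProjectiveChart.
Context {R : realType} {n : nat} {M : topologicalType}.

(** The intermediate value theorem on the segment from the origin to the point. *)
Lemma positive_on_ball (f : 'rV[R]_n -> R) (r : R) : smooth_on (ball 0 r) f ->
  (forall x, ball 0 r x -> f x != 0) -> 0 < f 0 -> forall x, ball 0 r x -> 0 < f x.
Proof.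
move=> sf fn f0 x /ball0P xr; rewrite lt_neqAle eq_sym fn /=; last exact/ball0P.
rewrite leNgt; apply/negP => fx.
have nr (t : R) : 0 <= t <= 1 -> ball 0 r (t *: x).
  by move=> t01; apply/ball0P; exact: norm_ray.
have cf : {within `[0, 1], continuous (fun t : R => f (t *: x))}.
  apply: derivable_continuous_within => t t01.
  by have [] := is_derive_ray (smooth_diff sf (nr t t01)).
have [|t + ft] := @IVT R (fun t : R => f (t *: x)) 0 1 0 ler01 cf.
  rewrite scale0r scale1r; apply/andP; split.
    by rewrite ge_min (ltW fx) orbT.
  by rewrite le_max (ltW f0).
rewrite in_itv /= => t01; by have := fn _ (nr t t01); rewrite ft eqxx.
Qed.

(** Both lower indices are contracted with the inverse Jacobian [K], under which [th] transforms as
    a covector. *)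
Lemma projective_connection_coef (J K : 'I_n -> 'I_n -> R) (Q : 'I_n -> 'I_n -> R)
    (th : 'I_n -> R) (a : 'I_n) :
  (forall a b, \sum_i J a i * K i b = (a == b)%:R) ->
  (forall j k, \sum_b \sum_e Q b e * J b j * J e k = J a j * th k + J a k * th j) ->
  forall b e, Q b e = (a == b)%:R * (\sum_k th k * K k e) + (a == e)%:R * (\sum_k th k * K k b).
Proof.
move=> JK QJ b e.
have E : \sum_j \sum_k (\sum_b' \sum_e' Q b' e' * J b' j * J e' k) * (K j b * K k e) =
    \sum_j \sum_k (J a j * th k + J a k * th j) * (K j b * K k e).
  by apply: eq_bigr => j _; apply: eq_bigr => k _; rewrite QJ.
transitivity (\sum_j \sum_k (\sum_b' \sum_e' Q b' e' * J b' j * J e' k) * (K j b * K k e)).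
  transitivity (\sum_b' \sum_e' Q b' e' * ((b' == b)%:R * (e' == e)%:R)).
    rewrite (bigD1 b) //= [X in _ + X]big1 ?addr0; last first.
      by move=> b' /negbTE ->; rewrite big1 // => e' _; rewrite mul0r mulr0.
    rewrite (bigD1 e) //= !eqxx !mulr1 big1 ?addr0 // => e' /negbTE ->.
    by rewrite !mulr0.
  transitivity (\sum_b' \sum_e' \sum_j \sum_k Q b' e' * J b' j * J e' k * (K j b * K k e)).
    apply: eq_bigr => b' _; apply: eq_bigr => e' _.
    rewrite -!JK big_distrlr big_distrr; apply: eq_bigr => j _ /=.
    by rewrite big_distrr; apply: eq_bigr => k _ /=; ring.
  under eq_bigr do rewrite exchange_big /=.
  rewrite exchange_big; apply: eq_bigr => j _ /=.
  under eq_bigr do rewrite exchange_big /=.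
  rewrite exchange_big; apply: eq_bigr => k _ /=.
  by rewrite big_distrl; apply: eq_bigr => b' _ /=; rewrite big_distrl.
rewrite E -!JK !big_distrlr /=.
rewrite [X in _ = _ + X]exchange_big -big_split; apply: eq_bigr => j _ /=.
by rewrite -big_split; apply: eq_bigr => k _ /=; ring.
Qed.

(** Writing f_a = g_a f_0 in the system, the terms with the Schouten tensor cancel. What remains
    expresses the covariant Hessian of g_a through its differential and [th], the logarithmic
    differential of f_0. *)
Lemma projective_coordinates (c : chart R n M) (G : conn_components R n M) (r0 : R) :
  (2 < n)%N -> open (cimg c) -> 0 < r0 -> ball 0 r0 `<=` cimg c ->
  (forall i j k, smooth_on (cimg c) (fun x => G c x i j k)) ->
  (forall x i j k, cimg c x -> G c x i j k = G c x i k j) ->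
  (forall x (X Y Z : 'rV[R]_n), cimg c x -> curvature G c x X Y Z =
    (n%:R - 1)^-1 *: (ricci G c x Y Z *: X - ricci G c x X Z *: Y)) ->
  exists (r : R) (g : 'rV[R]_n -> 'rV[R]_n) (th : 'I_n -> 'rV[R]_n -> R),
  [/\ 0 < r <= r0, forall a, smooth_on (ball 0 r) (fun x => g x 0 a), g 0 = 0,
      forall i a, pd i (fun x => g x 0 a) 0 = (i == a)%:R &
      forall x a j k, ball 0 r x ->
        \sum_i pd i (fun x => g x 0 a) x * G c x i j k =
        pd j (pd k (fun x => g x 0 a)) x +
        (pd j (fun x => g x 0 a) x * th k x + pd k (fun x => g x 0 a) x * th j x)].
Proof.
move=> n2 oU r00 sub sG tG pG.
have [||r1 /andP[r10 r1r0] sol] := @flat_system R n (option 'I_n) (tractor c G) r0 r00.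
- by move=> i a b; apply: smooth_sub sub _; exact: smooth_tractor.
- by move=> y yr i j a b; apply: tractor_flat => //; apply: sub; exact/ball0P.
(* The first index names the solution, [None] for f_0 and [Some a] for f_a; the second selects the
   function ([None]) or one of its derivatives. *)
have /boolp.choice[F HF] s := sol (fun b => (b == s)%:R).
have sF s b : smooth_on (ball 0 r1) (F s b) by have [_ h _] := HF s; exact: h.
have dF s i x : ball 0 r1 x -> pd i (F s None) x = F s (Some i) x.
  move=> /ball0P xr; have [_ _ ->] := HF s => //.
  rewrite (sum_option n2) /= mul0r add0r (bigD1 i) //= eqxx mul1r big1 ?addr0 //.
  by move=> j /negbTE ->; rewrite mul0r.
have ddF s i j x : ball 0 r1 x -> pd i (F s (Some j)) x =
    \sum_k G c x k i j * F s (Some k) x - schouten c G i j x * F s None x.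
  move=> /ball0P xr; have [_ _ ->] := HF s => //.
  by rewrite (sum_option n2) /= mulNr addrC.
have F0 s b : F s b 0 = (b == s)%:R by have [-> _ _] := HF s.
pose f0 := F None None.
have z1 : (ball 0 r1 : set 'rV[R]_n) 0 by apply/ball0P; rewrite normr0.
(* f_0 is 1 at the origin; varying by at most 1/2 it remains nonzero. *)
have half0 : 0 < 1 / 2 :> R by rewrite divr_gt0.
have [r2 r20 b2] := local_variation (f := fun _ : unit => f0) half0
  (fun _ => smooth_diff (sF None None) z1).
pose r := Num.min r1 r2.
have rpos : 0 < r by rewrite lt_min r10 r20.
have rr1 : r <= r1 by rewrite ge_min lexx.
have rr2 : r <= r2 by rewrite ge_min lexx orbT.
have sub1 : ball 0 r `<=` (ball 0 r1 : set 'rV[R]_n).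
  by move=> y /ball0P yr; apply/ball0P; exact: lt_le_trans rr1.
have fn0 x : ball 0 r x -> f0 x != 0.
  move=> /ball0P xr; have := b2 tt x (lt_le_trans xr rr2).
  rewrite /f0 F0 eqxx; apply: contraTneq => ->; rewrite sub0r normrN normr1 -ltNge.
  by rewrite ltr_pdivrMr // mul1r ltr1n.
have ob (e : R) : open (ball 0 e : set 'rV[R]_n) by apply: ball_open.
pose g x : 'rV[R]_n := \row_a (F (Some a) None x * (f0 x)^-1).
have gE a : (fun x => g x 0 a) = (fun x => F (Some a) None x * (f0 x)^-1).
  by apply/funext => x; rewrite mxE.
have sF' s b : smooth_on (ball 0 r) (F s b) by apply: (smooth_sub sub1); exact: sF.
have sf0 : smooth_on (ball 0 r) (fun x => (f0 x)^-1) by apply: smoothV => //; exact: sF'.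
have sg a : smooth_on (ball 0 r) (fun x => g x 0 a).
  by rewrite gE; apply: smoothM => //; exact: sF'.
have Dg a k x : ball 0 r x -> pd k (fun x => g x 0 a) x =
    (F (Some a) (Some k) x - g x 0 a * F None (Some k) x) * (f0 x)^-1.
  move=> xr; have d1 := smooth_diff (sF' (Some a) None) xr.
  have d2 := smooth_diff (sF' None None) xr.
  rewrite gE pdM //; last exact: (smooth_diff sf0).
  rewrite pdV //; last exact: fn0.
  rewrite !dF ?mxE; try exact: sub1.
  by rewrite mulrBl mulrN; congr (_ - _); ring.
exists r, g, (fun k x => F None (Some k) x * (f0 x)^-1); split.
- by rewrite rpos (le_trans rr1).
- exact: sg.
- by apply/rowP => a; rewrite !mxE F0 mul0r.
- move=> i a; rewrite Dg; last by apply/ball0P; rewrite normr0.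
  by rewrite mxE /f0 !F0 mul0r mul0r subr0 eqxx invr1 mulr1.
move=> x a j k xr.
have x1 := sub1 _ xr.
have dg := smooth_diff (sg a) xr.
have dFk s b := smooth_diff (sF' s b) xr.
have df0 : differentiable f0 x := dFk None None.
have H : pd j (pd k (fun x => g x 0 a)) x =
    (pd j (F (Some a) (Some k)) x - (pd j (fun x => g x 0 a) x * F None (Some k) x +
      g x 0 a * pd j (F None (Some k)) x)) * (f0 x)^-1 -
    pd k (fun x => g x 0 a) x * (F None (Some j) x * (f0 x)^-1).
  rewrite (pd_ext (U := ball 0 r) (ob _) (g := fun x =>
    (F (Some a) (Some k) x - g x 0 a * F None (Some k) x) * (f0 x)^-1)) //; last first.
    by move=> y yr; exact: Dg.
  rewrite pdM; last 2 first.
  - by apply: differentiableB => //; exact: differentiableM.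
  - exact: (smooth_diff sf0).
  rewrite pdV //; last exact: fn0.
  rewrite pdD //; last by apply: differentiableN; exact: differentiableM.
  rewrite pdN; last exact: differentiableM.
  rewrite pdM // (dF None j x x1) (Dg a k x xr).
  by rewrite mulrN; congr (_ - _); ring.
rewrite H !ddF //.
have -> : \sum_i pd i (fun x => g x 0 a) x * G c x i j k =
    (\sum_i G c x i j k * F (Some a) (Some i) x -
     g x 0 a * \sum_i G c x i j k * F None (Some i) x) * (f0 x)^-1.
  rewrite big_distrr /= -sumrB big_distrl /=; apply: eq_bigr => i _.
  by rewrite Dg //; ring.
have gf : g x 0 a * f0 x = F (Some a) None x by rewrite mxE mulfVK // fn0.
rewrite -gf -/f0; have := fn0 x xr.
move: (g x 0 a) (f0 x) (pd j _ x) (pd k _ x) (F None (Some k) x) (F None (Some j) x).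
move: (\sum_i _) (\sum_i _) (schouten c G j k x) => S1 S2 p gx f Jj Jk Fk Fj fn.
by field.
Qed.

End ProjectiveChart.

(** * Normal form of the connection and of the volume element *)

Section NormalForm.
Context {R : realType} {n : nat} {M : topologicalType}.

Lemma projective_chart (atlas : set (chart R n M)) (eta : cov_components R n M n)
    (G : conn_components R n M) (m : M) : (2 < n)%N ->
  smooth_atlas atlas -> equiprojective atlas eta G ->
  exists c rho th, [/\ atlas c, cdom c m, 0 < rho & cimg c = ball 0 rho] /\
    (forall x, ball 0 rho x -> 0 < volume_component eta c x) /\
    (forall x a b e, ball 0 rho x ->
       G c x a b e = (a == b)%:R * th e x + (a == e)%:R * th b x).
Proof.
move=> n2 sa [[veta [sG tG] tf _] pf].
have [c1 [ac1 mc1 mc10 eta1]] := centered_chart m (ltn_trans (isT : (0 < 2)%N) n2) sa veta.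
have [acharts _ _ _] := sa; have hc1 := acharts c1 ac1.
have [_ oU _ _ _] := hc1.
have U0 : cimg c1 0 by exists m.
have [r0 r00 sub0] := (proj1 (nbhs_ballP _ _)) (open_nbhs_nbhs (conj oU U0)).
have sG1 i j k : smooth_on (cimg c1) (fun x => G c1 x i j k) by exact: sG.
have tG1 x i j k : cimg c1 x -> G c1 x i j k = G c1 x i k j by move=> Ux; exact: tf.
have pG1 x (X Y Z : 'rV[R]_n) : cimg c1 x -> curvature G c1 x X Y Z =
    (n%:R - 1)^-1 *: (ricci G c1 x Y Z *: X - ricci G c1 x X Z *: Y).
  by move=> Ux; exact: pf.
have [r [g [th [/andP[rpos rr0] sg g0 Dg Hg]]]] :=
  projective_coordinates n2 oU r00 sub0 sG1 tG1 pG1.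
have [rho [V [h [[rho0 oV V0 Vr] [gP hP sh]]]]] := inverse_function rpos sg g0 Dg.
have ob (e : R) : open (ball 0 e : set 'rV[R]_n) by apply: ball_open.
have VU : V `<=` cimg c1.
  by move=> x /Vr /ball0P xr; apply: sub0; apply/ball0P; exact: lt_le_trans rr0.
have gP' x : V x -> ball 0 rho (g x) /\ h (g x) = x.
  by move=> /gP[/ball0P].
have hP' y : ball 0 rho y -> V (h y) /\ g (h y) = y by move=> /ball0P /hP.
have sgV a : smooth_on V (fun x => g x 0 a) by apply: (smooth_sub Vr).
pose c := change_chart c1 V g h.
have ac : atlas c by exact: (atlas_change sa ac1 oV (ob rho) VU gP' hP' sgV sh).
have ci : cimg c = ball 0 rho by exact: (cimg_change sa ac1 VU gP' hP').
have ov x : V x -> overlap c1 c x by exact: (overlap_change g h sa ac1 VU).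
have tr x : V x -> trans c1 c x = g x by exact: (trans_change g h sa ac1 VU).
have jacE x a i : V x -> jac c1 c x a i = pd i (fun z => g z 0 a) x.
  by exact: (jac_change g h sa ac1 oV VU).
have hessE x a i j : V x -> hess c1 c x a i j = pd i (pd j (fun z => g z 0 a)) x.
  by exact: (hess_change g h sa ac1 oV VU).
(* The covector field [th] is carried to the new coordinates by [h]. *)
exists c, rho, (fun k y => \sum_l th l (h y) * pd k (fun z => h z 0 l) y); split; last split.
- by split=> //; split=> //=; rewrite mc10.
- have [[seta teta] _ eta0] := veta.
  apply: positive_on_ball.
  + by rewrite -ci; exact: seta.
  + by move=> x; rewrite -ci; exact: eta0.
  + have J a i : jac c1 c 0 a i = 1 * (i == a)%:R by rewrite jacE // Dg mul1r.
    have := volume_component_diag (conj seta teta) ac1 ac (ov _ V0) J.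
    by rewrite big1 // mul1r tr // g0 => <-.
move=> y a b e yb; have [Vx gx] := hP' y yb; set x := h y in Vx gx *.
apply: (@projective_connection_coef R n (fun b i => pd i (fun z => g z 0 b) x)
  (fun i b => pd b (fun z => h z 0 i) y) (G c y a) (th ^~ x)).
- move=> a' b'; have := @pd_comp R n n (fun z => g z 0 a') h y b'.
  rewrite -/x => <-; last 2 first.
  + by move=> l; apply: (smooth_diff (sh l)).
  + exact: (smooth_diff (sgV a')).
  rewrite (pd_ext (ob rho) (g := fun z => z 0 a')) ?pd_coord 1?eq_sym //.
  by move=> z zb; rewrite (hP' z zb).2.
- move=> j k.
  have := tG c1 c x a j k ac1 ac (ov _ Vx).
  rewrite hessE // tr // gx; under eq_bigr do rewrite jacE //.
  rewrite Hg; last exact: Vr.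
  (* The transformation law and [Hg] have the same left-hand side and the same Hessian; cancelling
     it leaves the connection in the new chart. *)
  move/addrI => ->; apply: eq_bigr => b' _; apply: eq_bigr => e' _.
  by rewrite !jacE.
Qed.

Section Factor.
Variables (atlas : set (chart R n M)) (eta : cov_components R n M n)
  (G : conn_components R n M) (c : chart R n M) (th : 'I_n -> 'rV[R]_n -> R).
Hypothesis ve : volume_element atlas eta.
Hypothesis par : parallel atlas G eta.
Hypothesis ac : atlas c.
Hypothesis pos : forall x, cimg c x -> 0 < volume_component eta c x.
Hypothesis GE : forall x a b e, cimg c x ->
  G c x a b e = (a == b)%:R * th e x + (a == e)%:R * th b x.

(** The replaced tuple contains [l] twice, at places [a] and [l], so exchanging them both fixes the
    component and changes its sign. *)
Lemma volume_replace x (a l : 'I_n) : cimg c x -> l != a ->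
  eta c x (replace_index (ord_tuple n) a l) = 0.
Proof.
move=> cx la; have [_ alt _] := ve.
set i := replace_index _ _ _.
have := alt c x i (tperm a l) ac cx.
rewrite (_ : permute _ _ = i); last first.
  apply: eq_from_tnth => b; rewrite !tnth_mktuple !tnth_ord_tuple.
  case: tpermP => [->|->|ba bl].
  - by rewrite (negbTE la) eqxx.
  - by rewrite eqxx (negbTE la).
  - by rewrite (introF eqP ba).
rewrite odd_tperm eq_sym la expr1 mulN1r => /eqP.
by rewrite -addr_eq0 -mulr2n mulrn_eq0 => /eqP.
Qed.

(** Only [l = a] survives in the covariant derivative, leaving the trace of the connection: [th k]
    from each of the [n] indices and once more from [a = k]. *)
Lemma pd_volume x k : cimg c x ->
  pd k (volume_component eta c) x = n.+1%:R * th k x * volume_component eta c x.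
Proof.
move=> cx; have := par k (ord_tuple n) ac cx; rewrite /cov_deriv => /subr0_eq ->.
rewrite (eq_bigr (fun a => ((a == k)%:R * th a x + th k x) * volume_component eta c x)).
  rewrite -big_distrl /= big_split /= sumr_const card_ord (bigD1 k) //= eqxx mul1r.
  rewrite big1 ?addr0; last by move=> a /negbTE ->; rewrite mul0r.
  by rewrite -[th k x *+ n]mulr_natl -natr1; ring.
move=> a _; rewrite (bigD1 a) //= big1 ?addr0; last first.
  by move=> l la; rewrite volume_replace // mulr0.
rewrite tnth_ord_tuple GE // eqxx mul1r; congr (_ * _).
rewrite /volume_component; congr (eta c x _).
apply: eq_from_tnth => b; rewrite tnth_mktuple !tnth_ord_tuple.
by case: eqP => [->|].
Qed.

(** The reciprocal of the speed at which an affinely parametrised geodesic runs along its straight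
    line, for a suitable scale of the parameter. *)
Definition factor x := expR (2 * psi eta c x).

Lemma factor_gt0 x : 0 < factor x.
Proof. exact: expR_gt0. Qed.

Lemma factor_pd x k : cimg c x ->
  differentiable factor x /\ pd k factor x = 2 * th k x * factor x.
Proof.
move=> cx; have [[seta _] _ _] := ve.
have de : differentiable (volume_component eta c) x.
  exact: (smooth_diff (seta c (ord_tuple n) ac) cx).
have [d1 p1] := pd_comp_real k de (is_derive1_ln (pos cx)).
have l2 : is_derive (ln (volume_component eta c x)) 1
    (fun s => expR (2 * (n.+1%:R^-1 * s))) (2 * n.+1%:R^-1 * factor x).
  set t := ln _.
  have d0 : is_derive t (1 : R) (fun s : R => 2 * (n.+1%:R^-1 * s)) (2 * n.+1%:R^-1).
    have := is_deriveZ (2 * n.+1%:R^-1) (is_derive_id t (1 : R)).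
    rewrite [_ *: 1]mulr1; congr (is_derive t 1 _ _); apply/funext => s /=.
    by rewrite mulrA.
  rewrite [X in is_derive _ _ _ X]mulrC.
  exact: (is_derive1_comp (is_derive_expR _) d0).
have [d2 p2] := pd_comp_real k d1 l2.
split; first exact: d2.
rewrite -[LHS]/(pd k (fun z => expR (2 * (n.+1%:R^-1 * ln (volume_component eta c z)))) x).
rewrite p2 p1 pd_volume //.
have n0 : n.+1%:R != 0 :> R by rewrite pnatr_eq0.
have v0 := lt0r_neq0 (pos cx).
move: (n.+1%:R) n0 (volume_component eta c x) v0 => k1 k10 v1 v10.
by field; rewrite v10 k10.
Qed.

End Factor.

End NormalForm.

(** * Geodesics and Killing tensors *)

Local Opaque pd.

Lemma prolonged_lt (R : realType) (e : R) : 0 < e -> e < 1 + 2 * e /\ 1 + e < 1 + 2 * e.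
Proof. by move=> e0; split; lra. Qed.

Section Geodesics.
Context {R : realType} {n : nat} {M : topologicalType}.

(** The equation h' = 1 / g(h) is solved by quadrature: [h] inverts the primitive [tau] of [g], and
    [b] is the time [tau 1] needed to traverse the segment. *)
Lemma inverse_primitive (g : R -> R) : continuous g -> (forall s, 0 < g s) ->
  exists (b : R) (h : R -> R), [/\ 0 < b,
    forall t : R, 0 < t < b -> 0 < h t < 1 /\ is_derive t 1 h (g (h t))^-1 &
    forall s : R, 0 < s < 1 -> exists2 t : R, 0 < t < b & h t = s].
Proof.
move=> cg g0; have [tau tau0 dtau] := antiderivative cg.
have mono (s s' : R) : 0 <= s -> s < s' -> s' <= 1 -> tau s < tau s'.
  move=> s0 ss s1.
  have inn (u : R) : s <= u <= s' -> 0 <= u <= 1.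
    by move=> /andP[u1 u2]; rewrite (le_trans s0) // (le_trans u2).
  have [||u _ E] := @MVT R tau g s s' ss.
  - move=> u; rewrite in_itv /= => /andP[u1 u2]; apply: dtau; apply: inn.
    by rewrite !ltW.
  - by apply: derivable_continuous_within => u /inn u01; have [] := dtau u u01.
  by rewrite -subr_gt0 E mulr_gt0 // subr_gt0.
have h1 (t : R) : exists s, 0 < t < tau 1 -> 0 < s < 1 /\ tau s = t.
  case: (boolP (0 < t < tau 1)) => [/andP[t0 t1]|_]; last by exists 0.
  have [||s] := @IVT R tau 0 1 t ler01.
  - by apply: derivable_continuous_within => u u01; have [] := dtau u u01.
  - by rewrite tau0 ge_min (ltW t0) le_max (ltW t1) orbT.
  rewrite in_itv /= => /andP[s0 s1] ts; exists s => _; split=> //.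
  rewrite !lt_neqAle s0 s1 !andbT; apply/andP; split.
    by apply: contraTneq t0 => s00; rewrite -ts -s00 tau0 ltxx.
  by apply: contraTneq t1 => s11; rewrite -ts s11 ltxx.
have [h Hh] := boolp.choice h1.
have range (s : R) : 0 < s < 1 -> 0 < tau s < tau 1.
  by move=> /andP[s0 s1]; rewrite -{1}tau0 !mono // ltW.
have hK (s : R) : 0 < s < 1 -> h (tau s) = s.
  move=> s01; have [/andP[u0 u1] E] := Hh _ (range s s01); case/andP: s01 => s0 s1.
  case: (ltgtP (h (tau s)) s) => // lt.
    by have := mono _ _ (ltW u0) lt (ltW s1); rewrite E ltxx.
  by have := mono _ _ (ltW s0) lt (ltW u1); rewrite E ltxx.
exists (tau 1), h; split.
- by rewrite -{1}tau0 mono.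
- move=> t /Hh[ht E]; split=> //; rewrite -{1}E.
  have near01 : \forall s \near h t, 0 < s < 1.
    by have := @near_in_itvoo R 0 1 (h t); rewrite in_itv /=; apply.
  apply: is_derive_inverse.
  + by apply: filterS near01 => s; exact: hK.
  + apply: filterS near01 => s /andP[s0 s1].
    apply: differentiable_continuous; apply/derivable1_diffP.
    by have [] := dtau s; rewrite ?ltW.
  + by apply: dtau; case/andP: ht => s0 s1; rewrite !ltW.
  + by rewrite lt0r_neq0.
- by move=> s s01; exists (tau s); [exact: range|exact: hK].
Qed.

(** The algebra of the geodesic equation for a straight line seen in an arbitrary chart: [J0] and
    [H] are the differential and Hessian of one coordinate, [Jm] the Jacobian, [Q] the connection
    there. The acceleration due to the changing speed [q] absorbs the [th] terms. *)
Lemma geodesic_identity (J0 v th : 'I_n -> R) (Jm H Q : 'I_n -> 'I_n -> R) (q : R) :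
  (forall j k, \sum_l J0 l * ((l == j)%:R * th k + (l == k)%:R * th j) =
     H j k + \sum_b \sum_e Q b e * Jm b j * Jm e k) ->
  - (2 * (\sum_k th k * v k) * q * q) * (\sum_k v k * J0 k) +
    q * (\sum_k v k * \sum_l (q * v l) * H l k) +
  \sum_b \sum_e Q b e * (q * \sum_k v k * Jm b k) * (q * \sum_k v k * Jm e k) = 0.
Proof.
move=> E.
have D j k : \sum_l J0 l * ((l == j)%:R * th k + (l == k)%:R * th j) = J0 j * th k + J0 k * th j.
  have S (a : 'I_n) (z : R) : \sum_l J0 l * ((l == a)%:R * z) = J0 a * z.
    rewrite (bigD1 a) //= eqxx mul1r big1 ?addr0 // => l /negbTE ->.
    by rewrite mul0r mulr0.
  by under eq_bigr do rewrite mulrDr; rewrite big_split /= !S.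
have -> : \sum_b \sum_e Q b e * (q * \sum_k v k * Jm b k) * (q * \sum_k v k * Jm e k) =
    q * q * \sum_j \sum_k v j * v k * \sum_b \sum_e Q b e * Jm b j * Jm e k.
  transitivity (\sum_b \sum_e \sum_j \sum_k q * q * (v j * v k * (Q b e * Jm b j * Jm e k))).
    apply: eq_bigr => b _; apply: eq_bigr => e _.
    transitivity (q * q * Q b e * ((\sum_k v k * Jm b k) * (\sum_k v k * Jm e k))); first by ring.
    rewrite big_distrlr /= big_distrr /=; apply: eq_bigr => j _.
    by rewrite big_distrr /=; apply: eq_bigr => k _; ring.
  under eq_bigr do rewrite exchange_big /=.
  rewrite exchange_big big_distrr; apply: eq_bigr => j _ /=.
  under eq_bigr do rewrite exchange_big /=.
  rewrite exchange_big big_distrr; apply: eq_bigr => k _ /=.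
  rewrite !big_distrr; apply: eq_bigr => b _ /=.
  by rewrite !big_distrr.
have -> : \sum_j \sum_k v j * v k * (\sum_b \sum_e Q b e * Jm b j * Jm e k) =
   2 * (\sum_k th k * v k) * (\sum_k v k * J0 k) - \sum_k v k * \sum_l v l * H l k.
  transitivity (\sum_j \sum_k ((v j * J0 j) * (th k * v k) + (th j * v j) * (v k * J0 k) -
      v j * v k * H j k)).
    apply: eq_bigr => j _; apply: eq_bigr => k _.
    by move: (E j k); rewrite D => /eqP; rewrite -subr_eq addrC => /eqP <-; ring.
  under eq_bigr do rewrite sumrB big_split /=.
  rewrite sumrB big_split /= -!big_distrlr /=; congr (_ - _); first by ring.
  rewrite exchange_big; apply: eq_bigr => k _; rewrite big_distrr /=.
  by apply: eq_bigr => l _; ring.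
have -> : \sum_k v k * (\sum_l (q * v l) * H l k) = q * \sum_k v k * \sum_l v l * H l k.
  rewrite big_distrr; apply: eq_bigr => k _ /=; rewrite mulrCA; congr (_ * _).
  by rewrite big_distrr; apply: eq_bigr => l _ /=; rewrite mulrA.
move: (\sum_k _) (\sum_k _) (\sum_k _) => S1 S2 S3; ring.
Qed.

Variables (atlas : set (chart R n M)) (G : conn_components R n M) (c : chart R n M)
  (E : 'rV[R]_n -> R) (th : 'I_n -> 'rV[R]_n -> R).
Hypothesis sa : smooth_atlas atlas.
Hypothesis lc : linear_connection atlas G.
Hypothesis ac : atlas c.
Hypothesis E0 : forall x, 0 < E x.
Hypothesis dE : forall x, cimg c x -> differentiable E x.
Hypothesis pE : forall x k, cimg c x -> pd k E x = 2 * th k x * E x.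
Hypothesis GE : forall x a b e, cimg c x ->
  G c x a b e = (a == b)%:R * th e x + (a == e)%:R * th b x.

Section Line.
Variables (x v : 'rV[R]_n) (h : R -> R) (b : R).
Let y t := x + h t *: v.
Let q t := (E (y t))^-1.
Hypothesis yc : forall t : R, 0 < t < b -> cimg c (y t).
Hypothesis dh : forall t : R, 0 < t < b -> is_derive t 1 h (q t).
Definition line_geodesic (t : R) : M := cinv c (x + h t *: v).
Notation gamma := line_geodesic.

Let hc : is_chart c. Proof. by have [h1 _ _ _] := sa; exact: h1. Qed.

Lemma line_derive (t : R) k : 0 < t < b -> is_derive t 1 (fun s => y s 0 k) ((\row_k (q t * v 0 k)) 0 k).
Proof.
move=> tb; rewrite mxE.
have h1 : is_derive t (1 : R) (cst (x 0 k) : R -> R) (0 : R) by exact: is_derive_cst.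
have h2 : is_derive t (1 : R) (cst (v 0 k) : R -> R) (0 : R) by exact: is_derive_cst.
have := is_deriveD h1 (is_derive_mul (dh tb) h2).
rewrite mulr0 addr0 add0r; congr (is_derive t 1 _ _); apply/funext => s.
by rewrite /y !mxE.
Qed.

Lemma line_near (t : R) : 0 < t < b -> \forall s \near t, 0 < s < b.
Proof.
by move=> tb; have := @near_in_itvoo R 0 b t; rewrite in_itv /=; apply.
Qed.

Lemma line_continuous (t : R) : 0 < t < b -> {for t, continuous y}.
Proof.
move=> tb; apply: differentiable_continuous; apply/derivable1_diffP.
by have [] := derivable_curve (fun k => line_derive k tb).
Qed.

(** On a straight line the geodesic equation reduces to this equation for the speed; the relation
    [pE] between [E] and [th] is what makes [1 / E] solve it. *)
Lemma speed_derive (t : R) : 0 < t < b ->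
  is_derive t 1 q (- (2 * (\sum_k th k (y t) * v 0 k) * q t * q t)).
Proof.
move=> tb; have ct := yc tb.
have d1 := is_derive_curve (fun k => line_derive k tb) (dE ct).
have := is_deriveV (lt0r_neq0 (E0 (y t))) d1.
congr (is_derive t _ _ _).
rewrite (eq_bigr (fun k => (2 * q t * E (y t)) * (th k (y t) * v 0 k))); last first.
  by move=> k _; rewrite pE // !mxE; ring.
rewrite -big_distrr /= /q.
rewrite [LHS]mulNr; congr (- _).
move: (E (y t)) (lt0r_neq0 (E0 (y t))) (\sum_k _) => e e0 S.
by field.
Qed.

Lemma line_chart (t : R) : 0 < t < b -> cmap c (gamma t) = y t.
Proof. by move=> tb; have [] := cimg_cinv hc (yc tb). Qed.

Lemma line_overlap d (t : R) : 0 < t < b -> cdom d (gamma t) -> overlap c d (y t).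
Proof. by move=> tb dt; apply/(overlapP _ _ hc); split=> //; exact: yc. Qed.

Lemma coord_derive d (t : R) (i : 'I_n) : atlas d -> 0 < t < b -> overlap c d (y t) ->
  is_derive t 1 (Defs.coord d gamma i) (q t * \sum_k v 0 k * jac c d (y t) i k).
Proof.
move=> ad tb ov; have [_ _ acomp _] := sa.
have [sF _] := acomp c d ac ad i.
have := is_derive_curve (fun k => line_derive k tb) (smooth_diff sF ov).
congr (is_derive t _ _ _); rewrite big_distrr; apply: eq_bigr => k _ /=.
by rewrite mxE mulrA.
Qed.

Lemma velocityE d (t : R) (i : 'I_n) : atlas d -> 0 < t < b -> overlap c d (y t) ->
  velocity d gamma t i = q t * \sum_k v 0 k * jac c d (y t) i k.
Proof.
move=> ad tb ov; have h1 := coord_derive i ad tb ov.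
by rewrite /velocity derive1E derive_val.
Qed.

Lemma overlap_near d (t : R) : atlas d -> 0 < t < b -> overlap c d (y t) ->
  \forall s \near t, 0 < s < b /\ overlap c d (y s).
Proof.
move=> ad tb ov.
have [acharts _ _ _] := sa; have [ od _ _ _ _] := acharts d ad.
have N1 : nbhs t [set s | 0 < s < b] by exact: line_near.
have oo : open (overlap c d) by exact: open_overlap.
have N2 : nbhs t (y @^-1` overlap c d).
  by apply: (line_continuous tb); exact: (open_nbhs_nbhs (conj oo ov)).
exact: (@filterI _ (nbhs t) _ _ _ N1 N2).
Qed.

Lemma coord_derive2 d (t : R) (i : 'I_n) : atlas d -> 0 < t < b -> overlap c d (y t) ->
  is_derive t 1 (derive1 (Defs.coord d gamma i))
   (- (2 * (\sum_k th k (y t) * v 0 k) * q t * q t) * (\sum_k v 0 k * jac c d (y t) i k) +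
    q t * (\sum_k v 0 k * \sum_l (q t * v 0 l) * hess c d (y t) i l k)).
Proof.
move=> ad tb ov; have [acharts _ acomp _] := sa.
have [sF _] := acomp c d ac ad i.
have [ od _ _ _ _] := acharts d ad.
have oo : open (overlap c d) by exact: open_overlap.
apply: (near_eq_is_derive (f := fun s => q s * \sum_k v 0 k * jac c d (y s) i k)).
  apply: filterS (overlap_near ad tb ov) => s [sb os].
  exact: (esym (velocityE i ad sb os)).
apply: is_derive_mul; first exact: speed_derive.
apply: is_derive_bigsum => k.
rewrite -[X in is_derive _ _ _ X]add0r -[X in is_derive _ _ _ (X + _)](mul0r (jac c d (y t) i k)).
apply: (is_derive_mul (f := fun=> v 0 k)).
have sJ : smooth_on (overlap c d) (pd k (fun z => trans c d z 0 i)) by exact: smooth_pd.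
have := is_derive_curve (fun k => line_derive k tb) (smooth_diff sJ ov).
congr (is_derive t _ _ _); apply: eq_bigr => l _.
by rewrite mxE.
Qed.

Lemma line_is_geodesic : geodesic atlas G gamma 0 b.
Proof.
split=> [t tb|d t i ad tb dt].
  apply: (@continuous_comp _ _ _ y (cinv c)); first exact: line_continuous.
  by have [_ _ _ _ ci] := hc; apply: ci; exact: yc.
have ov := line_overlap tb dt.
have d1 := coord_derive i ad tb ov; have d2 := coord_derive2 i ad tb ov.
split; [by have [] := d1|by have [] := d2|].
rewrite derive1E derive_val.
have -> : cmap d (gamma t) = trans c d (y t) by [].
have hyp j k : \sum_l jac c d (y t) i l * ((l == j)%:R * th k (y t) + (l == k)%:R * th j (y t)) =
    hess c d (y t) i j k + \sum_b \sum_e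
      G d (trans c d (y t)) i b e * jac c d (y t) b j * jac c d (y t) e k.
  have := lc.2 c d (y t) i j k ac ad ov => <-.
  by apply: eq_bigr => l _; rewrite GE //; exact: yc.
rewrite -[RHS](geodesic_identity (v 0) (q t) hyp); congr (_ + _).
by apply: eq_bigr => j _; apply: eq_bigr => k _; rewrite !velocityE.
Qed.

Lemma eval_velocity_line p (phi : cov_components R n M p) (t : R) : 0 < t < b ->
  eval_velocity phi c gamma t = q t ^+ p * \sum_i phi c (y t) i * mon (v 0) i.
Proof.
move=> tb; rewrite /eval_velocity line_chart // big_distrr; apply: eq_bigr => i _ /=.
have ms := mon_scale (v 0) (q t) i; rewrite size_tuple in ms.
rewrite mulrCA; congr (_ * _); rewrite -ms mon_tuple.
apply: eq_bigr => a _.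
have cc : overlap c c (y t).
  by apply: line_overlap => //; have [] := cimg_cinv hc (yc tb).
rewrite velocityE //; congr (_ * _).
have [_ oi _ _ _] := hc.
rewrite (bigD1 (tnth i a)) //= big1 ?addr0 => [|k ka].
  rewrite /jac (pd_ext oi (g := fun z => z 0 (tnth i a))) ?pd_coord ?eqxx ?mulr1 //.
    by move=> z cz; rewrite trans_id.
  exact: yc.
rewrite /jac (pd_ext oi (g := fun z => z 0 (tnth i a))) ?pd_coord ?(negbTE ka) ?mulr0 //.
  by move=> z cz; rewrite trans_id.
exact: yc.
Qed.

End Line.

(** On the line through [x] and [z] the velocity is [k / E] times [z - x]; conservation of [phi] on
    it, after cancelling [k ^+ p], is the identity. *)
Lemma killing_flat (rho : R) p (phi : cov_components R n M p) (x z : 'rV[R]_n) :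
  cimg c = ball 0 rho -> killing_tensor atlas G phi -> `|x| < rho -> `|z| < rho ->
  \sum_i (E x)^-1 ^+ p * phi c x i * mon (fun k => z 0 k - x 0 k) i =
  \sum_i (E z)^-1 ^+ p * phi c z i * mon (fun k => z 0 k - x 0 k) i.
Proof.
move=> ci [_ kill] xr zr.
pose v := z - x.
(* The line is prolonged a little beyond [x] and [z], since geodesics are
   parametrised by open intervals. *)
pose e := Num.min (rho - `|x|) (rho - `|z|) / (1 + `|v|).
have v1 : 0 < 1 + `|v| by rewrite ltr_pwDl.
have e0 : 0 < e by rewrite divr_gt0 // lt_min !subr_gt0 xr zr.
(* The 1 in the denominator of [e] makes this strict and covers [x = z]. *)
have ev : e * `|v| < Num.min (rho - `|x|) (rho - `|z|).
  have -> : Num.min (rho - `|x|) (rho - `|z|) = e * (1 + `|v|).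
    by rewrite /e mulfVK // lt0r_neq0.
  by rewrite ltr_pM2l // ltrDr.
have [evx evz] : e * `|v| < rho - `|x| /\ e * `|v| < rho - `|z|.
  by move: ev; rewrite lt_min => /andP.
(* The segment prolonged by [e *: v] at both ends has direction [k *: v]; [x] and [z] sit at its
   parameters [e / k] and [(1 + e) / k], inside ]0, 1[. *)
pose k := 1 + 2 * e; have k0 : 0 < k by rewrite addr_gt0 // mulr_gt0.
pose x' := x - e *: v; pose v' := k *: v.
have x'r : `|x'| < rho.
  by apply: (le_lt_trans (ler_normB _ _)); rewrite normrZ gtr0_norm // addrC -ltrBrDr.
have z'E : x' + v' = z + e *: v.
  by apply/rowP => i; rewrite !mxE /k; ring.
have z'r : `|x' + v'| < rho.
  rewrite z'E; apply: (le_lt_trans (ler_normD _ _)).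
  by rewrite normrZ gtr0_norm // addrC -ltrBrDr.
have inb (s : R) : 0 <= s <= 1 -> cimg c (x' + s *: v').
  by move=> s01; rewrite ci; apply/ball0P; exact: norm_segment.
(* Clipping makes [g] continuous on the whole line, as [inverse_primitive] demands. *)
pose g (s : R) := E (x' + clip s *: v').
have cg : continuous g.
  move=> s; apply: (@continuous_comp _ _ _ clip (fun s => E (x' + s *: v'))).
    exact: continuous_clip.
  apply: differentiable_continuous; apply/derivable1_diffP.
  by have [] := is_derive_segment (dE (inb _ (clip01 s))).
have [b [h [b0 hP hS]]] := inverse_primitive cg (fun s => E0 _).
have h01 (t : R) : 0 < t < b -> 0 <= h t <= 1.
  by move=> /hP[/andP[h0 h1] _]; rewrite !ltW.
have yc (t : R) : 0 < t < b -> cimg c (x' + h t *: v') by move=> /h01; exact: inb.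
have dh (t : R) : 0 < t < b -> is_derive t 1 h (E (x' + h t *: v'))^-1.
  by move=> tb; have [_] := hP t tb; rewrite /g clip_id //; exact: h01.
have geo := line_is_geodesic yc dh.
have s1 : 0 < e / k < 1.
  by rewrite divr_gt0 //= ltr_pdivrMr // mul1r; exact: (prolonged_lt e0).1.
have s2 : 0 < (1 + e) / k < 1.
  apply/andP; split; first by apply: divr_gt0 => //; exact: addr_gt0.
  by rewrite ltr_pdivrMr // mul1r; exact: (prolonged_lt e0).2.
have [t1 t1b h1] := hS _ s1; have [t2 t2b h2] := hS _ s2.
have y1 : x' + h t1 *: v' = x.
  by rewrite h1 scalerA mulfVK ?lt0r_neq0 // subrK.
have y2 : x' + h t2 *: v' = z.
  rewrite h2 scalerA mulfVK ?lt0r_neq0 //.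
  by apply/rowP => i; rewrite !mxE; ring.
have dom t : 0 < t < b -> cdom c (cinv c (x' + h t *: v')).
  have [acharts _ _ _] := sa; have hc := acharts c ac.
  by move=> tb; have [] := cimg_cinv hc (yc t tb).
have := kill _ 0 b geo t1 t2 c c t1b t2b ac ac (dom _ t1b) (dom _ t2b).
rewrite !(eval_velocity_line yc dh) // y1 y2.
have vE (i : p.-tuple 'I_n) : mon (v' 0) i = k ^+ p * mon (fun k => z 0 k - x 0 k) i.
  have ms := mon_scale (fun k => z 0 k - x 0 k) k i; rewrite size_tuple in ms.
  rewrite -ms; apply: eq_bigr => l _.
  by rewrite !mxE.
under eq_bigr do rewrite vE mulrCA; under [in RHS]eq_bigr do rewrite vE mulrCA.
rewrite -!big_distrr /= mulrCA [RHS]mulrCA => /(mulfI (expf_neq0 p (lt0r_neq0 k0))).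
rewrite !big_distrr /= => eq.
transitivity (\sum_i (E x)^-1 ^+ p * (phi c x i * mon (fun k => z 0 k - x 0 k) i)).
  by apply: eq_bigr => i _; rewrite mulrA.
by rewrite eq; apply: eq_bigr => i _; rewrite mulrA.
Qed.

End Geodesics.

Theorem theorem2 (R : realType) (n : nat) (hn : (2 < n)%N)
    (M : topologicalType) (atlas : set (chart R n M))
    (eta : cov_components R n M n) (G : conn_components R n M)
    (hM : connected_manifold atlas) (hS : equiprojective atlas eta G) (m : M) :
  exists c : chart R n M,
    [/\ atlas c, cdom c m,
        forall x, cimg c x -> 0 < volume_component eta c x
      & forall (p : nat) (phi : cov_components R n M p),
          killing_tensor atlas G phi ->
          exists A : seq 'I_n -> R,
            [/\ coef_symmetric p A, coef_relations p A
              & forall x (i : p.-tuple 'I_n), cimg c x ->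
                  phi c x i = expR (2 * p%:R * psi eta c x) * poly_part A i x]].
Proof.
have [_ _ _ sa] := hM.
have [[ve lc _ par] _] := hS.
have [c [rho [th [[ac cm rho0 ci] [pos GE]]]]] := projective_chart m hn sa hS.
have pos' x : cimg c x -> 0 < volume_component eta c x by rewrite ci; exact: pos.
have GE' x a b e : cimg c x -> G c x a b e = (a == b)%:R * th e x + (a == e)%:R * th b x.
  by rewrite ci; exact: GE.
have fE x k (cx : cimg c x) := factor_pd ve par ac pos' GE' k cx.
exists c; split=> // p phi kphi.
pose E := factor eta c.
(* [factor_pd] delivers differentiability together with a partial derivative, so some direction has
   to be named. *)
have i0 : 'I_n := Ordinal (ltn_trans (isT : (0 < 2)%N) hn).
have [A [A1 A2 A3]] := @flat_killing_coefficients R n p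
  (fun i x => (E x)^-1 ^+ p * phi c x i) rho rho0
  (fun x i s xr => congr1 _ (kphi.1.2 c x i s ac (eq_ind_r (@^~ x) (proj2 (ball0P _ _) xr) ci)))
  (fun x z xr zr => killing_flat sa lc ac (factor_gt0 eta c)
    (fun y cy => (fE y i0 cy).1) (fun y k cy => (fE y k cy).2) GE' ci kphi xr zr).
exists A; split=> // x i; rewrite ci => /ball0P xr.
rewrite -A3 // mulrA; have -> : expR (2 * p%:R * psi eta c x) = E x ^+ p.
  by rewrite mulrAC expRM_natr.
by rewrite -exprMn mulfV ?expr1n ?mul1r // lt0r_neq0 // factor_gt0.
Qed.
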